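(* Let $\{Z_n\}$ be a critical Galton--Watson process with immigration satisfying condition (A) (as described in the context), with $\sigma=\beta/\gamma>1$. Let $\{X_i\}_{i\ge1}$ be i.i.d. real random variables, independent of $\{Z_n\}$, with $\mathbb{E}X_1=0$ and $\sigma_0^2:=\mathbb{E}X_1^2\in(0,\infty)$. Let $S_k=\sum_{i=1}^kX_i$ and $L_n=\frac{S_{Z_n}}{Z_n}I_{\{Z_n>0\}}$. Let $\varepsilon>0$ be a fixed number. (a) If $X_1^+$ has a tail of index $\alpha\in(1+\sigma,+\infty)$, then there exists $q(\varepsilon)>0$ such that $$\lim_{n\to\infty}n^{\sigma}\,\mathbb{P}(L_n\ge\varepsilon)=q(\varepsilon)<\infty.$$ (b) If $X_1^+$ has a tail of index $\alpha=1+\sigma$, then $$\lim_{n\to\infty}\frac{n^{\sigma}}{\log n}\,\mathbb{P}(L_n\ge\varepsilon)=\varepsilon^{-(\sigma+1)}a\,I(\sigma,\sigma)<\infty.$$ (c) If $X_1^+$ has a tail of index $\alpha\in(2,1+\sigma)$, then $$\lim_{n\to\infty}n^{\alpha-1}\,\mathbb{P}(L_n\ge\varepsilon)=\varepsilon^{-\alpha}a\,I(\alpha-1,\sigma)<\infty.$$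
   Context: Galton--Watson process with immigration: $\{\xi_{ni}: n,i\ge1\}$ are i.i.d. non-negative integer-valued random variables with generating function $f(s)=\sum_{i\ge0}p_is^i$; $\{Y_n:n\ge1\}$ are i.i.d. non-negative integer-valued random variables with generating function $h(s)=\sum_{i\ge0}h_is^i$, independent of $\{\xi_{ni}\}$. Define $Z_0=0$ and $Z_n=\sum_{i=1}^{Z_{n-1}}\xi_{ni}+Y_n$ for $n\ge1$. Let $m=\mathbb{E}\xi_{11}$, $\beta=h'(1)$, $\gamma=\frac12 f''(1)$, $\sigma=\beta/\gamma$. Condition (A): $\gcd\{k:p_k>0\}=1$, $0<p_0<1$, $0<h_0<1$, $m=1$, $0<\beta<\infty$, $0<\gamma<\infty$, $\sum_{j\ge1}p_jj^2\log j<\infty$, $\sum_{j\ge1}h_jj^2<\infty$. Tail index: $X_1^+=X_1\vee0$ has a tail of index $\alpha$ if $\mathbb{P}(X_1^+\ge x)\sim ax^{-\alpha}$ as $x\to\infty$ for some constant $a>0$; this is the constant $a$ in the claim. $I(\sigma,\sigma)=\frac{1}{\Gamma(\sigma)}\gamma^{-\sigma}$, and for $0<r<\sigma$, $I(r,\sigma)=\frac{1}{\Gamma(r)}\int_0^\infty(1+\gamma s)^{-\sigma}s^{r-1}\,ds$. $\Gamma$ is the Gamma function. *)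

(* Defs.v *)
From HB Require Import structures.
From mathcomp Require Import all_boot all_order all_algebra finmap.
From mathcomp Require Import all_classical all_reals all_analysis.

Set Implicit Arguments.
Unset Strict Implicit.
Unset Printing Implicit Defensive.

Import Order.TTheory GRing.Theory Num.Theory.
Import numFieldNormedType.Exports.

Local Open Scope classical_set_scope.
Local Open Scope ring_scope.
Local Open Scope ereal_scope.

Section Independence.
Context {d : measure_display} {T : measurableType d} {R : realType}.
Variable P : probability T R.

Definition mutually_independent (I : choiceType) (d' : measure_display)
    (U : measurableType d') (X : I -> T -> U) : Prop :=
  forall (J : {fset I}) (A : I -> set U), (forall i, measurable (A i)) ->
    P (\bigcap_(i in [set` J]) X i @^-1` A i)
    = \prod_(i <- J) P (X i @^-1` A i).

Definition identically_distributed (I : Type) (d' : measure_display)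
    (U : measurableType d') (X : I -> {RV P >-> U}) : Prop :=
  forall i j (A : set U), measurable A ->
    distribution P (X i) A = distribution P (X j) A.

Definition iid (I : choiceType) (d' : measure_display)
    (U : measurableType d') (X : I -> {RV P >-> U}) : Prop :=
  mutually_independent X /\ identically_distributed X.

Definition family_sigma_algebra (I : Type) (d' : measure_display)
    (U : measurableType d') (X : I -> T -> U) : set (set T) :=
  <<s \bigcup_i preimage_set_system setT (X i) measurable >>.

Definition independent_families (I J : Type) (d1 d2 : measure_display)
    (U : measurableType d1) (V : measurableType d2)
    (X : I -> T -> U) (Y : J -> T -> V) : Prop :=
  forall A B, family_sigma_algebra X A -> family_sigma_algebra Y B ->
    P (A `&` B) = P A * P B.

End Independence.

Section GaltonWatson.
Context {d : measure_display} {T : measurableType d} {R : realType}.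

Definition law_nat (P : probability T R) (N : {RV P >-> nat}) (k : nat) : R :=
  fine (P [set w | N w = k]).

(* Offspring and immigration variables are indexed from 0:
   [xi n i] is $\xi_{n+1,i+1}$ and [Y n] is $Y_{n+1}$. *)
Fixpoint gwi (xi : nat -> nat -> T -> nat) (Y : nat -> T -> nat)
    (n : nat) (w : T) : nat :=
  if n is n'.+1 then (\sum_(i < gwi xi Y n' w) xi n' i w + Y n' w)%N else 0%N.

(* [X i] is $X_{i+1}$. *)
Definition random_mean (Z : nat -> T -> nat) (X : nat -> T -> R)
    (n : nat) (w : T) : R :=
  if (0 < Z n w)%N then ((\sum_(i < Z n w) X i w) / (Z n w)%:R)%R else 0%R.

End GaltonWatson.

Section ConditionA.
Context {R : realType}.
Implicit Types p h : nat -> R.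

Definition gen_fun p (s : R) : R := limn (pseries p s).

(* The value at 1 of the k-th derivative of a generating function is its left
   limit at 1, the point 1 being possibly on the boundary of the disk of
   convergence. A finite value is meant, as [b] is real. *)
Definition gen_fun_deriv_at1 p (k : nat) (b : R) : Prop :=
  derive1n k (gen_fun p) s @[s --> (1%R : R)^'-] --> b.

Definition is_gcd_of (K : set nat) (g : nat) : Prop :=
  (forall k, K k -> (g %| k)%N) /\
  (forall e, (forall k, K k -> (e %| k)%N) -> (e %| g)%N).

(* [m] is the offspring mean; [beta] is h'(1) and [gamma] is f''(1) / 2. *)
Definition condition_A p h (m : \bar R) (beta gamma : R) : Prop :=
  [/\ is_gcd_of [set k | (0 < p k)%R] 1,
      (0 < p 0%N < 1)%R /\ (0 < h 0%N < 1)%R,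
      m = 1,
      [/\ (0 < beta)%R, gen_fun_deriv_at1 h 1 beta,
          (0 < gamma)%R & gen_fun_deriv_at1 p 2 (2 * gamma)%R] &
      \sum_(1 <= j <oo) (p j * j%:R ^+ 2 * ln j%:R)%:E < +oo /\
      \sum_(1 <= j <oo) (h j * j%:R ^+ 2)%:E < +oo].

End ConditionA.

Section Constants.
Context {R : realType}.

Definition Gamma (r : R) : R :=
  (\int[lebesgue_measure]_(t in `]0%R, +oo[) (t `^ (r - 1) * expR (- t)))%R.

Definition I_const (gamma r sigma : R) : \bar R :=
  ((Gamma r)^-1)%:E *
  (if r == sigma then (gamma `^ (- sigma))%:E
   else \int[lebesgue_measure]_(s in `]0%R, +oo[)
          ((1 + gamma * s) `^ (- sigma) * s `^ (r - 1))%:E).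

End Constants.

Definition tail_index {d : measure_display} {T : measurableType d}
    {R : realType} (P : probability T R) (X : {RV P >-> R})
    (a alpha : R) : Prop :=
  (0 < a)%R /\
  (fine (P [set w | (x <= Num.max (X w) 0)%R]) / (a * x `^ (- alpha)))%R
    @[x --> +oo%R] --> (1%R : R).

(* Main.v *)
Require Import Defs.
From HB Require Import structures.
From mathcomp Require Import all_boot all_order all_algebra finmap.
From mathcomp Require Import all_classical all_reals all_analysis.
From mathcomp Require Import measurable_realfun ring lra.

(* Conditioning on Z_n gives P(L_n >= eps) = sum_{k >= 1} P(Z_n = k) A_k with
   A_k = P(S_k >= k eps).  Since the tail of X is regularly varying, a large
   average comes from a single large summand, so A_k ~ a eps^-alpha k^(1-alpha).
   Everything then reduces to the harmonic moments E[Z_n^-r; Z_n > 0], with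
   r = alpha - 1.

   With g(t) = 1 - f(1 - t) = t - gamma t^2 + o(t^2), one has
   E (1 - t)^{Z_n} = prod_{j<n} h(1 - g^j(t)), and comparing
   ln h(1 - t) = - beta t + O(t^2) with sigma ln (g(t) / t) shows that this
   product is (1 + gamma n t)^-sigma exp(E_n(t)) with E_n bounded and small near
   t = 0, uniformly in n; the condition E[xi^2 log xi] < oo makes the errors
   summable along the orbit.  Inserting this in
   Gamma(r) E[Z_n^-r; Z_n > 0] = int_0^oo u^(r-1) E[exp(-u Z_n); Z_n > 0] du
   and rescaling u by n yields, for r < sigma, dominated convergence; for
   r = sigma, a logarithmically divergent integral over 1 << u << n.  For
   r > sigma the moment is carried by bounded values of Z_n, and
   n^sigma P(Z_n = k) converges for each k. *)

Set Implicit Arguments.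
Unset Strict Implicit.
Unset Printing Implicit Defensive.

Import Order.TTheory GRing.Theory Num.Theory.
Import numFieldNormedType.Exports.

Local Open Scope classical_set_scope.
Local Open Scope ring_scope.

(** * Iteration of the offspring map near its fixed point *)

(** The offspring law has barely more than two moments, so g(t) - t + gamma t^2 need not be O(t^3):
    the available bound is t^2 w(t), with w increasing and w(1 / (1 + c j)) / (1 + c j) summable in
    j. All errors on the orbit are therefore dominated, uniformly in t, through g^j(t) <= 1 / (1 + c
    j), which follows from g(t) <= t - c t^2 with c = p_0. The limit of E_n(t) for fixed t exists
    but has no closed form here; hence q in (a) is only obtained as the limit of a Cauchy sequence,
    and its positivity needs a separate comparison with the generating function at one small t.

    The Gamma integrals are used for exponents r > 1 only; this covers r = sigma > 1 and r = alpha -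
    1 > 1.

    For A_k, the Chernoff parameter is logarithmic in k: finite variance then keeps the k-fold
    product of truncated exponential moments bounded, and truncating at dl k with dl = eps / (2
    alpha) leaves a term k^-alpha, one power below the main term k^(1 - alpha).

    The analysis is carried out for abstract weights [a n] with generating function [H n]; the
    process enters only when these are instantiated. *)

Ltac nneg := try done; lazymatch goal with
  | |- is_true (_ <= ?x + ?y) => apply: addr_ge0; nneg
  | |- is_true (_ <= ?x ^+ 2) => apply: sqr_ge0
  | |- is_true (_ <= ?x * ?y) => apply: mulr_ge0; nneg
  | |- is_true (_ <= ?x^-1) => rewrite invr_ge0; nneg
  | |- is_true (_ <= ?x ^+ _) => apply: exprn_ge0; nneg
  | |- is_true (_ <= expR _) => apply: expR_ge0
  | |- is_true (_ <= powR _ _) => apply: powR_ge0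
  | |- _ => by apply: ltW
  end.

Section logarithm_estimates.
Context {R : realType}.
Implicit Types x y : R.

Lemma ln_le_subr1 y : 0 < y -> ln y <= y - 1.
Proof.
move=> y0; have : ln (1 + (y - 1)) <= y - 1 by apply: le_ln1Dx; lra.
by rewrite subrKC.
Qed.

Lemma ln_ge_1BV y : 0 < y -> 1 - y^-1 <= ln y.
Proof.
move=> y0; have := @ln_le_subr1 y^-1; rewrite invr_gt0 lnV ?posrE//.
by move=> /(_ y0); lra.
Qed.

(** From 1 - 1/y <= ln y <= y - 1: the gap between the two bounds is exactly (y - 1)^2 / y. *)
Lemma ln_approx y y0 : 0 < y0 -> y0 <= y -> `|ln y - (y - 1)| <= (y - 1) ^+ 2 / y0.
Proof.
move=> y00 y0y; have y_gt0 : 0 < y by lra.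
have h1 := ln_le_subr1 y_gt0; have h2 := ln_ge_1BV y_gt0.
rewrite distrC ger0_norm; last lra.
apply: (@le_trans _ _ ((y - 1) ^+ 2 / y)).
  have -> : (y - 1) ^+ 2 / y = y - 1 - (1 - y^-1) by field; lra.
  lra.
by rewrite ler_wpM2l ?sqr_ge0// lef_pV2 ?posrE.
Qed.

Lemma norm_ln_le y y0 : 0 < y0 <= 1 -> y0 <= y -> `|ln y| <= `|y - 1| / y0.
Proof.
move=> /andP[y00 y01] y0y; have y_gt0 : 0 < y by lra.
have h1 := ln_le_subr1 y_gt0; have h2 := ln_ge_1BV y_gt0.
have iy0 : 1 <= y0^-1 by rewrite invf_ge1.
have iy : y^-1 <= y0^-1 by rewrite lef_pV2 ?posrE.
have h3 : 1 - y^-1 = (y - 1) * y^-1 by field; lra.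
have iy1 : 0 < y^-1 by rewrite invr_gt0.
have [y1|y1] := leP 1 y.
  rewrite !ger0_norm ?subr_ge0//; last by rewrite ln_ge0.
  nra.
rewrite !ltr0_norm ?subr_lt0//; last by rewrite ln_lt0// y_gt0.
nra.
Qed.

End logarithm_estimates.

(* Shape of E (1 - t)^{Z_n} at criticality: up to a bounded factor exp(E n t)
   that tends to 1 as t -> 0 uniformly in n, it is the Gamma(sig) Laplace
   transform at n t. *)
Definition critical_asymptotics {R : realType} (gam sig : R)
    (H : nat -> R -> R) : Prop :=
  exists E : nat -> R -> R, [/\
    forall n (t : R), 0 < t <= 1 ->
      H n t = (1 + gam * n%:R * t) `^ (- sig) * expR (E n t),
    exists B : R, forall n (t : R), 0 < t <= 1 -> `|E n t| <= B,
    forall e : R, 0 < e -> exists2 del : R, 0 < del <= 1 &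
      forall n (t : R), 0 < t <= del -> `|E n t| <= e &
    forall t : R, 0 < t <= 1 -> cvgn (E ^~ t)].

Section iteration.
Context {R : realType}.
Variables (g hh w : R -> R) (beta gam sig c q0 h0 C : R).

Definition traj n (t : R) : R := iter n g t.
Definition traj_prod n (t : R) : R := \prod_(j < n) hh (traj j t).

(** In the application c = p_0, q0 = 1 - p_0, h0 = h_0 and w(t) = t + E(xi^2 min(1, xi t)). The
    condition E(xi^2 log xi) < oo is what yields [w_sum]. *)
Hypotheses (c_gt0 : 0 < c) (q0_gt0 : 0 < q0) (h0_gt0 : 0 < h0)
  (gam_gt0 : 0 < gam) (beta_gt0 : 0 < beta) (C_ge0 : 0 <= C)
  (betaE : beta = sig * gam)
  (g_ge : forall t : R, 0 < t <= 1 -> q0 * t <= g t)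
  (g_le : forall t : R, 0 < t <= 1 -> g t <= t - c * t ^+ 2)
  (g_approx : forall t : R, 0 < t <= 1 -> `|g t - t + gam * t ^+ 2| <= t ^+ 2 * w t)
  (hh_ge : forall t : R, 0 < t <= 1 -> h0 <= hh t)
  (hh_approx : forall t : R, 0 < t <= 1 -> `|hh t - 1 + beta * t| <= C * t ^+ 2)
  (w_ge : forall t : R, 0 < t <= 1 -> t <= w t)
  (w_homo : forall s t : R, 0 < s -> s <= t -> t <= 1 -> w s <= w t)
  (w_sum : cvgn (series (fun j => w (1 + c * j%:R)^-1 / (1 + c * j%:R)))).

Let sig_gt0 : 0 < sig.
Proof. by move: beta_gt0; rewrite betaE pmulr_lgt0. Qed.

Let w_ge0 (t : R) : 0 < t <= 1 -> 0 <= w t.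
Proof. by move=> t01; have := w_ge t01; lra. Qed.

Let w_le1 (t : R) : 0 < t <= 1 -> w t <= w 1.
Proof. by move=> /andP[t0 t1]; apply: w_homo. Qed.

Let g_in (t : R) : 0 < t <= 1 -> 0 < g t <= t.
Proof.
move=> t01; have h1 := g_ge t01; have h2 := g_le t01; case/andP: t01 => t0 t1.
have := mulr_gt0 q0_gt0 t0; have := mulr_gt0 c_gt0 (exprn_gt0 2 t0); lra.
Qed.

Lemma traj_in n (t : R) : 0 < t <= 1 -> 0 < traj n t <= t.
Proof.
move=> t01; elim: n => [|n /andP[h1 h2]] /=; first by rewrite /traj/=; lra.
have /g_in : 0 < traj n t <= 1 by lra.
by rewrite /traj/= -/(traj n t); lra.
Qed.

Lemma traj_in01 n (t : R) : 0 < t <= 1 -> 0 < traj n t <= 1.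
Proof. by move=> t01; have := traj_in n t01; lra. Qed.

(** Reciprocals turn quadratic decay into linear growth: (1 + c x)(x - c x^2) <= x gives 1 / g(x) >=
    1 / x + c at each step. *)
Lemma traj_geV n (t : R) : 0 < t <= 1 -> t^-1 + c * n%:R <= (traj n t)^-1.
Proof.
move=> t01; elim: n => [|n ih]; first by rewrite mulr0 addr0.
have x01 := traj_in01 n t01; rewrite {1}/traj iterS -/(traj n t).
set x := traj n t in ih x01 *.
have gx := g_in x01; have h := g_le x01.
apply: (@le_trans _ _ (x^-1 + c)); first by rewrite -natr1; lra.
rewrite -[leRHS]mul1r ler_pdivlMr; last lra.
have -> : x^-1 + c = (1 + c * x) / x by field; lra.
rewrite mulrAC ler_pdivrMr ?mul1r; last lra.
have cx : 0 < c * x by rewrite mulr_gt0//; lra.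
have : 0 <= c * x * (c * x) * x by rewrite mulr_ge0 ?sqr_ge0//; lra.
have : (1 + c * x) * g x <= (1 + c * x) * (x - c * x ^+ 2).
  by rewrite ler_wpM2l//; lra.
lra.
Qed.

Lemma traj_le n (t : R) : 0 < t <= 1 -> traj n t <= (1 + c * n%:R)^-1.
Proof.
move=> t01; have h1 := traj_geV n t01; have h2 := traj_in01 n t01.
have t1 : 1 <= t^-1 by rewrite invf_ge1; lra.
have n0 : 0 <= c * n%:R by rewrite mulr_ge0// ltW.
by rewrite -[leLHS]invrK lef_pV2 ?posrE ?invr_gt0; lra.
Qed.

Let den_in n : 0 < (1 + c * n%:R)^-1 <= 1.
Proof.
have n0 : 0 <= c * n%:R by rewrite mulr_ge0// ltW.
by rewrite invr_gt0 invf_le1 ?lerDl ?n0 ?andbT// ltr_wpDr.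
Qed.

Let wsummand j := w (1 + c * j%:R)^-1 / (1 + c * j%:R).

Let wsummand_ge0 j : 0 <= wsummand j.
Proof.
have := den_in j; rewrite /wsummand => h; rewrite mulr_ge0 ?w_ge0//; lra.
Qed.

Lemma traj_w_le n (t : R) : 0 < t <= 1 -> traj n t * w (traj n t) <= wsummand n.
Proof.
move=> t01; have h1 := traj_le n t01; have h2 := traj_in01 n t01.
rewrite /wsummand mulrC; apply: ler_pM => //; [exact: w_ge0| lra |].
by apply: w_homo => //; [lra|have := den_in n; lra].
Qed.

(** If w stayed above e, monotonicity would make the terms of [w_sum] at least e / (1 + c) times
    those of the harmonic series, which diverges. *)
Lemma w_small (e : R) : 0 < e -> exists2 del : R, 0 < del <= 1 &
  forall t : R, 0 < t <= del -> w t < e.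
Proof.
move=> e0; apply: contrapT => nH.
have we (t : R) : 0 < t <= 1 -> e <= w t.
  move=> t01; rewrite leNgt; apply/negP => wt; apply: nH; exists t => // s st.
  by apply: le_lt_trans wt; apply: w_homo; lra.
apply: (@dvg_harmonic R).
have c1 : 0 < 1 + c by rewrite addr_gt0.
pose K := e / (1 + c).
have K0 : 0 < K by rewrite divr_gt0.
have key n : n.+1%:R^-1 / (1 + c) <= (1 + c * n%:R)^-1.
  have n0 : 0 <= n%:R :> R by [].
  have c0 := c_gt0.
  rewrite -invfM lef_pV2 ?posrE ?mulr_gt0//; last by rewrite ltr_wpDr// mulr_ge0// ltW.
  lra.
have : cvgn (series (fun j => K * harmonic j)).
  apply: series_le_cvg w_sum => [n|n|n].
  - by rewrite mulr_ge0 ?harmonic_ge0// ltW.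
  - exact: wsummand_ge0.
  - rewrite /K/= /wsummand mulrAC -mulrA ler_pM ?we//; first exact: ltW.
      by rewrite divr_ge0 ?invr_ge0// ltW.
move=> /(@is_cvg_seriesZ _ _ K^-1); congr (cvgn (series _)).
all: by apply/funext => j; apply: mulKf; rewrite gt_eqF.
Qed.

(** Defects of the two leading-order relations. Since ln hh(t) is close to - beta t and ln (g(t) /
    t) to - gam t, the equality beta = sig gam cancels the first order in [rho]; [dlt] is the defect
    in 1 / g(t) = 1 / t + gam. *)
Let rho (t : R) := ln (hh t) - sig * ln (g t / t).
Let dlt (t : R) := (g t)^-1 - t^-1 - gam.

Lemma rho_bound : exists2 C1 : R, 0 <= C1 &
  forall t : R, 0 < t <= 1 -> `|rho t| <= C1 * (t * w t).
Proof.
exists (C + (beta + C) ^+ 2 / h0 + sig * (1 + (gam + w 1) ^+ 2 / q0)).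
  have := w_ge0 (t := 1); rewrite ltr01 lexx => /(_ isT) w1.
  have [q00 h00 s0] : [/\ 0 <= q0, 0 <= h0 & 0 <= sig] by split; exact: ltW.
  by nneg.
move=> t t01; have wt := w_ge t01; have w1t := w_le1 t01.
have [[[c0 q00] h00] gam0] := (c_gt0, q0_gt0, h0_gt0, gam_gt0).
have [[b0 C0] s0] := (beta_gt0, C_ge0, sig_gt0); have /andP[t0 t1] := t01.
have wt0 : 0 <= w t by lra.
have w10 : 0 <= w 1 by lra.
have a1 : `|ln (hh t) + beta * t| <= (C + (beta + C) ^+ 2 / h0) * t ^+ 2.
  have h1 := hh_approx t01; have h2 := ln_approx h0_gt0 (hh_ge t01).
  have -> : ln (hh t) + beta * t = (ln (hh t) - (hh t - 1)) + (hh t - 1 + beta * t) by ring.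
  apply: le_trans (ler_normD _ _) _; rewrite mulrDl addrC lerD//.
  apply: le_trans h2 _; rewrite [leRHS]mulrAC ler_pM2r ?invr_gt0// -exprMn.
  rewrite -ler_sqrt ?sqr_ge0// !sqrtr_sqr.
  rewrite [leRHS]ger0_norm; last by rewrite mulr_ge0//; lra.
  move: h1; rewrite !ler_norml; nra.
have a2 : `|ln (g t / t) + gam * t| <= (1 + (gam + w 1) ^+ 2 / q0) * (t * w t).
  have q0y : q0 <= g t / t by rewrite ler_pdivlMr ?g_ge//; lra.
  have h2 := ln_approx q0_gt0 q0y.
  have h1 : `|g t / t - 1 + gam * t| <= t * w t.
    have -> : g t / t - 1 + gam * t = (g t - t + gam * t ^+ 2) / t by field; lra.
    rewrite normrM normfV (gtr0_norm t0) ler_pdivrMr//.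
    by apply: le_trans (g_approx t01) _; rewrite expr2 mulrAC.
  have -> : ln (g t / t) + gam * t = (ln (g t / t) - (g t / t - 1)) + (g t / t - 1 + gam * t) by ring.
  apply: le_trans (ler_normD _ _) _; rewrite mulrDl mul1r addrC lerD//.
  apply: le_trans h2 _; rewrite [leRHS]mulrAC ler_pM2r ?invr_gt0//.
  apply: (@le_trans _ _ ((gam + w 1) ^+ 2 * (t * t))); last first.
    by rewrite ler_wpM2l ?sqr_ge0// ler_wpM2l//; lra.
  rewrite -expr2 -exprMn -ler_sqrt ?sqr_ge0// !sqrtr_sqr.
  rewrite [leRHS]ger0_norm; last by rewrite mulr_ge0 ?addr_ge0//; lra.
  move: h1; rewrite !ler_norml; nra.
have -> : rho t = (ln (hh t) + beta * t) - sig * (ln (g t / t) + gam * t).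
  by rewrite /rho betaE; ring.
apply: le_trans (ler_normB _ _) _; rewrite mulrDl lerD//.
  apply: le_trans a1 _; rewrite ler_wpM2l//.
    by rewrite addr_ge0 ?divr_ge0 ?sqr_ge0// ltW.
  by rewrite expr2 ler_wpM2l//; lra.
by rewrite normrM (gtr0_norm sig_gt0) -mulrA ler_wpM2l// ltW.
Qed.

Lemma dlt_bound : exists2 C2 : R, 0 <= C2 &
  forall t : R, 0 < t <= 1 -> `|dlt t| <= C2 * w t.
Proof.
exists ((1 + gam * (gam + w 1)) / q0).
  have := w_ge0 (t := 1); rewrite ltr01 lexx => /(_ isT) w1.
  have [q00 g00] : 0 <= q0 /\ 0 <= gam by split; exact: ltW.
  by nneg.
move=> t t01; have wt := w_ge t01; have w1t := w_le1 t01.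
have [[[c0 q00] h00] gam0] := (c_gt0, q0_gt0, h0_gt0, gam_gt0).
have [[b0 C0] s0] := (beta_gt0, C_ge0, sig_gt0); have /andP[t0 t1] := t01.
have wt0 : 0 <= w t by lra.
have w10 : 0 <= w 1 by lra.
have h1 := g_approx t01; have h2 := g_ge t01; have h3 := g_in t01.
(* Isolates the error of the quadratic approximation of g; the other part, gam t (t - g t), is
   O(t^3) and is absorbed because t <= w t. *)
have -> : dlt t = (- (g t - t + gam * t ^+ 2) + gam * t * (t - g t)) / (t * g t).
  by rewrite /dlt; field; rewrite !gt_eqF//; lra.
have tg : 0 < t * g t by rewrite mulr_gt0//; lra.
rewrite normrM [X in _ * X]gtr0_norm ?invr_gt0// ler_pdivrMr//.
have h4 : q0 * t ^+ 2 <= t * g t by nra.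
have h5 : `|t - g t| <= t ^+ 2 * (gam + w 1).
  have -> : t - g t = gam * t ^+ 2 - (g t - t + gam * t ^+ 2) by ring.
  apply: le_trans (ler_normB _ _) _; rewrite ger0_norm; last first.
    by rewrite mulr_ge0 ?sqr_ge0// ltW.
  by have := sqr_ge0 t; nra.
apply: (@le_trans _ _ (t ^+ 2 * w t * (1 + gam * (gam + w 1)))).
  apply: le_trans (ler_normD _ _) _; rewrite normrN [leRHS]mulrDr mulr1 lerD//.
  rewrite normrM ger0_norm; last by rewrite mulr_ge0//; lra.
  apply: (@le_trans _ _ (gam * t * (t ^+ 2 * (gam + w 1)))).
    by rewrite ler_wpM2l// mulr_ge0//; lra.
  have -> : gam * t * (t ^+ 2 * (gam + w 1)) = t ^+ 2 * t * (gam * (gam + w 1)) by ring.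
  by rewrite ler_wpM2r ?mulr_ge0 ?addr_ge0// ?ler_wpM2l ?sqr_ge0//; lra.
set K := 1 + gam * (gam + w 1).
have -> : t ^+ 2 * w t * K = K / q0 * w t * (q0 * t ^+ 2) by field; rewrite gt_eqF.
by rewrite ler_wpM2l// /K; nneg.
Qed.

Lemma traj_le1 n (t : R) : 0 < t <= 1 -> traj n t <= t.
Proof. by move=> /(traj_in n) /andP[]. Qed.

Lemma trajV n (t : R) : 0 < t <= 1 ->
  (traj n t)^-1 = t^-1 + gam * n%:R + \sum_(j < n) dlt (traj j t).
Proof.
move=> t01; elim: n => [|n ih]; first by rewrite big_ord0 mulr0 !addr0.
rewrite big_ord_recr/= -/(traj n t) -natr1 mulrDr mulr1.
have -> : (g (traj n t))^-1 = (traj n t)^-1 + gam + dlt (traj n t).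
  by rewrite /dlt; ring.
by rewrite ih; ring.
Qed.

Let Q n (t : R) : R := t / traj n t.

Let QE n (t : R) : 0 < t <= 1 ->
  Q n t = 1 + gam * n%:R * t + t * \sum_(j < n) dlt (traj j t).
Proof.
move=> t01; rewrite /Q trajV// !mulrDr divff; last by rewrite gt_eqF//; lra.
by rewrite [t * (gam * _)]mulrC.
Qed.

Lemma traj_prodS n (t : R) : traj_prod n.+1 t = traj_prod n t * hh (traj n t).
Proof. by rewrite /traj_prod big_ord_recr. Qed.

Lemma traj_prod_gt0 n (t : R) : 0 < t <= 1 -> 0 < traj_prod n t.
Proof.
move=> t01; apply: prodr_gt0 => j _.
by apply: lt_le_trans h0_gt0 _; apply/hh_ge/traj_in01.
Qed.

(** The terms ln (g(x) / x) telescope along the orbit to - ln Q, so only the defects [rho]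
    accumulate. *)
Lemma ln_traj_prod n (t : R) : 0 < t <= 1 ->
  ln (traj_prod n t) = \sum_(j < n) rho (traj j t) - sig * ln (Q n t).
Proof.
move=> t01; have hp j := lt_le_trans h0_gt0 (hh_ge (traj_in01 j t01)).
rewrite /Q; elim: n => [|n ih].
  by rewrite /traj_prod !big_ord0 /traj/= divff ?ln1 ?mulr0 ?subr0// gt_eqF//; lra.
have x01 := traj_in01 n t01; have gx := g_in x01.
have x'01 := traj_in01 n.+1 t01.
rewrite traj_prodS lnM ?posrE//; last exact: traj_prod_gt0.
rewrite ih big_ord_recr/= -/(traj n t) -/(traj n.+1 t) /rho.
by rewrite -/(traj n.+1 t)  !ln_div ?posrE; [ring|lra..].
Qed.

(** The E_n(t) of [critical_asymptotics]: the accumulated defects, plus the correction for replacing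
    Q by its leading form 1 + gam n t. *)
Definition traj_err n (t : R) : R :=
  \sum_(j < n) rho (traj j t) - sig * ln (Q n t / (1 + gam * n%:R * t)).

Let den_gt0 n (t : R) : 0 < t <= 1 -> 1 <= 1 + gam * n%:R * t.
Proof. by move=> t01; rewrite lerDl !mulr_ge0//; [exact: ltW|lra]. Qed.

Let Q_ge n (t : R) : 0 < t <= 1 -> 1 + c * n%:R * t <= Q n t.
Proof.
move=> t01; have := traj_in01 n t01; have h := traj_geV n t01 => x01.
rewrite /Q -(@ler_pM2l _ t^-1) ?mulKf ?invr_gt0 ?gt_eqF; try lra.
by rewrite mulrDr mulr1 [_ * t]mulrC mulKf// gt_eqF//; lra.
Qed.

Lemma traj_prodE n (t : R) : 0 < t <= 1 ->
  traj_prod n t = (1 + gam * n%:R * t) `^ (- sig) * expR (traj_err n t).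
Proof.
move=> t01; have d0 := den_gt0 n t01; have dp := lt_le_trans ltr01 d0.
have Q0 : 0 < Q n t.
  by have := traj_in01 n t01 => x01; rewrite /Q divr_gt0//; lra.
apply: ln_inj; rewrite ?posrE ?traj_prod_gt0 ?mulr_gt0 ?powR_gt0 ?expR_gt0//.
rewrite lnM ?posrE ?powR_gt0 ?expR_gt0// expRK ln_powR ln_traj_prod//.
by rewrite /traj_err ln_div ?posrE//; ring.
Qed.

(** The orbit stays below t, so the n defects [dlt] sum to at most n C2 w(t); multiplied by t and
    divided by 1 + gam n t >= gam n t, this loses its dependence on n. *)
Let Q_approx : exists2 K : R, 0 <= K & forall n (t : R), 0 < t <= 1 ->
  `|Q n t / (1 + gam * n%:R * t) - 1| <= K * w t.
Proof.
have [C2 C20 hC2] := dlt_bound; exists (C2 / gam) => [|n t t01].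
  by have gam0 := gam_gt0; nneg.
have d1 := den_gt0 n t01; have dp := lt_le_trans ltr01 d1.
have gam0 := gam_gt0; have wt0 := w_ge0 t01.
rewrite QE// mulrDl divff ?gt_eqF// addrAC subrr add0r !normrM normfV.
rewrite (gtr0_norm dp) ler_pdivrMr// gtr0_norm; last lra.
apply: (@le_trans _ _ (t * (C2 * w t *+ n))).
  rewrite ler_wpM2l//; first lra.
  rewrite -[n in leRHS]card_ord -sumr_const (le_trans (ler_norm_sum _ _ _))//.
  apply: ler_sum => j _; have tj := traj_in01 j t01.
  apply: le_trans (hC2 _ tj) _; rewrite ler_wpM2l// w_homo//; try lra.
  exact: traj_le1.
have -> : t * (C2 * w t *+ n) = C2 / gam * w t * (gam * n%:R * t).
  by rewrite -mulr_natr; field; rewrite gt_eqF.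
rewrite ler_wpM2l//; first by nneg.
lra.
Qed.

(** The cruder growth rate c of 1 / g^n(t) keeps the ratio away from 0, so that its logarithm can be
    bounded linearly. *)
Let Q_den_ge n (t : R) : 0 < t <= 1 ->
  c / (c + gam) <= Q n t / (1 + gam * n%:R * t).
Proof.
move=> t01; have d1 := den_gt0 n t01; have dp := lt_le_trans ltr01 d1.
have [gam0 c0] : 0 < gam /\ 0 < c by [].
have cg : 0 < c + gam by lra.
rewrite ler_pdivlMr//; apply: le_trans (Q_ge n t01).
rewrite mulrDr mulr1 lerD//; first by rewrite ler_pdivrMr//; lra.
rewrite !mulrA ler_wpM2r//; first lra.
by rewrite ler_wpM2r// mulrAC ler_pdivrMr// ler_wpM2l//; lra.
Qed.

Lemma traj_err_le : exists C1 K : R, [/\ 0 <= C1, 0 <= K & forall n (t : R),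
  0 < t <= 1 -> `|traj_err n t| <=
  C1 * \sum_(j < n) traj j t * w (traj j t) + K * w t].
Proof.
have [C1 C10 hC1] := rho_bound; have [K K0 hK] := Q_approx.
have [gam0 c0 s0] : [/\ 0 < gam, 0 < c & 0 < sig] by [].
have cg : 0 < c + gam by lra.
have y0 : 0 < c / (c + gam) by rewrite divr_gt0.
have y1 : c / (c + gam) <= 1 by rewrite ler_pdivrMr//; lra.
exists C1, (sig * (K / (c / (c + gam)))); split => //; first by nneg.
move=> n t t01; apply: le_trans (ler_normB _ _) _; rewrite lerD//.
  rewrite mulr_sumr (le_trans (ler_norm_sum _ _ _))//.
  by apply: ler_sum => j _; apply/hC1/traj_in01.
rewrite normrM (gtr0_norm s0) -[leRHS]mulrA ler_wpM2l//; first lra.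
apply: le_trans (norm_ln_le _ (Q_den_ge n t01)) _; first by rewrite y0 y1.
by rewrite [leRHS]mulrAC ler_wpM2r ?hK// invr_ge0 ltW.
Qed.

Let wsum_le n : series wsummand n <= limn (series wsummand).
Proof.
apply: nondecreasing_cvgn_le; last exact: w_sum.
by apply: nondecreasing_series => j _ _; exact: wsummand_ge0.
Qed.

Lemma traj_err_bounded : exists B : R, forall n (t : R), 0 < t <= 1 ->
  `|traj_err n t| <= B.
Proof.
have [C1 [K [C10 K0 h]]] := traj_err_le.
exists (C1 * limn (series wsummand) + K * w 1) => n t t01.
apply: le_trans (h n t t01) _; rewrite lerD// ler_wpM2l//; last exact: w_le1.
apply: le_trans (wsum_le n); rewrite seriesEord /=.
by apply: ler_sum => j _; exact: traj_w_le.
Qed.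

(** The series dominating the sum does not depend on t: its tail after J is below e / 2, and each of
    the first J terms is at most t w(1). *)
Lemma traj_sum_small (e : R) : 0 < e -> exists2 del : R, 0 < del <= 1 &
  forall n (t : R), 0 < t <= del ->
  \sum_(j < n) traj j t * w (traj j t) <= e.
Proof.
move=> e0; pose L := limn (series wsummand).
have [J _ hJ] : \forall n \near \oo, `|L - series wsummand n| < e / 2.
  by move/cvgrPdist_lt : w_sum; apply; rewrite divr_gt0.
have {}hJ := hJ J (leqnn J).
have w1 : 0 <= w 1 by apply: w_ge0; rewrite ltr01 lexx.
pose D := 1 + J%:R * w 1 *+ 2 / e.
have JJ : 0 <= J%:R * w 1 by rewrite mulr_ge0.
have D1 : 1 <= D by rewrite /D lerDl divr_ge0 ?mulrn_wge0// ltW.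
have D0 := lt_le_trans ltr01 D1.
(* [D] is chosen so that J w(1) / D <= e / 2. *)
exists D^-1 => [|n t tD]; first by rewrite invr_gt0 D0 invf_le1.
have t01 : 0 < t <= 1 by have : D^-1 <= 1; [rewrite invf_le1|lra].
have x0 j : 0 <= traj j t * w (traj j t).
  by have := traj_in01 j t01 => xj; rewrite mulr_ge0 ?w_ge0//; lra.
apply: (@le_trans _ _ (\sum_(0 <= j < J + n) traj j t * w (traj j t))).
  rewrite addnC -(big_mkord xpredT (fun j => traj j t * w (traj j t))).
  by rewrite [leRHS](@big_cat_nat _ _ _ n) ?leq_addr//= lerDl sumr_ge0.
rewrite (@big_cat_nat _ _ _ J) ?leq_addr//= [e]splitr lerD//.
  apply: (@le_trans _ _ (t * w 1 *+ J)).
    rewrite -[X in _ *+ X]subn0 -sumr_const_nat; apply: ler_sum => j _.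
    have xj := traj_in01 j t01; rewrite ler_pM ?traj_le1 ?w_le1//; first lra.
    exact: w_ge0.
  case/andP: tD => t0 tD.
  apply: (@le_trans _ _ (D^-1 * w 1 *+ J)); first by rewrite lerMn2r ler_wpM2r ?orbT.
  have De : e / 2 * D = e / 2 + J%:R * w 1 by rewrite /D; field; rewrite gt_eqF.
  by rewrite -mulr_natr -mulrA mulrC ler_pdivrMr// De mulrC lerDr ltW// divr_gt0.
apply: (@le_trans _ _ (\sum_(J <= j < J + n) wsummand j)).
  by apply: ler_sum => j _; exact: traj_w_le.
have := wsum_le (J + n); rewrite -/L seriesEnat/= (@big_cat_nat _ _ _ J) ?leq_addr//=.
move: hJ; rewrite seriesEnat/= ltr_norml; lra.
Qed.

Lemma traj_err_small (e : R) : 0 < e -> exists2 del : R, 0 < del <= 1 &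
  forall n (t : R), 0 < t <= del -> `|traj_err n t| <= e.
Proof.
move=> e0; have [C1 [K [C10 K0 h]]] := traj_err_le.
have c1 : 0 < 1 + C1 by lra.
have k1 : 0 < 1 + K by lra.
have [d1 d11 h1] : exists2 del : R, 0 < del <= 1 & forall n (t : R), 0 < t <= del ->
  \sum_(j < n) traj j t * w (traj j t) <= e / 2 / (1 + C1).
  by apply: traj_sum_small; rewrite !divr_gt0.
have [d2 d21 h2] : exists2 del : R, 0 < del <= 1 & forall (t : R), 0 < t <= del ->
  w t < e / 2 / (1 + K) by apply: w_small; rewrite !divr_gt0.
exists (Num.min d1 d2) => [|n t]; first by rewrite lt_min ge_min; lra.
rewrite le_min => /and3P[t0 td1 td2].
have t01 : 0 < t <= 1 by lra.
apply: le_trans (h n t t01) _; rewrite [e]splitr lerD//.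
  apply: (@le_trans _ _ (C1 * (e / 2 / (1 + C1)))); first by rewrite ler_wpM2l// h1// t0.
  by rewrite mulrCA ger_pMr ?divr_gt0// ler_pdivrMr//; lra.
apply: (@le_trans _ _ (K * (e / 2 / (1 + K)))).
  by rewrite ler_wpM2l// ltW// h2// t0.
by rewrite mulrCA ger_pMr ?divr_gt0// ler_pdivrMr//; lra.
Qed.

Let traj_cvg0 (t : R) : 0 < t <= 1 -> traj n t @[n --> \oo] --> (0 : R).
Proof.
move=> t01; apply/cvgrPdist_lt => e e0; have c0 := c_gt0.
exists (Num.truncn (c * e)^-1).+1 => // n /= hn; rewrite sub0r normrN.
have xn := traj_in01 n t01; rewrite gtr0_norm; last lra.
have ce : 0 < c * e by rewrite mulr_gt0.
apply: le_lt_trans (traj_le n t01) _.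
rewrite -[ltRHS]invrK ltf_pV2 ?posrE ?invr_gt0//; last first.
  by have := den_in n; rewrite invr_gt0 => /andP[].
have : (c * e)^-1 < n%:R.
  by apply: lt_le_trans (truncnS_gt _) _; rewrite ler_nat.
rewrite invfM ltr_pdivrMl//; lra.
Qed.

Let dlt_cvg0 (t : R) : 0 < t <= 1 -> dlt (traj n t) @[n --> \oo] --> (0 : R).
Proof.
move=> t01; apply/cvgrPdist_lt => e e0; have [C2 C20 hC2] := dlt_bound.
have c2 : 0 < 1 + C2 by lra.
have [d d01 hd] : exists2 del : R, 0 < del <= 1 & forall (t : R), 0 < t <= del ->
  w t < e / (1 + C2) by apply: w_small; rewrite divr_gt0.
have /cvgrPdist_lt/(_ d) := traj_cvg0 t01; move/andP : d01 => [d0 d1] /(_ d0)[N _ hN].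
exists N => // n /hN /=; rewrite !sub0r !normrN => xd.
have xn := traj_in01 n t01.
have xd' : traj n t <= d by apply: le_trans (ltW xd); exact: ler_norm.
apply: le_lt_trans (hC2 _ xn) _.
apply: (@le_lt_trans _ _ (C2 * (e / (1 + C2)))).
  by rewrite ler_wpM2l// ltW// hd//; lra.
by rewrite mulrCA gtr_pMr// ltr_pdivrMr//; lra.
Qed.

(** The defects [rho] form an absolutely convergent series by the same domination, and Q / (1 + gam
    n t) tends to 1 because the Cesaro means of [dlt] along the orbit tend to 0. *)
Lemma traj_err_cvg (t : R) : 0 < t <= 1 -> cvgn (traj_err ^~ t).
Proof.
move=> t01; apply: is_cvgB; last first.
  apply: is_cvgM; first exact: is_cvg_cst.
  suff : Q n t / (1 + gam * n%:R * t) @[n --> \oo] --> (1 : R).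
    by move=> h; apply/cvgP/(cvg_comp _ _ h (continuous_ln ltr01)).
  rewrite -cvg_shiftS; apply/cvgrPdist_le => e e0; have gam0 := gam_gt0.
  have ge0 : 0 < gam * e by rewrite mulr_gt0.
  have /cesaro/cvgrPdist_le/(_ _ ge0)[N _ hN] := dlt_cvg0 t01.
  exists N => // n /hN /=; rewrite sub0r normrN normrM gtr0_norm ?invr_gt0// => hn.
  have d1 := den_gt0 n.+1 t01; have dp := lt_le_trans ltr01 d1.
  rewrite distrC QE// mulrDl divff ?gt_eqF// addrAC subrr add0r normrM normrM normfV.
  rewrite (gtr0_norm dp) ler_pdivrMr// gtr0_norm; last lra.
  move: hn; rewrite seriesEord/= ler_pdivrMl// => hn.
  apply: (@le_trans _ _ (t * (n.+1%:R * (gam * e)))); first by rewrite ler_wpM2l//; lra.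
  lra.
suff : cvgn (series (fun j => rho (traj j t))) by rewrite seriesEord.
apply: normed_cvg.
have [C1 C10 hC1] := rho_bound.
apply: (@series_le_cvg _ _ (fun j => C1 * wsummand j)) => [n|n|n|].
- exact: normr_ge0.
- by rewrite mulr_ge0.
- apply: le_trans (hC1 _ (traj_in01 n t01)) _.
  by rewrite ler_wpM2l// traj_w_le.
exact: (@is_cvg_seriesZ _ _ C1 w_sum).
Qed.

Lemma traj_prod_asymptotics : critical_asymptotics gam sig traj_prod.
Proof.
exists (traj_err); split; first exact: traj_prodE.
- exact: traj_err_bounded.
- exact: traj_err_small.
- exact: traj_err_cvg.
Qed.

End iteration.

(** The constant is the maximum of u^s exp(- c u), reached at u = s / c; the bound is ln y <= y - 1
    at y = u c / s. *)
Lemma powR_le_expR {R : realType} (s c : R) : 0 < s -> 0 < c ->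
  exists2 C : R, 0 < C & forall u : R, 0 < u -> u `^ s <= C * expR (c * u).
Proof.
move=> s0 c0; exists (expR (s * (ln (s / c) - 1))) => [|u u0]; first exact: expR_gt0.
have ucs : 0 < u * c / s by rewrite divr_gt0 ?mulr_gt0.
have sc : 0 < s / c by rewrite divr_gt0.
rewrite -expRD /powR gt_eqF// ler_expR.
have -> : u = (u * c / s) * (s / c) by field; rewrite !gt_eqF.
rewrite lnM ?posrE//; have := ln_le_subr1 ucs.
have -> : c * (u * c / s * (s / c)) = s * (u * c / s) by field; rewrite !gt_eqF.
rewrite -mulrDr => h; rewrite ler_pM2l//; lra.
Qed.

Lemma onemX_le_powR {R : realType} (t r : R) : 0 < t <= 1 -> 0 < r ->
  exists2 C : R, 0 < C &
    forall k : nat, (0 < k)%N -> (1 - t) ^+ k <= C * k%:R `^ (- r).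
Proof.
move=> /andP[t0 t1] r0; have [C C0 hC] := powR_le_expR r0 t0.
exists C => // k k0; have kR : 0 < k%:R :> R by rewrite ltr0n.
rewrite powRN ler_pdivlMr ?powR_gt0//.
apply: (@le_trans _ _ (expR (- t) ^+ k * (C * expR (t * k%:R)))).
  rewrite ler_pM ?powR_ge0 ?exprn_ge0 ?hC ?subr_ge0//.
  by rewrite lerXn2r ?nnegrE ?expR_ge0 ?subr_ge0// expR_ge1Dx.
by rewrite -expRM_natr mulrCA -expRD mulNr addNr expR0 mulr1.
Qed.

Lemma continuous_powRl {R : realType} (s x : R) : 0 < x ->
  {for x, continuous (fun y : R => y `^ s)}.
Proof.
move=> x0; apply: differentiable_continuous; apply/derivable1_diffP.
by apply: derivable_powR; rewrite in_itv/= x0.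
Qed.

Lemma onem_expRN_le {R : realType} (x : R) : 1 - expR (- x) <= x.
Proof. by have := expR_ge1Dx (- x); lra. Qed.

Lemma onem_expRN_ge {R : realType} (x : R) : 0 <= x ->
  x / (1 + x) <= 1 - expR (- x).
Proof.
move=> x0; have h := expR_ge1Dx x; rewrite expRN ler_pdivrMr; last lra.
have : (expR x)^-1 * (1 + x) <= 1 by rewrite mulrC ler_pdivrMr ?expR_gt0// mul1r.
lra.
Qed.

(** * Bounds and limits drawn from the critical asymptotics *)

Section asymptotics_consequences.
Context {R : realType}.
Variables (gam sig : R) (H : nat -> R -> R).
Hypotheses (gam_gt0 : 0 < gam) (sig_gt0 : 0 < sig).
Hypothesis asym : critical_asymptotics gam sig H.

Lemma asym_upper : exists2 B : R, 0 < B & forall n (t : R), 0 < t <= 1 ->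
  n%:R `^ sig * H n t <= B * t `^ (- sig).
Proof.
have [E [HE [B hB] _ _]] := asym; have [g0 s0] := (gam_gt0, sig_gt0).
exists (gam `^ (- sig) * expR B) => [|n t t01].
  by rewrite mulr_gt0 ?powR_gt0 ?expR_gt0.
have /andP[t0 t1] := t01.
case: n => [|n].
  rewrite powR0 ?gt_eqF// mul0r !mulr_ge0 ?powR_ge0 ?expR_ge0//.
have n0 : 0 < n.+1%:R :> R by [].
rewrite HE// mulrA [leRHS]mulrAC ler_pM ?mulr_ge0 ?powR_ge0 ?expR_ge0//; last first.
  by rewrite ler_expR (le_trans _ (hB n.+1 t t01))// ler_norm.
rewrite -powRM; [|lra..].
rewrite !powRN -[n.+1%:R `^ sig]invrK -invfM lef_pV2 ?posrE; last 2 first.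
  by rewrite mulr_gt0 ?invr_gt0 ?powR_gt0// addr_gt0 ?mulr_gt0.
  by rewrite powR_gt0 ?mulr_gt0.
rewrite ler_pdivlMl ?powR_gt0// -powRM; [|by rewrite ?mulr_ge0// ltW..].
apply: ge0_ler_powR; rewrite ?nnegrE; [by nneg|by nneg|by nneg|lra].
Qed.

Let ratioE n (t : R) : 0 < t <= 1 ->
  n%:R `^ sig * (1 + gam * n%:R * t) `^ (- sig) =
  (n%:R / (1 + gam * n%:R * t)) `^ sig.
Proof.
move=> /andP[t0 t1]; have g0 := gam_gt0.
have d0 : 0 < 1 + gam * n%:R * t by rewrite ltr_wpDr// !mulr_ge0// ltW.
by rewrite powRM// ?invr_ge0 ?ltW// -powR_inv1 ?ltW// -powRrM mulN1r.
Qed.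

Let ratio_cvg (t : R) : 0 < t <= 1 ->
  n%:R / (1 + gam * n%:R * t) @[n --> \oo] --> (gam * t)^-1.
Proof.
move=> /andP[t0 t1]; have g0 := gam_gt0; have gt0 := mulr_gt0 g0 t0.
rewrite -cvg_shiftS /=.
have -> : (fun n : nat => n.+1%:R / (1 + gam * n.+1%:R * t)) =
          (fun n : nat => (harmonic n + gam * t)^-1).
  apply/funext => n /=; have n0 : 0 < n.+1%:R :> R by [].
  have d0 : 0 < 1 + gam * n.+1%:R * t by rewrite ltr_wpDr// !mulr_ge0// ltW.
  have -> : n.+1%:R^-1 + gam * t = (1 + gam * n.+1%:R * t) / n.+1%:R.
    by field; rewrite gt_eqF.
  by rewrite invf_div.
apply: cvgV; first by rewrite gt_eqF.
rewrite -[X in _ --> X]add0r; apply: cvgD; first exact: cvg_harmonic.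
exact: cvg_cst.
Qed.

Lemma asym_pointwise (t : R) : 0 < t <= 1 ->
  exists2 l : R, 0 < l & n%:R `^ sig * H n t @[n --> \oo] --> l.
Proof.
move=> t01; have [E [HE _ _ cE]] := asym; have /andP[t0 t1] := t01.
have gt0 := mulr_gt0 gam_gt0 t0.
exists ((gam * t)^-1 `^ sig * expR (limn (E ^~ t))).
  by rewrite mulr_gt0 ?powR_gt0 ?expR_gt0// invr_gt0.
have -> : (fun n => n%:R `^ sig * H n t) =
    (fun n => (n%:R / (1 + gam * n%:R * t)) `^ sig * expR (E n t)).
  by apply/funext => n; rewrite HE// mulrA ratioE.
apply: cvgM.
  have : {for (gam * t)^-1, continuous (fun y : R => y `^ sig)}.
    by apply: continuous_powRl; rewrite invr_gt0.
  exact: (cvg_comp _ _ (ratio_cvg t01)).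
exact: (cvg_comp _ _ (cE _ t01) (@continuous_expR R _)).
Qed.

(** As soon as gam n t >= 1 one has 1 + gam n t <= 2 gam n t, and exp(E) is at least exp(- B). *)
Lemma asym_lower : exists2 b : R, 0 < b & forall (t : R), 0 < t <= 1 ->
  \forall n \near \oo, b * t `^ (- sig) <= n%:R `^ sig * H n t.
Proof.
have [E [HE [B hB] _ _]] := asym; have [g0 s0] := (gam_gt0, sig_gt0).
exists ((2 * gam) `^ (- sig) * expR (- B)) => [|t t01].
  by rewrite mulr_gt0 ?powR_gt0 ?expR_gt0// mulr_gt0.
have /andP[t0 t1] := t01; have gt0 := mulr_gt0 g0 t0.
exists (Num.truncn (gam * t)^-1).+1 => // n /= hn.
have ngt : 1 <= gam * n%:R * t.
  have : (gam * t)^-1 <= n%:R by apply: (le_trans (ltW (truncnS_gt _))); rewrite ler_nat.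
  rewrite -[leLHS]mul1r ler_pdivrMr//; lra.
rewrite HE// mulrA ratioE// mulrAC -powRM; [|lra..].
rewrite ler_pM ?powR_ge0 ?expR_ge0//; last first.
  by rewrite ler_expR; have := hB n t t01; rewrite ler_norml => /andP[].
have gt2 : 0 < 2 * gam * t by lra.
rewrite -[X in X `^ - _]invrK -[X in X `^ - _]powR_inv1; last by nneg.
rewrite -powRrM mulN1r opprK; apply: ge0_ler_powR; rewrite ?nnegrE; [by nneg|by nneg| |].
  by apply: divr_ge0 => //; lra.
rewrite ler_pdivlMr; last lra.
rewrite mulrC ler_pdivrMr ?mulr_gt0//.
lra.
Qed.

(** Two independent conditions: t <= d makes exp(E) close to 1, and x = n t >= M makes x / (1 + gam
    x) close to 1 / gam. *)
Lemma asym_uniform (e : R) : 0 < e -> exists d M : R, [/\ 0 < d <= 1, 0 < M &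
  forall n (t : R), 0 < t <= d -> M <= n%:R * t ->
  `|(n%:R * t) `^ sig * H n t - gam `^ (- sig)| <= e].
Proof.
move=> e0; have [E [HE _ sE _]] := asym; have [g0 s0] := (gam_gt0, sig_gt0).
have gs0 : 0 < gam `^ (- sig) by rewrite powR_gt0.
have : {for gam^-1, continuous (fun y : R => y `^ sig)}.
  by apply: continuous_powRl; rewrite invr_gt0.
move=> /cvgrPdist_le/(_ (e / 2)); rewrite divr_gt0// => /(_ isT).
rewrite near_simpl => -[r /= r0 hr].
have /cvgrPdist_le/(_ (e / 2 / gam `^ (- sig))) := @continuous_expR R 0.
rewrite !divr_gt0// => /(_ isT); rewrite near_simpl => -[r' /= r'0 hr'].
have [d d01 hd] := sE (r' / 2) (divr_gt0 r'0 (ltr0n _ 2)).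
(* The gap 1 / gam - x / (1 + gam x) equals 1 / (gam (1 + gam x)), which is below r once x exceeds 1
   / (gam^2 r). *)
exists d, (1 + (gam ^+ 2 * r)^-1); split => //.
  by rewrite addr_gt0// invr_gt0 mulr_gt0// exprn_gt0.
move=> n t td ntM; have t01 : 0 < t <= 1 by lra.
have g2r : 0 < gam ^+ 2 * r by rewrite mulr_gt0// exprn_gt0.
have iM : 0 < (gam ^+ 2 * r)^-1 by rewrite invr_gt0.
set x := n%:R * t in ntM *; have x0 : 0 < x by lra.
have gx0 : 0 < gam * x by rewrite mulr_gt0.
have dx : 1 + gam * n%:R * t = 1 + gam * x by rewrite mulrA.
have -> : x `^ sig * H n t = (x / (1 + gam * x)) `^ sig * expR (E n t).
  rewrite HE// mulrA dx powRM ?invr_ge0; [|lra..].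
  by rewrite -[(1 + gam * x)^-1]powR_inv1 ?addr_ge0 ?ltW// -powRrM mulN1r.
set y := x / (1 + gam * x).
have yg : gam^-1 - y = (gam * (1 + gam * x))^-1.
  by rewrite /y; field; rewrite !gt_eqF//; lra.
have y0 : 0 <= y by rewrite /y divr_ge0//; lra.
have ygr : gam^-1 - y < r.
  rewrite yg -[ltRHS]invrK ltf_pV2 ?posrE ?invr_gt0 ?mulr_gt0//; last lra.
  have : gam ^+ 2 * (gam ^+ 2 * r)^-1 = r^-1 by field; rewrite !gt_eqF.
  have : gam ^+ 2 * (gam ^+ 2 * r)^-1 < gam ^+ 2 * x by rewrite ltr_pM2l ?exprn_gt0//; lra.
  lra.
have yg0 : 0 < gam^-1 - y by rewrite yg invr_gt0 mulr_gt0//; lra.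
have h1 : `|gam^-1 `^ sig - y `^ sig| <= e / 2.
  by apply: hr; rewrite /ball_/= ger0_norm ?ltW.
have gsE : gam^-1 `^ sig = gam `^ (- sig).
  by rewrite -powR_inv1 ?ltW// -powRrM mulN1r.
have h2 : `|1 - expR (E n t)| <= e / 2 / gam `^ (- sig).
  have := hr' (E n t); rewrite /ball_/= sub0r normrN expR0; apply.
  by apply: (le_lt_trans (hd n t td)); lra.
have ys : 0 <= y `^ sig <= gam `^ (- sig).
  rewrite powR_ge0 -gsE ge0_ler_powR ?nnegrE ?invr_ge0//; lra.
have -> : y `^ sig * expR (E n t) - gam `^ (- sig) =
    - (y `^ sig * (1 - expR (E n t))) - (gam^-1 `^ sig - y `^ sig).
  by rewrite gsE; ring.
apply: le_trans (ler_normB _ _) _; rewrite normrN [e]splitr lerD//.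
rewrite normrM ger0_norm ?powR_ge0//.
apply: (@le_trans _ _ (gam `^ (- sig) * (e / 2 / gam `^ (- sig)))).
  by rewrite ler_pM ?powR_ge0//; lra.
by rewrite mulrC divfK// gt_eqF.
Qed.

(** The argument t_n = 1 - exp(- u / n) satisfies n t_n -> u. Both t_n and n move, so it is the
    uniformity in n of the smallness of E near 0 that removes the exponential factor. *)
Lemma asym_scaling (u : R) : 0 < u ->
  H n (1 - expR (- (u / n%:R))) @[n --> \oo] --> (1 + gam * u) `^ (- sig).
Proof.
move=> u0; have [E [HE _ sE _]] := asym; have [g0 s0] := (gam_gt0, sig_gt0).
rewrite -cvg_shiftS /=.
pose t (n : nat) : R := 1 - expR (- (u / n.+1%:R)).
have x0 n : 0 < u / n.+1%:R by rewrite divr_gt0.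
have t_le n : t n <= u / n.+1%:R by exact: onem_expRN_le.
have t_ge n : u / n.+1%:R / (1 + u / n.+1%:R) <= t n.
  by apply: onem_expRN_ge; exact: ltW.
have t01 n : 0 < t n <= 1.
  apply/andP; split; last by rewrite /t gerBl expR_ge0.
  by apply: lt_le_trans (t_ge n); rewrite divr_gt0// addr_gt0.
have ux : u / n.+1%:R @[n --> \oo] --> (0 : R).
  by rewrite -[X in _ --> X](mulr0 u); apply: cvgM; [exact: cvg_cst|exact: cvg_harmonic].
have nt : n.+1%:R * t n @[n --> \oo] --> u.
  apply: (squeeze_cvgr (f := fun n => u / (1 + u / n.+1%:R)) (h := fun=> u)).
  - apply: nearW => n; have n0 : 0 < n.+1%:R :> R by [].
    have x0n := x0 n; apply/andP; split.
      have := t_ge n; rewrite -(@ler_pM2l _ n.+1%:R)//; apply: le_trans.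
      by rewrite !mulrA [n.+1%:R * u]mulrC mulfK ?gt_eqF.
    by have := t_le n; rewrite -(@ler_pM2l _ n.+1%:R)// [n.+1%:R * (_ / _)]mulrC mulfVK ?gt_eqF.
  - rewrite -[X in _ --> X]divr1; apply: cvgM; first exact: cvg_cst.
    apply: cvgV => //; rewrite -[X in _ --> X]addr0.
    by apply: cvgD; [exact: cvg_cst|exact: ux].
  - exact: cvg_cst.
have EH n : H n.+1 (t n) = (1 + gam * (n.+1%:R * t n)) `^ (- sig) * expR (E n.+1 (t n)).
  by rewrite HE// mulrA.
suff fin : (1 + gam * (n.+1%:R * t n)) `^ (- sig) * expR (E n.+1 (t n))
    @[n --> \oo] --> (1 + gam * u) `^ (- sig).
  have -> : (fun n => H n.+1 (1 - expR (- (u / n.+1%:R)))) =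
     (fun n => (1 + gam * (n.+1%:R * t n)) `^ (- sig) * expR (E n.+1 (t n))).
    by apply/funext => n; rewrite -/(t n) EH.
  exact: fin.
rewrite -[X in _ --> X]mulr1; apply: cvgM.
  have d0 : 0 < 1 + gam * u by rewrite addr_gt0 ?mulr_gt0.
  have cc : 1 + gam * (n.+1%:R * t n) @[n --> \oo] --> 1 + gam * u.
    by apply: cvgD; [exact: cvg_cst|apply: cvgM; [exact: cvg_cst|exact: nt]].
  exact: (cvg_comp _ _ cc (continuous_powRl d0)).
have EE : E n.+1 (t n) @[n --> \oo] --> (0 : R).
  apply/cvgrPdist_le => e e0; have [d d01 hd] := sE e e0.
  have /cvgrPdist_le/(_ d) := ux; move/andP : d01 => [d0 d1] /(_ d0)[N _ hN].
  exists N => // n /hN /=; rewrite !sub0r !normrN => xd.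
  apply: hd; have /andP[-> _] := t01 n => /=.
  by apply: le_trans (t_le n) _; apply: le_trans xd; exact: ler_norm.
by rewrite -expR0; exact: (cvg_comp _ _ EE (@continuous_expR R _)).
Qed.

End asymptotics_consequences.

(** * Sums weighted by the law of the process *)

(** A sequence eventually within e of some convergent sequence, for every e, is Cauchy. This gives
    limits that are never computed. *)
Lemma cvgn_approx {R : realType} (x : nat -> R) :
  (forall e : R, 0 < e -> exists2 y : nat -> R, cvgn y &
    \forall n \near \oo, `|x n - y n| <= e) -> cvgn x.
Proof.
move=> h; apply/cauchy_cvgP/cauchy_exP => e e0.
have e4 : 0 < e / 4 by rewrite divr_gt0.
have [y cy xy] := h _ e4; exists (limn y).
have /cvgrPdist_le/(_ _ e4) hy := cy.
suff : \forall n \near \oo, ball (limn y) e (x n) by [].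
apply: filterS2 xy hy => n h1 h2; rewrite /ball/=.
have -> : limn y - x n = (limn y - y n) - (x n - y n) by ring.
by apply: le_lt_trans (ler_normB _ _) _; lra.
Qed.

Lemma is_cvgn_bigsum {R : realType} (k : nat) (F : nat -> nat -> R) :
  (forall i, (i < k)%N -> cvgn (F ^~ i)) -> cvgn (fun n => \sum_(i < k) F n i).
Proof.
elim: k => [|k ih] h.
  by under eq_fun do rewrite big_ord0; exact: is_cvg_cst.
under eq_fun do rewrite big_ord_recr.
by apply: is_cvgD; [apply: ih => i ik; apply: h; exact: ltnW|exact: h].
Qed.

Lemma cvgn_bigsum0 {R : realType} (k : nat) (F : nat -> nat -> R) :
  (forall i, F n i @[n --> \oo] --> 0) ->
  \sum_(i < k) F n i @[n --> \oo] --> 0.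
Proof.
move=> h; elim: k => [|k ih].
  by under eq_fun do rewrite big_ord0; exact: cvg_cst.
rewrite (_ : (fun n => _) = (fun n => \sum_(i < k) F n i + F n k)); last first.
  by apply/funext => n; rewrite big_ord_recr.
by rewrite -[X in _ --> X]addr0; apply: cvgD; [exact: ih|exact: h].
Qed.

Definition subprobability_weights {R : realType} (a : nat -> R) : Prop :=
  (forall k, 0 <= a k) /\ (\sum_(k <oo) (a k)%:E <= 1)%E.

(** [fine] sends an infinite sum to 0; the bound [M] on [B] that most lemmas below require excludes
    this case. *)
Definition wsum {R : realType} (a B : nat -> R) : R :=
  fine (\sum_(k <oo) (a k * B k)%:E)%E.

Section weighted_sums.
Context {R : realType}.
Implicit Types a B : nat -> R.

Lemma wsumE a B (M : R) : subprobability_weights a ->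
  (forall k, 0 <= B k <= M) ->
  (\sum_(k <oo) (a k * B k)%:E)%E = (wsum a B)%:E.
Proof.
move=> [a0 a1] BM; rewrite fineK// ge0_fin_numE; last first.
  by apply: nneseries_ge0 => k _ _; rewrite lee_fin mulr_ge0//; have /andP[] := BM k.
have M0 : 0 <= M by have := BM 0%N; lra.
apply: (@le_lt_trans _ _ (M%:E * \sum_(k <oo) (a k)%:E)%E).
  rewrite -nneseriesZl; last by move=> k _; rewrite lee_fin.
  apply: lee_nneseries => k _.
    by move=> _; rewrite lee_fin mulr_ge0//; have /andP[] := BM k.
  by rewrite -EFinM lee_fin mulrC ler_wpM2r//; have /andP[] := BM k.
apply: (@le_lt_trans _ _ (M%:E * 1)%E); first by rewrite lee_wpmul2l// lee_fin.
by rewrite mule1 ltry.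
Qed.

Lemma wsum_ge0 a B : (forall k, 0 <= a k) -> (forall k, 0 <= B k) ->
  0 <= wsum a B.
Proof.
move=> a0 B0; rewrite /wsum fine_ge0// nneseries_ge0// => k _ _.
by rewrite lee_fin mulr_ge0.
Qed.

Lemma le_wsum a B B' (M : R) : subprobability_weights a ->
  (forall k, 0 <= B k <= B' k) -> (forall k, B' k <= M) ->
  wsum a B <= wsum a B'.
Proof.
move=> ha BB' B'M; have [a0 _] := ha.
rewrite -lee_fin -(wsumE (M := M))//; last by move=> k; have := BB' k; have := B'M k; lra.
rewrite -(wsumE (M := M))//; last by move=> k; have := BB' k; have := B'M k; lra.
apply: lee_nneseries => k _; first by move=> _; rewrite lee_fin mulr_ge0//; have /andP[] := BB' k.
by rewrite lee_fin ler_wpM2l//; have /andP[] := BB' k.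
Qed.

Lemma wsumZ a B (c : R) : (forall k, 0 <= a k) -> (forall k, 0 <= B k) ->
  0 <= c -> wsum a (fun k => c * B k) = c * wsum a B.
Proof.
move=> a0 B0 c0; rewrite /wsum.
have -> : (\sum_(k <oo) (a k * (c * B k))%:E =
           c%:E * \sum_(k <oo) (a k * B k)%:E)%E.
  rewrite -nneseriesZl; last by move=> k _; rewrite lee_fin mulr_ge0.
  by apply: eq_eseriesr => k _; rewrite -EFinM mulrCA.
(* No bound on [B] is assumed here: when the sum is infinite and c > 0, both sides are 0 by the
   convention of [fine]. *)
have [->|cn0] := eqVneq c 0; first by rewrite mul0e mul0r.
have {cn0}c0' : 0 < c by rewrite lt_def cn0.
have : (0 <= \sum_(k <oo) (a k * B k)%:E)%E.
  by apply: nneseries_ge0 => k _ _; rewrite lee_fin mulr_ge0.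
case: (\sum_(k <oo) (a k * B k)%:E)%E => [r| |] // _.
by rewrite gt0_muley ?lte_fin//= mulr0.
Qed.

Lemma wsumD a B B' (M : R) : subprobability_weights a ->
  (forall k, 0 <= B k <= M) -> (forall k, 0 <= B' k <= M) ->
  wsum a (fun k => B k + B' k) = wsum a B + wsum a B'.
Proof.
move=> ha hB hB'; have [a0 _] := ha; apply: EFin_inj; rewrite EFinD.
rewrite -(wsumE (M := M + M))//; last by move=> k; have := hB k; have := hB' k; lra.
rewrite -(wsumE (M := M))// -(wsumE (B := B') (M := M))//.
rewrite -nneseriesD; first by apply: eq_eseriesr => k _; rewrite mulrDr.
- by move=> k _ _; rewrite lee_fin mulr_ge0//; have /andP[] := hB k.
- by move=> k _ _; rewrite lee_fin mulr_ge0//; have /andP[] := hB' k.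
Qed.

Lemma wsum_split a B (M : R) (K : nat) : subprobability_weights a ->
  (forall k, 0 <= B k <= M) ->
  wsum a B = \sum_(k < K) a k * B k +
             wsum a (fun k => if (k < K)%N then 0 else B k).
Proof.
move=> ha hB; have [a0 _] := ha; have M0 : 0 <= M by have := hB 0%N; lra.
apply: EFin_inj; rewrite -(wsumE (M := M))// EFinD.
rewrite -(wsumE (M := M))//; last by move=> k; case: ifP => // _; rewrite lexx.
have t0 k : (0 <= (a k * B k)%:E)%E.
  by rewrite lee_fin mulr_ge0//; have /andP[] := hB k.
rewrite (nneseries_split 0 K)// add0n; congr (_ + _)%E.
  by rewrite sumEFin big_mkord.
rewrite (nneseries_split 0 K) ?add0n; last first.
  by move=> k _; case: ifP => _ //; rewrite mulr0.
rewrite big_nat big1 ?add0e; last by move=> k /andP[_ ->]; rewrite mulr0.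
rewrite eseries_cond [RHS]eseries_cond; apply: eq_eseriesr => k /= Kk.
by rewrite ltnNge Kk.
Qed.

Lemma wsum_le_partial a B (D : R) : (forall k, 0 <= a k) -> (forall k, 0 <= B k) ->
  (forall N : nat, \sum_(k < N) a k * B k <= D) -> wsum a B <= D.
Proof.
move=> a0 B0 h; have D0 : 0 <= D by have := h 0%N; rewrite big_ord0.
have S : (\sum_(k <oo) (a k * B k)%:E <= D%:E)%E.
  apply: lime_le.
    by apply: is_cvg_nneseries => k _ _; rewrite lee_fin mulr_ge0.
  by apply: nearW => N; rewrite sumEFin lee_fin big_mkord.
have S0 : (0 <= \sum_(k <oo) (a k * B k)%:E)%E.
  by apply: nneseries_ge0 => k _ _; rewrite lee_fin mulr_ge0.
rewrite /wsum -lee_fin fineK// ge0_fin_numE//; apply: le_lt_trans S _.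
by rewrite ltry.
Qed.

Lemma wsum_ge_partial a B (M : R) (N : nat) : subprobability_weights a ->
  (forall k, 0 <= B k <= M) -> \sum_(k < N) a k * B k <= wsum a B.
Proof.
move=> ha hB; rewrite (wsum_split N ha hB) lerDl wsum_ge0//; first by case: ha.
by move=> k; case: ifP => // _; have /andP[] := hB k.
Qed.

Lemma wsum_ge_term a B (M : R) k : subprobability_weights a ->
  (forall k, 0 <= B k <= M) -> a k * B k <= wsum a B.
Proof.
move=> ha hB; apply: le_trans (wsum_ge_partial k.+1 ha hB).
rewrite big_ord_recr/= lerDr sumr_ge0// => i _; rewrite mulr_ge0//.
  by case: ha.
by have /andP[] := hB i.
Qed.

End weighted_sums.

Lemma powRN_small {R : realType} (q e : R) : 0 < q -> 0 < e ->
  exists2 K : nat, (0 < K)%N &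
    forall k : nat, (K <= k)%N -> k%:R `^ (- q) <= e.
Proof.
move=> q0 e0; exists (Num.truncn (e `^ (- q^-1))).+1 => // k Kk.
have ek : e `^ (- q^-1) <= k%:R.
  by apply: le_trans (ltW (truncnS_gt _)) _; rewrite ler_nat.
have p0 : 0 < e `^ (- q^-1) by rewrite powR_gt0.
have k0 : 0 < k%:R :> R := lt_le_trans p0 ek.
rewrite powRN -[leRHS]invrK lef_pV2 ?posrE ?invr_gt0 ?powR_gt0//.
have -> : e^-1 = (e `^ (- q^-1)) `^ q.
  by rewrite -powRrM mulNr mulVf ?gt_eqF// powR_inv1// ltW.
by apply: ge0_ler_powR => //; rewrite ?nnegrE ltW.
Qed.

(** Induction through (1 - x / 2)^2 >= 1 - x with x = 2^-(m+1); the base case is (1 - 1/2)^2 =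
    1/4. *)
Lemma onemX_dyadic {R : realType} (m : nat) :
  1 / 4 <= (1 - 2^-1 ^+ m.+1) ^+ (2 ^ m.+1) :> R.
Proof.
elim: m => [|m ih]; first by rewrite expr1 expr2; lra.
apply: le_trans ih _; rewrite [in leRHS]expnS exprM [2^-1 ^+ m.+2]exprS.
have : 2^-1 ^+ m.+1 <= 1 :> R by rewrite exprn_ile1//; lra.
have : 0 <= 2^-1 ^+ m.+1 :> R by rewrite exprn_ge0.
move: (2^-1 ^+ m.+1) => x x0 x1.
by apply: lerXn2r; rewrite ?nnegrE ?sqr_ge0//; nra.
Qed.

(* Dominates k^-p by weights (1 - t)^k at dyadic t, whose sums against the law
   of Z_n are values of the generating function. *)
Lemma powRN_le_dyadic {R : realType} (p : R) (k : nat) : 0 < p -> (0 < k)%N ->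
  k%:R `^ (- p) <=
  4 * (2 `^ (- p)) ^+ trunc_log 2 k * (1 - 2^-1 ^+ (trunc_log 2 k).+1) ^+ k.
Proof.
move=> p0 k0; set j := trunc_log 2 k.
have /andP[jk kj] : (2 ^ j <= k < 2 ^ j.+1)%N by apply: trunc_log_bounds.
have kR : 0 < k%:R :> R by rewrite ltr0n.
have h1 : k%:R `^ (- p) <= (2 `^ (- p)) ^+ j.
  rewrite -powR_mulrn ?powR_ge0// -powRrM [_ * j%:R]mulrC powRrM powR_mulrn//.
  rewrite !powRN lef_pV2 ?posrE ?powR_gt0 ?exprn_gt0//.
  by rewrite -natrX; apply: ge0_ler_powR; rewrite ?nnegrE ?ler_nat//; exact: ltW.
have h2 : 1 / 4 <= (1 - 2^-1 ^+ j.+1) ^+ k :> R.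
  apply: le_trans (onemX_dyadic j) _; apply: ler_wiXn2l; last exact: ltnW.
    by rewrite subr_ge0 exprn_ile1//; lra.
  by rewrite gerBl exprn_ge0.
apply: le_trans h1 _.
have : 0 <= (2 `^ (- p)) ^+ j :> R by rewrite exprn_ge0// powR_ge0.
move: (_ ^+ j) (_ ^+ k) h2 => x y h2 x0; nra.
Qed.

(** * From the generating function to limits of weighted sums *)

Section harmonic_moment_asymptotics.
Context {R : realType}.
Variables (gam sig : R) (H : nat -> R -> R) (a : nat -> nat -> R).
Hypotheses (gam_gt0 : 0 < gam) (sig_gt0 : 0 < sig).
Hypothesis asym : critical_asymptotics gam sig H.
Hypothesis a_sub : forall n, subprobability_weights (a n).
Hypothesis HE : forall n (t : R), 0 < t <= 1 ->
  wsum (a n) (fun k => (1 - t) ^+ k) = H n t.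

Let a_ge0 n k : 0 <= a n k. Proof. by have [] := a_sub n. Qed.

Let powX_in (t : R) k : 0 < t <= 1 -> 0 <= (1 - t) ^+ k <= 1.
Proof. by move=> t01; rewrite exprn_ge0 ?exprn_ile1//; lra. Qed.

(** A single term of the generating function at t = 1/2 already gives a_n(k) 2^-k <= H n (1/2). *)
Lemma scaled_weight_bounded k : exists2 D : R, 0 < D &
  forall n, n%:R `^ sig * a n k <= D.
Proof.
have [B B0 hB] := asym_upper gam_gt0 sig_gt0 asym.
have h01 : 0 < (1 / 2 : R) <= 1 by lra.
exists (2 ^+ k * (B * (1 / 2) `^ (- sig))) => [|n].
  by rewrite !mulr_gt0 ?powR_gt0 ?exprn_gt0.
rewrite -ler_pdivrMl ?exprn_gt0// mulrCA.
apply: le_trans (hB n _ h01); rewrite ler_wpM2l ?powR_ge0// -HE//.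
apply: le_trans (wsum_ge_term (M := 1) k (a_sub n) (fun i => powX_in i h01)).
rewrite mulrC ler_wpM2l// -exprVn (_ : 1 - 1 / 2 = 2^-1 :> R)//.
by field.
Qed.

(** Take the generating function at a small argument s = 1 - t, subtract the terms below k, whose
    limits are known, and divide by s^k: what remains is the k-th weight up to O(s) uniformly in n,
    and s is arbitrary. *)
Let weight_cvg_step k : (forall i, (i < k)%N -> cvgn (fun n => n%:R `^ sig * a n i)) ->
  cvgn (fun n => n%:R `^ sig * a n k).
Proof.
move=> ih; have [B B0 hB] := asym_upper gam_gt0 sig_gt0 asym.
have h01 : 0 < (1 / 2 : R) <= 1 by lra.
pose D := 2 ^+ k.+1 * (B * (1 / 2) `^ (- sig)).
have D0 : 0 < D by rewrite !mulr_gt0 ?powR_gt0 ?exprn_gt0.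
apply: cvgn_approx => e e0.
pose s := Num.min (1 / 2) (e / D).
have s0 : 0 < s by rewrite lt_min !divr_gt0.
have s2 : s <= 1 / 2 by rewrite ge_min lexx.
have t01 : 0 < 1 - s <= 1 by lra.
have sD : s * D <= e by rewrite -ler_pdivlMr// ge_min lexx orbT.
exists (fun n => (n%:R `^ sig * H n (1 - s)
   - \sum_(i < k) n%:R `^ sig * a n i * s ^+ i) / s ^+ k).
  apply: is_cvgM; last exact: is_cvg_cst.
  apply: is_cvgB.
    by have [l _ /cvgP] := asym_pointwise gam_gt0 asym t01.
  apply: (is_cvgn_bigsum (F := fun n i => n%:R `^ sig * a n i * s ^+ i)) => i ik.
  by apply: is_cvgM; [exact: ih|exact: is_cvg_cst].
apply: nearW => n; rewrite -HE//.
have E i : (1 - (1 - s)) ^+ i = s ^+ i by rewrite opprB addrC subrK.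
rewrite (wsum_split k.+1 (a_sub n) (fun i => powX_in i t01)) big_ord_recr/= E.
under eq_bigr do rewrite E.
set S := \sum_(_ < _) _; set W := wsum _ _; set N := n%:R `^ sig.
rewrite (_ : \sum_(i < k) _ = N * S); last first.
  by rewrite mulr_sumr; apply: eq_bigr => i _; rewrite mulrA.
have sk0 : 0 < s ^+ k by rewrite exprn_gt0.
have N0 : 0 <= N by exact: powR_ge0.
have -> : N * a n k - (N * (S + a n k * s ^+ k + W) - N * S) / s ^+ k =
   - (N * W / s ^+ k) by field; rewrite gt_eqF.
have W0 : 0 <= W.
  by apply: wsum_ge0 => // i; case: ifP => // _; have /andP[] := powX_in i t01.
rewrite normrN ger0_norm; last by nneg.
apply: le_trans sD; rewrite ler_pdivrMr//.
(* For i > k and s <= 1/2, s^i <= s^(k+1) 2^(k+1) 2^-i: the remainder is controlled by the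
   generating function at 1/2, which is O(n^-sig). *)
have hW : W <= s ^+ k.+1 * 2 ^+ k.+1 * H n (1 / 2).
  rewrite -HE// -wsumZ//; last 2 first.
  - by move=> i; have /andP[] := powX_in i h01.
  - by rewrite mulr_ge0 ?exprn_ge0//; lra.
  have s21 : s ^+ k.+1 * 2 ^+ k.+1 <= 1 by rewrite -exprMn exprn_ile1//; lra.
  apply: (le_wsum (M := 1)) => // i; last first.
    have := powX_in i h01; have : 0 <= s ^+ k.+1 * 2 ^+ k.+1.
      by rewrite mulr_ge0// exprn_ge0//; lra.
    by move: (_ * _) s21 ((1 - _) ^+ i) => x x1 y x0 /andP[y0 y1]; nra.
  case: ltnP => ki.
    by rewrite lexx/= !mulr_ge0 ?exprn_ge0//; lra.
  rewrite E (_ : 1 - 1 / 2 = 2^-1 :> R); last by field.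
  apply/andP; split; first by rewrite exprn_ge0// ltW.
  have -> : s ^+ k.+1 * 2 ^+ k.+1 * 2^-1 ^+ i = s ^+ k.+1 * 2^-1 ^+ (i - k.+1).
    rewrite -{1}(subnKC ki) exprD mulrA -(mulrA _ (2 ^+ k.+1)) -exprMn.
    by rewrite divff// expr1n mulr1.
  rewrite -{1}(subnKC ki) exprD ler_wpM2l//; first by rewrite exprn_ge0// ltW.
  by apply: lerXn2r; rewrite ?nnegrE//; lra.
have -> : s * D * s ^+ k = s ^+ k.+1 * 2 ^+ k.+1 * (B * (1 / 2) `^ (- sig)).
  by rewrite /D [s ^+ k.+1]exprS; ring.
apply: (@le_trans _ _ (s ^+ k.+1 * 2 ^+ k.+1 * (N * H n (1 / 2)))).
  by rewrite mulrCA ler_wpM2l.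
by rewrite ler_wpM2l ?hB// mulr_ge0// exprn_ge0// ltW.
Qed.

Lemma weight_cvg k : cvgn (fun n => n%:R `^ sig * a n k).
Proof.
elim/ltn_ind: k => k ih; exact: weight_cvg_step.
Qed.

(** Dyadic domination replaces k^-p by the values of the generating function at t = 2^-(j+1) with
    weights 2^(- p j); since n^sig H n t = O(t^-sig), the sum over j is geometric of ratio z =
    2^(sig - p) < 1. *)
Lemma harmonic_moment_bounded (p : R) : sig < p -> exists2 D : R, 0 < D &
  forall n, n%:R `^ sig * wsum (a n) (fun k => k%:R `^ (- p)) <= D.
Proof.
move=> sp; have [B B0 hB] := asym_upper gam_gt0 sig_gt0 asym.
have p0 : 0 < p by have := sig_gt0; lra.
pose z : R := 2 `^ (sig - p).
have z0 : 0 < z by rewrite powR_gt0.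
have z1 : z < 1.
  by rewrite /z /powR gt_eqF// expR_lt1 nmulr_rlt0 ?ln_gt0 ?subr_lt0// ltr1n.
pose D := 4 * (B * 2 `^ sig) / (1 - z).
have D0 : 0 < D by rewrite !mulr_gt0 ?powR_gt0 ?invr_gt0//; lra.
exists D => // n; set N := n%:R `^ sig.
have N0 : 0 <= N by exact: powR_ge0.
have [->|Nn0] := eqVneq N 0; first by rewrite mul0r ltW.
have Np : 0 < N by rewrite lt_def Nn0.
rewrite -ler_pdivlMl//; apply: wsum_le_partial => //.
move=> m; rewrite ler_pdivlMl// mulr_sumr.
pose t (j : nat) : R := 2^-1 ^+ j.+1.
have t01 j : 0 < t j <= 1.
  by rewrite exprn_gt0//= exprn_ile1//; lra.
pose F (j k : nat) : R := 4 * (2 `^ (- p)) ^+ j * (N * (a n k * (1 - t j) ^+ k)).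
have F0 j k : 0 <= F j k.
  rewrite /F !mulr_ge0// ?exprn_ge0 ?powR_ge0//.
  by have := t01 j; lra.
(* Only j = [trunc_log 2 k] is needed for each k, and 2^j <= k < m puts it in range; summing over
   every j makes the two sums exchangeable. *)
apply: (@le_trans _ _ (\sum_(k < m) \sum_(j < m) F j k)).
  apply: ler_sum => k _; case: (posnP k) => [->|k0].
    by rewrite powR0 ?oppr_eq0 ?gt_eqF// !mulr0 sumr_ge0.
  have jm : (trunc_log 2 k < m)%N.
    apply: leq_ltn_trans (ltn_ord k); apply: leq_trans (@trunc_logP 2 k isT k0).
    exact/ltnW/ltn_expl.
  rewrite (bigD1 (Ordinal jm))//=.
  apply: (@le_trans _ _ (F (trunc_log 2 k) k)); last by rewrite lerDl sumr_ge0.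
  rewrite /F [leRHS]mulrCA ler_wpM2l// [leRHS]mulrCA ler_wpM2l//.
  by apply: powRN_le_dyadic.
rewrite exchange_big /=.
apply: (@le_trans _ _ (\sum_(j < m) 4 * (B * 2 `^ sig) * z ^+ j)).
  apply: ler_sum => j _; rewrite /F -mulr_sumr -mulr_sumr.
  have h : N * \sum_(k < m) a n k * (1 - t j) ^+ k <= B * t j `^ (- sig).
    apply: le_trans (hB n _ (t01 j)); rewrite ler_wpM2l// -HE//.
    exact: (wsum_ge_partial (M := 1) m (a_sub n) (fun i => powX_in i (t01 j))).
  apply: (@le_trans _ _ (4 * (2 `^ (- p)) ^+ j * (B * t j `^ (- sig)))).
    by rewrite ler_wpM2l// mulr_ge0// exprn_ge0// powR_ge0.
  have -> : t j `^ (- sig) = 2 `^ sig * (2 `^ sig) ^+ j.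
    rewrite /t exprVn -powR_inv1 ?exprn_ge0// -powRrM mulN1r opprK.
    by rewrite -(powR_mulrn j.+1)// powRAC powR_mulrn ?powR_ge0// exprS.
  have -> : z ^+ j = (2 `^ (- p)) ^+ j * (2 `^ sig) ^+ j.
    by rewrite -exprMn -powRD ?pnatr_eq0 ?implybT// addrC.
  by rewrite le_eqVlt; apply/orP; left; apply/eqP; ring.
rewrite -mulr_sumr /D ler_wpM2l//; first by nneg.
rewrite -[leRHS]mulr1 ler_pdivlMl ?subr_gt0//.
have := subrX1 z m; set S := \sum_(_ < _) _ => h.
have -> : (1 - z) * S = 1 - z ^+ m by rewrite -[1 - z]opprB mulNr -h opprB.
by rewrite gerBl exprn_ge0// ltW.
Qed.

(** Truncate at K. The finite part converges weight by weight; with p halfway between sig and r, the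
    tail costs K^-(r - p) times the bounded moment of order p. *)
Lemma moment_cvg (A : nat -> R) (r D M : R) : sig < r ->
  (forall k, 0 <= A k <= M) ->
  (forall k, (0 < k)%N -> A k <= D * k%:R `^ (- r)) ->
  cvgn (fun n => n%:R `^ sig * wsum (a n) A).
Proof.
move=> sr AM AD; pose p := (sig + r) / 2.
have sp : sig < p by rewrite /p; lra.
have pr : 0 < r - p by rewrite /p; lra.
have D0 : 0 <= D.
  have := AD 1%N isT; rewrite powR1 mulr1; apply: le_trans.
  by have /andP[] := AM 1%N.
have [Dp Dp0 hDp] := harmonic_moment_bounded sp.
apply: cvgn_approx => e e0.
have D1 : 0 < (D + 1) * Dp by rewrite mulr_gt0//; lra.
have [K K0 hK] := powRN_small pr (divr_gt0 e0 D1).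
exists (fun n => \sum_(i < K) n%:R `^ sig * a n i * A i).
  apply: (is_cvgn_bigsum (F := fun n i => n%:R `^ sig * a n i * A i)) => i _.
  by apply: is_cvgM; [exact: weight_cvg|exact: is_cvg_cst].
apply: nearW => n; rewrite (wsum_split K (a_sub n) AM).
rewrite mulrDr mulr_sumr.
under eq_bigr do rewrite mulrA.
rewrite addrAC subrr add0r; set T := wsum _ _.
have T0 : 0 <= T.
  by apply: wsum_ge0 => // k; case: ifP => // _; have /andP[] := AM k.
rewrite ger0_norm ?mulr_ge0 ?powR_ge0//.
have hT : T <= e / Dp * wsum (a n) (fun k => k%:R `^ (- p)).
  rewrite -wsumZ//; last by nneg.
  apply: (le_wsum (M := e / Dp)) => // k; last first.
    rewrite ler_piMr//; first by nneg.
    case: k => [|k]; first by rewrite powR0// oppr_eq0; have := sig_gt0; lra.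
    rewrite powRN invf_le1 ?powR_gt0// -[leLHS](powRr0 k.+1%:R).
    by apply: ler_powR; rewrite ?ler1n//; have := sig_gt0; lra.
  case: ltnP => Kk; first by rewrite lexx /= mulr_ge0 ?powR_ge0//; nneg.
  have /andP[-> _] /= := AM k.
  have k0 : (0 < k)%N by apply: leq_trans K0 Kk.
  apply: le_trans (AD k k0) _.
  have -> : k%:R `^ (- r) = k%:R `^ (- (r - p)) * k%:R `^ (- p).
    by rewrite -powRD ?pnatr_eq0 -?lt0n ?k0 ?implybT//; congr (_ `^ _); ring.
  rewrite mulrA ler_wpM2r ?powR_ge0//.
  apply: (@le_trans _ _ ((D + 1) * (e / ((D + 1) * Dp)))).
    by rewrite ler_pM ?powR_ge0 ?hK//; lra.
  rewrite (_ : (D + 1) * _ = e / Dp)//; field.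
  by rewrite !gt_eqF//; lra.
apply: (@le_trans _ _ (n%:R `^ sig * (e / Dp * wsum (a n) (fun k => k%:R `^ (- p))))).
  by rewrite ler_wpM2l ?powR_ge0.
rewrite mulrCA; apply: (@le_trans _ _ (e / Dp * Dp)).
  by rewrite ler_wpM2l//; nneg.
by rewrite mulfVK// gt_eqF.
Qed.

(** As t decreases, n^sig H n t is eventually at least b t^-sig, while its first K terms contribute
    at most S, whatever t. Choosing b t^-sig >= S + 1 leaves mass at least 1 beyond K, where (1 -
    t)^k <= C k^-r <= (C / d) A_k. *)
Let moment_lower (A : nat -> R) (r d M : R) (K : nat) : 0 < r ->
  (forall k, 0 <= A k <= M) -> (0 < K)%N -> 0 < d ->
  (forall k, (K <= k)%N -> d * k%:R `^ (- r) <= A k) ->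
  exists2 q : R, 0 < q &
    \forall n \near \oo, q <= n%:R `^ sig * wsum (a n) A.
Proof.
move=> r0 AM K0 d0 Ad; have [b b0 hb] := asym_lower gam_gt0 sig_gt0 asym.
have [B B0 hB] := asym_upper gam_gt0 sig_gt0 asym.
have h01 : 0 < (1 / 2 : R) <= 1 by lra.
pose S := 2 ^+ K * (B * (1 / 2) `^ (- sig)).
have S0 : 0 < S by rewrite !mulr_gt0 ?powR_gt0 ?exprn_gt0.
pose t := Num.min (1 / 2) (((S + 1) / b) `^ (- sig^-1)).
have Sb : 0 < (S + 1) / b by rewrite divr_gt0//; lra.
have t0 : 0 < t by rewrite lt_min powR_gt0// andbT; lra.
have t01 : 0 < t <= 1.
  by rewrite t0/= ge_min; apply/orP; left; lra.
have bt : S + 1 <= b * t `^ (- sig).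
  rewrite -ler_pdivrMl// mulrC powRN -[leLHS]invrK lef_pV2 ?posrE ?powR_gt0 ?invr_gt0//.
  have -> : ((S + 1) / b)^-1 = (((S + 1) / b) `^ (- sig^-1)) `^ sig.
    by rewrite -powRrM mulNr mulVf ?gt_eqF// powR_inv1// ltW.
  apply: ge0_ler_powR; rewrite ?nnegrE ?powR_ge0//; [exact: ltW|exact: ltW|].
  by rewrite ge_min lexx orbT.
have [C C0 hC] := onemX_le_powR t01 r0.
exists (d / C); first by rewrite divr_gt0.
move: (hb t t01); apply: filterS => n hn.
set N := n%:R `^ sig in hn *; have N0 : 0 <= N by exact: powR_ge0.
rewrite -HE// (wsum_split K (a_sub n) (fun i => powX_in i t01)) in hn.
set W := wsum _ _ in hn.
have h1 : N * \sum_(k < K) a n k * (1 - t) ^+ k <= S.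
  apply: (@le_trans _ _ (N * (2 ^+ K * H n (1 / 2)))); last first.
    by rewrite mulrCA /S ler_wpM2l ?hB// exprn_ge0.
  rewrite ler_wpM2l// -ler_pdivrMl ?exprn_gt0// -HE//.
  apply: le_trans (wsum_ge_partial (M := 1) K (a_sub n) (fun i => powX_in i h01)).
  rewrite mulr_sumr; apply: ler_sum => k _.
  rewrite mulrCA ler_wpM2l// (_ : 1 - 1 / 2 = 2^-1 :> R); last by field.
  rewrite exprVn ler_pdivrMl ?exprn_gt0//.
  apply: (@le_trans _ _ 1); first by have /andP[] := powX_in k t01.
  rewrite ler_pdivlMr ?exprn_gt0// mul1r; apply: ler_weXn2l; first lra.
  exact/ltnW/ltn_ord.
have h2 : W <= C / d * wsum (a n) A.
  have A0 k : 0 <= A k by have /andP[] := AM k.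
  rewrite -wsumZ//; last by nneg.
  apply: (le_wsum (M := C / d * M)) => // k; last first.
    by rewrite ler_wpM2l//; [nneg|have /andP[] := AM k].
  case: ltnP => Kk; first by rewrite lexx /= mulr_ge0//; nneg.
  have /andP[-> _] /= := powX_in k t01.
  apply: le_trans (hC k (leq_trans K0 Kk)) _.
  rewrite -mulrA ler_wpM2l ?(ltW C0)//.
  by rewrite ler_pdivlMl// Ad.
have h3 : 1 <= N * W by lra.
have h4 : N * W <= C / d * (N * wsum (a n) A).
  by rewrite mulrCA ler_wpM2l.
have -> : d / C = (C / d)^-1 by rewrite invf_div.
rewrite -[leLHS]mulr1 ler_pdivrMl ?divr_gt0//.
exact: le_trans h3 h4.
Qed.

Lemma moment_cvg_gt0 (A : nat -> R) (r D d M : R) (K : nat) : sig < r ->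
  (forall k, 0 <= A k <= M) ->
  (forall k, (0 < k)%N -> A k <= D * k%:R `^ (- r)) ->
  (0 < K)%N -> 0 < d ->
  (forall k, (K <= k)%N -> d * k%:R `^ (- r) <= A k) ->
  exists2 q : R, 0 < q & n%:R `^ sig * wsum (a n) A @[n --> \oo] --> q.
Proof.
move=> sr AM AD K0 d0 Ad; have cA := moment_cvg sr AM AD.
exists (limn (fun n => n%:R `^ sig * wsum (a n) A)); last exact: cA.
have r0 : 0 < r by have := sig_gt0; lra.
have [q q0 hq] := moment_lower r0 AM K0 d0 Ad.
by apply: lt_le_trans q0 _; apply: limr_ge.
Qed.

(** The relation A_k ~ c k^-r holds only for k >= K, but the normalisation [w] makes any finite set
    of values of k negligible; beyond K the relative error is at most [eta]. *)
Lemma moment_equivalent (w : nat -> R) (A : nat -> R) (r c l M : R) :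
  0 < r -> (forall n, 0 <= w n) -> (forall k, 0 <= A k <= M) ->
  w n * wsum (a n) (fun k => k%:R `^ (- r)) @[n --> \oo] --> l ->
  (forall k, w n * a n k @[n --> \oo] --> 0) ->
  A k * k%:R `^ r @[k --> \oo] --> c ->
  w n * wsum (a n) A @[n --> \oo] --> c * l.
Proof.
move=> r0 w0 AM wV wa Ac.
have A0 k : 0 <= A k by have /andP[] := AM k.
have c0 : 0 <= c.
  rewrite -(cvg_lim _ Ac)//; apply: limr_ge; first by apply/cvg_ex; exists c.
  by apply: nearW => k; rewrite mulr_ge0 ?powR_ge0.
have M0 : 0 <= M by have := AM 0%N; lra.
pose V n := wsum (a n) (fun k => k%:R `^ (- r)).
have V0 n : 0 <= V n by apply: wsum_ge0.
have p01 (k : nat) : 0 <= (k%:R : R) `^ (- r) <= 1.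
  rewrite powR_ge0/=; case: k => [|k].
    by rewrite powR0// oppr_eq0 gt_eqF.
  rewrite powRN invf_le1 ?powR_gt0// -[leLHS](powRr0 k.+1%:R).
  by apply: ler_powR; rewrite ?ler1n// ltW.
have l0 : 0 <= l.
  rewrite -(cvg_lim _ wV)//; apply: limr_ge; first by apply/cvg_ex; exists l.
  by apply: nearW => n; rewrite mulr_ge0 ?V0.
apply/cvgrPdist_le => e e0.
pose eta := e / 3 / (l + 1).
have eta0 : 0 < eta by rewrite !divr_gt0//; lra.
have [K0 _ hK0] : \forall k \near \oo, `|c - A k * k%:R `^ r| <= eta.
  by move/cvgrPdist_le : Ac; apply.
pose K := K0.+1.
have hK k : (K <= k)%N -> `|A k - c * k%:R `^ (- r)| <= eta * k%:R `^ (- r).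
  move=> Kk; have kp : 0 < k%:R :> R by rewrite ltr0n (leq_trans _ Kk).
  have -> : A k - c * k%:R `^ (- r) = - (c - A k * k%:R `^ r) * k%:R `^ (- r).
    by rewrite powRN; field; rewrite gt_eqF// powR_gt0.
  rewrite normrM normrN (ger0_norm (powR_ge0 _ _)) ler_wpM2r ?powR_ge0//.
  by apply: hK0 => /=; exact: ltnW.
have key n : `|w n * wsum (a n) A - c * (w n * V n)| <=
    eta * (w n * V n) + (M + c) * \sum_(k < K) w n * a n k.
  have -> : w n * wsum (a n) A - c * (w n * V n) = w n * (wsum (a n) A - c * V n) by ring.
  have -> : eta * (w n * V n) + (M + c) * \sum_(k < K) w n * a n k =
     w n * (eta * V n + (M + c) * \sum_(k < K) a n k).
    by rewrite -mulr_sumr; ring.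
  rewrite normrM ger0_norm// ler_wpM2l//.
  rewrite (wsum_split K (a_sub n) AM) {1}/V (wsum_split K (a_sub n) p01).
  set T := wsum _ (fun k => if (k < K)%N then 0 else A k).
  set U := wsum _ (fun k => if (k < K)%N then 0 else k%:R `^ (- r)).
  have U01 k : 0 <= (if (k < K)%N then 0 else (k%:R : R) `^ (- r)) <= 1.
    by case: ifP => // _; rewrite lexx ler01.
  have U0 : 0 <= U by apply: wsum_ge0 => // k; have /andP[] := U01 k.
  have UV : U <= V n.
    apply: (le_wsum (M := 1)) => // k; last by have /andP[] := p01 k.
    by case: ifP => // _; rewrite ?lexx powR_ge0.
  have h1 : T <= (c + eta) * U.
    rewrite -wsumZ//; [|by move=> k; have /andP[] := U01 k|by nneg].
    apply: (le_wsum (M := c + eta)) => // k; last first.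
      by rewrite ler_piMr//; [nneg|have /andP[] := U01 k].
    case: ltnP => Kk; first by rewrite mulr0 !lexx.
    by rewrite A0/=; have := hK k Kk; rewrite ler_norml; lra.
  have h2 : c * U <= T + eta * U.
    rewrite -wsumZ//; last by move=> k; have /andP[] := U01 k.
    rewrite -(wsumZ (c := eta))//; [|by move=> k; have /andP[] := U01 k|by nneg].
    rewrite -(wsumD (M := M + eta))//.
    - apply: (le_wsum (M := M + eta)) => // k.
        case: ltnP => Kk; first by rewrite !mulr0 addr0 lexx.
        rewrite mulr_ge0 ?powR_ge0//=.
        by have := hK k Kk; rewrite ler_norml; lra.
      case: ltnP => Kk; first by rewrite mulr0 addr0; nneg.
      have /andP[_ AkM] := AM k; have /andP[_ k1] := p01 k.
      by rewrite lerD// ler_piMr//; exact: ltW.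
    - move=> k; have := AM k; case: ifP => _; last by have := eta0; lra.
      by move=> _; rewrite lexx /=; nneg.
    - move=> k; have /andP[u0 u1] := U01 k; rewrite mulr_ge0//=; last exact: ltW.
      apply: (@le_trans _ _ eta); last by lra.
      by rewrite ler_piMr//; exact: ltW.
  set s1 := \sum_(_ < K) a n _ * A _.
  set s2 := \sum_(_ < K) a n _ * _ `^ _.
  set s3 := \sum_(_ < K) a n _.
  have g1 : 0 <= s1 <= M * s3.
    rewrite sumr_ge0 => [/=|k _]; last by rewrite mulr_ge0.
    rewrite /s3 mulr_sumr; apply: ler_sum => k _; rewrite mulrC ler_wpM2r//.
    by have /andP[] := AM k.
  have g2 : 0 <= s2 <= s3.
    rewrite sumr_ge0 => [/=|k _]; last by rewrite mulr_ge0// powR_ge0.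
    apply: ler_sum => k _; rewrite ler_piMr//.
    by have /andP[] := p01 k.
  have g3 : 0 <= c * s2 <= c * s3 by rewrite mulr_ge0 ?ler_wpM2l//; lra.
  have g4 : eta * U <= eta * V n by rewrite ler_wpM2l// ltW.
  rewrite mulrDr mulrDl ler_norml; apply/andP; split; lra.
have wV1 : \forall n \near \oo, `|l - w n * V n| <= Num.min 1 (e / 3 / (c + 1)).
  by move/cvgrPdist_le : wV; apply; rewrite lt_min ltr01 !divr_gt0//; lra.
have wS : (M + c) * \sum_(k < K) w n * a n k @[n --> \oo] --> (0 : R).
  rewrite -[X in _ --> X](mulr0 (M + c)); apply: cvgM; first exact: cvg_cst.
  exact: (@cvgn_bigsum0 _ _ (fun n k => w n * a n k)).
move/cvgrPdist_le/(_ (e / 3)) : wS; rewrite divr_gt0// => /(_ isT) wS.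
apply: filterS2 wV1 wS => n; rewrite le_min => /andP[h1 h2]; rewrite sub0r normrN => h3.
have -> : c * l - w n * wsum (a n) A =
  c * (l - w n * V n) - (w n * wsum (a n) A - c * (w n * V n)) by ring.
apply: le_trans (ler_normB _ _) _; rewrite normrM (ger0_norm c0).
have i1 : c * `|l - w n * V n| <= e / 3.
  apply: (@le_trans _ _ (c * (e / 3 / (c + 1)))); first by rewrite ler_wpM2l.
  rewrite mulrCA ler_piMr//; first by rewrite divr_ge0// ltW.
  by rewrite ler_pdivrMr; lra.
have i2 : eta * (w n * V n) <= e / 3.
  apply: (@le_trans _ _ (eta * (l + 1))); last by rewrite /eta divfK// gt_eqF//; lra.
  by rewrite ler_wpM2l ?(ltW eta0)//; move: h1; rewrite ler_norml; lra.
have i3 := le_trans (key n) (lerD i2 (le_trans (ler_norm _) h3)).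
apply: le_trans (lerD i1 i3) _; lra.
Qed.

End harmonic_moment_asymptotics.

(** * Gamma integrals *)

Section integrals.
Context {R : realType}.
Let mu := @lebesgue_measure R.

Lemma measurable_powRl_comp (D : set R) (f : R -> R) (p : R) :
  measurable_fun D f -> measurable_fun D (fun u => f u `^ p).
Proof. by move=> mf; apply: (measurableT_comp (measurable_powR p)). Qed.

Lemma measurable_expR_comp (D : set R) (f : R -> R) :
  measurable_fun D f -> measurable_fun D (fun u => expR (f u)).
Proof. by move=> mf; apply: measurableT_comp. Qed.

Lemma measurable_exp_decay (D : set R) (c : R) :
  measurable_fun D (fun u : R => expR (- (c * u))).
Proof.
apply: measurable_funTS; apply: measurable_expR_comp.
by apply: measurableT_comp.
Qed.

Definition gamma_kernel (r c u : R) : R := u `^ (r - 1) * expR (- (c * u)).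

Lemma measurable_gamma_kernel (D : set R) r c :
  measurable_fun D (gamma_kernel r c).
Proof.
apply: measurable_funM; last exact: measurable_exp_decay.
by apply: measurable_powRl_comp.
Qed.

Lemma gamma_kernel_ge0 r c u : 0 <= gamma_kernel r c u.
Proof. by rewrite mulr_ge0 ?powR_ge0 ?expR_ge0. Qed.

(** Substitution on the half-line asks for continuity up to 0, and r > 1 is what makes u^(r - 1)
    vanish there. *)
Lemma continuous_gamma_kernel r c : 1 < r ->
  {within `[0, +oo[, continuous (gamma_kernel r c)}.
Proof.
move=> r1.
have ce (x : R) : {for x, continuous (fun u : R => expR (- (c * u)))}.
  apply: continuous_comp; last exact: continuous_expR.
  apply: continuousN; apply: continuousM; first exact: cst_continuous.
  exact: cvg_id.
apply/continuous_within_itvcyP; split.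
  move=> x; rewrite in_itv/= andbT => x0.
  rewrite /continuous_at /gamma_kernel.
  by apply: cvgM; [exact: continuous_powRl|exact: ce].
rewrite /gamma_kernel; apply: cvgM.
  rewrite [X in _ --> X]powR0; last by rewrite gt_eqF//; lra.
  by apply: powR_cvg0; lra.
apply: cvg_at_right_filter; exact: ce.
Qed.

Lemma integral_itv0y (f : R -> R) : measurable_fun [set: R] f ->
  (\int[mu]_(u in `]0%R, +oo[) (f u)%:E = \int[mu]_(u in `[0%R, +oo[) (f u)%:E)%E.
Proof.
move=> mf; apply: integral_itv_obnd_cbnd.
by apply/measurable_EFinP; exact: measurable_funTS.
Qed.

Lemma integral_exp_half :
  (\int[mu]_(u in `]0%R, +oo[) (expR (- (2^-1 * u)))%:E <= 2%:E)%E.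
Proof.
have h0 : 0 < 2^-1 :> R by [].
have -> : (2%:E = 2%:E * \int[mu]_x (exponential_pdf (2^-1 : R) x)%:E)%E.
  by rewrite integral_exponential_pdf ?mule1.
rewrite -ge0_integralZl//=; last 2 first.
- by apply/measurable_EFinP; exact: measurable_exponential_pdf.
- by move=> x _; rewrite lee_fin exponential_pdf_ge0// ltW.
apply: (@le_trans _ _ (\int[mu]_(u in `]0%R, +oo[) (2%:E * (exponential_pdf 2^-1 u)%:E))%E).
  apply: ge0_le_integral => //=.
  - by apply/measurable_EFinP; exact: measurable_exp_decay.
  - by apply/measurable_EFinP/measurable_funM => //; apply: measurable_funTS;
      exact: measurable_exponential_pdf.
  - move=> x; rewrite in_itv/= andbT => x0; rewrite -EFinM lee_fin.
    rewrite exponential_pdfE ?(ltW x0)//.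
    by rewrite mulrA divff// mul1r mulNr.
apply: ge0_subset_integral => //=.
- by apply/measurable_EFinP/measurable_funM => //; exact: measurable_exponential_pdf.
- by move=> x _; rewrite -EFinM lee_fin mulr_ge0// exponential_pdf_ge0// ltW.
Qed.

(** [Gamma] is the [fine] of an extended integral, so finiteness must be shown before it can be
    used: u^(r - 1) <= C exp(u / 2) bounds it above. On [1, 2] the integrand is at least exp(- 2),
    hence positivity. *)
Lemma Gamma_integral (r : R) : 1 < r ->
  (\int[mu]_(u in `]0%R, +oo[) (gamma_kernel r 1 u)%:E = (Gamma r)%:E)%E /\
  0 < Gamma r.
Proof.
move=> r1; have r10 : 0 < r - 1 by rewrite subr_gt0.
have [C C0 hC] := powR_le_expR r10 (ltac:(lra) : 0 < 2^-1 :> R).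
set I := (\int[mu]_(u in _) _)%E.
have EI : Gamma r = fine I.
  rewrite /Gamma /Rintegral; congr fine; apply: eq_integral => u _.
  by rewrite /gamma_kernel mul1r.
have Ile : (I <= (C * 2)%:E)%E.
  rewrite EFinM; apply: le_trans (lee_wpmul2l _ integral_exp_half); last by rewrite lee_fin ltW.
  rewrite -ge0_integralZl//=; last 2 first.
  - by apply/measurable_EFinP; exact: measurable_exp_decay.
  - by rewrite lee_fin ltW.
  apply: ge0_le_integral => //=.
  - by move=> x _; rewrite lee_fin gamma_kernel_ge0.
  - by apply/measurable_EFinP; exact: measurable_gamma_kernel.
  - by apply/measurable_EFinP/measurable_funM => //; exact: measurable_exp_decay.
  - move=> x; rewrite in_itv/= andbT => x0; rewrite -EFinM lee_fin /gamma_kernel mul1r.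
    apply: (@le_trans _ _ (C * expR (2^-1 * x) * expR (- x))).
      by rewrite ler_wpM2r ?expR_ge0// hC.
    by rewrite -mulrA -expRD ler_wpM2l ?ler_expR ?(ltW C0)//; lra.
have Ige : ((expR (- 2))%:E <= I)%E.
  apply: (@le_trans _ _ (\int[mu]_(u in `[1%R, 2%R]) (gamma_kernel r 1 u)%:E)%E); last first.
    apply: ge0_subset_integral => //=.
    - by apply/measurable_EFinP; exact: measurable_gamma_kernel.
    - by move=> x _; rewrite lee_fin gamma_kernel_ge0.
    - by move=> x /=; rewrite !in_itv/= andbT => /andP[x1 _]; lra.
  apply: (@le_trans _ _ (\int[mu]_(u in `[1%R, 2%R]) (cst (expR (- 2))%:E u))%E).
    rewrite integral_cst//= lebesgue_measure_itv/= lte_fin ltr1n -EFinB.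
    by rewrite (_ : 2 - 1 = 1 :> R) ?mule1//; ring.
  apply: ge0_le_integral => //=.
  - by apply/measurable_EFinP; exact: measurable_gamma_kernel.
  - move=> x; rewrite in_itv/= => /andP[x1 x2]; rewrite lee_fin /gamma_kernel mul1r.
    rewrite -[leLHS]mul1r ler_pM ?expR_ge0 ?ler_expR//; last lra.
    by rewrite -[leLHS](powRr0 x); apply: ler_powR => //; exact: ltW.
have Ifin : I \is a fin_num.
  rewrite ge0_fin_numE; last by apply: le_trans Ige; rewrite lee_fin expR_ge0.
  by apply: le_lt_trans Ile _; rewrite ltry.
split; first by rewrite EI fineK.
rewrite EI -lte_fin fineK//; apply: lt_le_trans Ige.
by rewrite lte_fin expR_gt0.
Qed.

Lemma gamma_kernel_scaling (r c : R) : 1 < r -> 0 < c ->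
  (\int[mu]_(u in `]0%R, +oo[) (gamma_kernel r c u)%:E =
   (c `^ (- r) * Gamma r)%:E)%E.
Proof.
move=> r1 c0; have [GE _] := @Gamma_integral r r1.
pose F := fun u : R => c * u.
have F'E : F^`()%classic = cst c.
  by apply/funext => x; rewrite derive1Ml// derive1_id mulr1.
have F0 : F 0 = 0 by rewrite /F mulr0.
have cF (x : R) : {for x, continuous F}.
  by apply: continuousM; [exact: cst_continuous|exact: cvg_id].
have Fpos : F x @[x --> +oo] --> +oo by apply: gt0_cvgMry => //; exact: cvg_id.
have cG : {within `[F 0, +oo[, continuous (gamma_kernel r 1)}.
  by rewrite F0; exact: continuous_gamma_kernel.
have := @increasing_ge0_integration_by_substitutiony R F (gamma_kernel r 1) 0.
rewrite F'E F0 -!integral_itv0y; last 2 first.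
- apply: measurable_funM => //; apply: measurableT_comp.
    exact: measurable_gamma_kernel.
  exact: measurable_funM.
- exact: measurable_gamma_kernel.
rewrite GE => sub.
rewrite EFinM.
have {sub} -> : (Gamma r)%:E =
    (\int[mu]_(u in `]0%R, +oo[) ((c `^ r)%:E * (gamma_kernel r c u)%:E))%E.
  apply: etrans (sub _ _ _ _ _ _ _ _) _ => //.
  - by move=> x y _ _ xy; rewrite /F ltr_pM2l.
  - by move=> x _; exact: cst_continuous.
  - by apply/cvg_ex; exists c; exact: cvg_cst.
  - by apply/cvg_ex; exists c; exact: cvg_cst.
  - split; first by move=> x _; apply: derivableM.
    by apply: cvg_at_right_filter; exact: cF.
  - by rewrite -F0.
  - by move=> x _; exact: gamma_kernel_ge0.
  apply: eq_integral => x; rewrite inE/= in_itv/= andbT => x0.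
  rewrite -EFinM; congr EFin.
  transitivity (gamma_kernel r 1 (c * x) * c); first by [].
  rewrite /gamma_kernel mul1r powRM; [|exact: ltW|exact: ltW].
  by rewrite -(mulr_powRB1 (ltW c0) (_ : 0 < r)); [ring|lra].
rewrite ge0_integralZl//; last 3 first.
- by apply/measurable_EFinP; exact: measurable_gamma_kernel.
- by move=> x _; rewrite lee_fin gamma_kernel_ge0.
- by rewrite lee_fin powR_ge0.
rewrite muleA -EFinM powRN mulVf ?mul1e//.
by rewrite gt_eqF// powR_gt0.
Qed.

Lemma integral_itvcc_invr (x y : R) : 0 < x -> x < y ->
  (\int[mu]_(u in `[x, y]) (u^-1)%:E = (ln y - ln x)%:E)%E.
Proof.
move=> x0 xy; have y0 := lt_trans x0 xy.
rewrite (@continuous_FTC2 _ _ (@ln R))//.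
- apply: continuous_in_subspaceT => z; rewrite inE/= in_itv/= => /andP[xz _].
  by apply: cvgV; [rewrite gt_eqF// (lt_le_trans x0)|exact: cvg_id].
- split.
  + move=> z; rewrite in_itv/= => /andP[xz _].
    by apply: ex_derive; apply: is_derive1_ln; exact: lt_trans xz.
  + by apply: cvg_at_right_filter; exact: continuous_ln.
  + by apply: cvg_at_left_filter; exact: continuous_ln.
- move=> z; rewrite in_itv/= => /andP[xz _]; rewrite derive1E.
  by apply: derive_val; apply: is_derive1_ln; exact: lt_trans xz.
Qed.

(** Integrability of the function used later for dominated convergence, from the explicit
    antiderivative [F], which vanishes at infinity. *)
Lemma integral_onedXN_lty (p : R) : 1 < p ->
  (\int[mu]_(u in `[0%R, +oo[) ((1 + u) `^ (- p))%:E < +oo)%E.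
Proof.
move=> p1; have p0 : 0 < p - 1 by rewrite subr_gt0.
pose F := fun u : R => - (p - 1)^-1 * (1 + u) `^ (1 - p).
have c1 (q x : R) : 0 <= x -> {for x, continuous (fun u : R => (1 + u) `^ q)}.
  move=> x0; apply: (@continuous_comp _ _ _ (fun u : R => 1 + u) (fun y => y `^ q)).
    by apply: continuousD; [exact: cst_continuous|exact: cvg_id].
  by apply: continuous_powRl; rewrite ltr_wpDr.
have dd (q x : R) : 0 < x -> is_derive x 1 (fun u : R => (1 + u) `^ q) (q * (1 + x) `^ (q - 1)).
  move=> x0; have x1 : 1 + x \in `]0, +oo[ by rewrite in_itv/= andbT addr_gt0.
  have sh : is_derive x 1 (fun u : R => 1 + u) 1.
    have := is_deriveD (is_derive_cst (1 : R) x (1 : R)) (is_derive_id x (1 : R)).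
    by rewrite add0r; exact.
  have pw : is_derive (1 + x) 1 (fun y : R => y `^ q) (q * (1 + x) `^ (q - 1)).
    by apply: DeriveDef; [exact: derivable_powR|rewrite -derive1E powR_derive1].
  have := is_derive1_comp pw sh.
  rewrite mulr1; exact.
rewrite (@ge0_continuous_FTC2y _ _ F _ 0)//.
- by rewrite add0e -EFinN ltry.
- by move=> x _; exact: powR_ge0.
- apply/continuous_within_itvcyP; split.
    by move=> x; rewrite in_itv/= andbT => x0; apply: c1; exact: ltW.
  by apply: cvg_at_right_filter; exact: c1.
- rewrite -[X in _ --> X](mulr0 (- (p - 1)^-1)); apply: cvgM; first exact: cvg_cst.
  apply/cvgrPdist_le => e e0.
  near=> u; rewrite sub0r normrN ger0_norm ?powR_ge0//.
  have u0 : 0 < 1 + u.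
    by rewrite addr_gt0//; near: u; exact: nbhs_pinfty_gt.
  rewrite -(opprB p 1) powRN -[leRHS]invrK lef_pV2 ?posrE ?invr_gt0 ?powR_gt0//.
  have -> : e^-1 = (e `^ (- (p - 1)^-1)) `^ (p - 1).
    by rewrite -powRrM mulNr mulVf ?gt_eqF// powR_inv1// ltW.
  apply: ge0_ler_powR; rewrite ?nnegrE ?powR_ge0//; [exact: ltW|exact: ltW|].
  apply: (@le_trans _ _ u); last by rewrite lerDr.
  by near: u; apply: nbhs_pinfty_ge; exact: num_real.
- move=> x x0; apply: derivableM; first exact: derivable_cst.
  by have := dd (1 - p) x x0 => h; apply: ex_derive.
- by apply: cvgM; [exact: cvg_cst|apply: cvg_at_right_filter; exact: c1].
- move=> x; rewrite in_itv/= andbT => x0.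
  have [d1 d2] := dd (1 - p) x x0.
  rewrite /F derive1Ml// derive1E d2 mulrA (_ : 1 - p - 1 = - p); last by ring.
  by rewrite (_ : - (p - 1)^-1 * (1 - p) = 1) ?mul1r//; field; rewrite gt_eqF.
Unshelve. all: by end_near. Qed.

End integrals.

(** * Harmonic moments *)

Lemma measurable_invr (R : realType) (A : set R) : measurable A ->
  (forall u, A u -> 0 <= u) -> measurable_fun A (fun u : R => u^-1).
Proof.
move=> mA A0; apply: (eq_measurable_fun (fun u : R => u `^ (-1))).
  by move=> u /set_mem uA; rewrite powR_inv1// A0.
by apply: measurable_powRl_comp.
Qed.

Section laplace.
Context {R : realType}.
Let mu := @lebesgue_measure R.
Implicit Types a : nat -> R.

(** The value 0 at k = 0 restricts the transform to Z_n > 0. Without it the atom at 0 would spoil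
    the integrability in u at infinity. *)
Definition laplace_weight (u : R) (k : nat) : R :=
  if k == 0%N then 0 else expR (- (k%:R * u)).

Definition laplace a (u : R) : R := wsum a (laplace_weight u).

Lemma laplace_weight_ge0 u k : 0 <= laplace_weight u k.
Proof. by rewrite /laplace_weight; case: ifP => // _; exact: expR_ge0. Qed.

Lemma laplace_weight_in u k : 0 <= u -> 0 <= laplace_weight u k <= 1.
Proof.
move=> u0; rewrite laplace_weight_ge0/= /laplace_weight; case: ifP => // _.
by rewrite expR_le1 oppr_le0 mulr_ge0.
Qed.

Lemma measurable_laplace_weight (D : set R) (c : R) k :
  measurable_fun D (fun u => laplace_weight (u * c) k).
Proof.
rewrite /laplace_weight; case: (k == 0)%N; first exact: measurable_cst.
rewrite (_ : (fun u => _) = (fun u => expR (- (k%:R * c * u)))).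
  exact: measurable_exp_decay.
by apply/funext => u; rewrite [u * c]mulrC mulrA.
Qed.

Lemma laplace_le1 a u : subprobability_weights a -> 0 <= u -> 0 <= laplace a u <= 1.
Proof.
move=> ha u0; have [a0 a1] := ha; apply/andP; split.
  by apply: wsum_ge0 => // k; exact: laplace_weight_ge0.
rewrite -lee_fin -(wsumE (M := 1))//; last by move=> k; exact: laplace_weight_in.
apply: le_trans a1; apply: lee_nneseries => k _; rewrite lee_fin.
  by move=> _; rewrite mulr_ge0// laplace_weight_ge0.
by rewrite ler_piMr//; have /andP[] := laplace_weight_in k u0.
Qed.

Lemma wsum_powN_bounded (r : R) k : 0 < r -> 0 <= (k%:R : R) `^ (- r) <= 1.
Proof.
move=> r0; rewrite powR_ge0/=; case: k => [|k].
  by rewrite powR0// oppr_eq0 gt_eqF.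
rewrite powRN invf_le1 ?powR_gt0// -[leLHS](powRr0 k.+1%:R).
by apply: ler_powR; rewrite ?ler1n// ltW.
Qed.

Lemma measurable_laplace a (D : set R) (c : R) : subprobability_weights a ->
  measurable D -> 0 < c -> (forall u, D u -> 0 <= u) ->
  measurable_fun D (fun u => laplace a (u * c)).
Proof.
move=> ha mD c0 D0; have [a0 _] := ha; apply/measurable_EFinP.
apply: (@eq_measurable_fun _ _ _ _ D
   (fun u => \sum_(0 <= k <oo) (a k * laplace_weight (u * c) k)%:E)%E).
  move=> u; rewrite inE => Du; rewrite /= -(wsumE (M := 1))// => k.
  by apply: laplace_weight_in; apply: mulr_ge0; [exact: D0|exact: ltW].
apply: ge0_emeasurable_sum => //.
  by move=> k u Du _; rewrite lee_fin mulr_ge0// laplace_weight_ge0.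
move=> k _; apply/measurable_EFinP/measurable_funM => //.
exact: measurable_laplace_weight.
Qed.

(* From k^-r Gamma(r) = int_0^oo u^(r-1) exp(-k u) du. *)
Lemma harmonic_moment_integral a (r c : R) : subprobability_weights a ->
  1 < r -> 0 < c ->
  (\int[mu]_(u in `]0%R, +oo[) (u `^ (r - 1) * laplace a (u * c))%:E =
   (c `^ (- r) * (wsum a (fun k => k%:R `^ (- r)) * Gamma r))%:E)%E.
Proof.
move=> ha r1 c0; have [a0 _] := ha; have r0 : 0 < r by lra.
have [GE G0] := Gamma_integral r1.
pose F k (u : R) := (a k * (u `^ (r - 1) * laplace_weight (u * c) k))%:E.
have F0 k u : (0 <= F k u)%E.
  by rewrite lee_fin !mulr_ge0// ?powR_ge0// laplace_weight_ge0.
have IF k : (\int[mu]_(u in `]0%R, +oo[) F k u =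
             (c `^ (- r) * Gamma r * (a k * k%:R `^ (- r)))%:E)%E.
  (* At k = 0 both sides vanish, since 0 to a nonzero power is 0 for [powR], negative exponents
     included. *)
  case: (posnP k) => [->|k0].
    rewrite powR0 ?oppr_eq0 ?gt_eqF// !mulr0.
    by apply: integral0_eq => u _; rewrite /F /laplace_weight/= !mulr0.
  have kc : 0 < k%:R * c by rewrite mulr_gt0// ltr0n.
  have -> : (\int[mu]_(u in `]0%R, +oo[) F k u =
     \int[mu]_(u in `]0%R, +oo[) ((a k)%:E * (gamma_kernel r (k%:R * c) u)%:E))%E.
    apply: eq_integral => u _; rewrite /F -EFinM /laplace_weight (negbTE (lt0n_neq0 k0)).
    by rewrite /gamma_kernel -[k%:R * c * u]mulrA [c * u]mulrC.
  rewrite ge0_integralZl//; last 3 first.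
  - by apply/measurable_EFinP; exact: measurable_gamma_kernel.
  - by move=> u _; rewrite lee_fin gamma_kernel_ge0.
  - by rewrite lee_fin.
  rewrite gamma_kernel_scaling// -EFinM powRM ?ler0n ?(ltW c0)//.
  by congr EFin; ring.
transitivity (\int[mu]_(u in `]0%R, +oo[) \sum_(0 <= k <oo) F k u)%E.
  apply: eq_integral => u; rewrite inE/= in_itv/= andbT => u0.
  rewrite EFinM /laplace -(wsumE (M := 1))//; last first.
    by move=> k; apply: laplace_weight_in; rewrite mulr_ge0// ltW.
  rewrite -nneseriesZl; last first.
    by move=> k _; rewrite lee_fin mulr_ge0// laplace_weight_ge0.
  by apply: eq_eseriesr => k _; rewrite -EFinM /F mulrCA.
rewrite integral_nneseries//; last first.
  move=> k; apply/measurable_EFinP/measurable_funM => //.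
  apply: measurable_funM; first exact: measurable_powRl_comp.
  exact: measurable_laplace_weight.
rewrite (eq_eseriesr (fun k _ => IF k)).
have -> : c `^ (- r) * (wsum a (fun k => k%:R `^ (- r)) * Gamma r) =
  (c `^ (- r) * Gamma r) * wsum a (fun k => k%:R `^ (- r)) by ring.
rewrite [RHS]EFinM -(wsumE (M := 1))//; last by move=> k; exact: wsum_powN_bounded.
rewrite -nneseriesZl; last by move=> k _; rewrite lee_fin mulr_ge0// powR_ge0.
by apply: eq_eseriesr => k _; rewrite -EFinM.
Qed.

End laplace.

Section harmonic_moments.
Context {R : realType}.
Let mu := @lebesgue_measure R.
Variables (gam sig : R) (H : nat -> R -> R) (a : nat -> nat -> R).
Hypotheses (gam_gt0 : 0 < gam) (sig_gt1 : 1 < sig).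
Hypothesis asym : critical_asymptotics gam sig H.
Hypothesis a_sub : forall n, subprobability_weights (a n).
Hypothesis HE : forall n (t : R), 0 < t <= 1 ->
  wsum (a n) (fun k => (1 - t) ^+ k) = H n t.

Let sig_gt0 : 0 < sig. Proof. by have := sig_gt1; lra. Qed.

Let onem_expR_in (u : R) : 0 < u -> 0 < 1 - expR (- u) <= 1.
Proof. by move=> u0; rewrite subr_gt0 expR_lt1 oppr_lt0 u0 gerBl expR_ge0. Qed.

Lemma laplaceE n (u : R) : 0 < u -> laplace (a n) u = H n (1 - expR (- u)) - a n 0.
Proof.
move=> u0; have t01 := onem_expR_in u0.
have p01 k : 0 <= (1 - (1 - expR (- u))) ^+ k <= 1.
  by rewrite opprB addrC subrK exprn_ge0 ?expR_ge0// exprn_ile1 ?expR_ge0// expR_le1 oppr_le0 ltW.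
rewrite -HE// (wsum_split 1 (a_sub n) p01) big_ord1 expr0 mulr1 addrAC subrr add0r.
congr wsum; apply/funext => -[|k]; rewrite /laplace_weight//=.
by rewrite opprB addrC subrK -expRM_natl mulrN.
Qed.

Lemma laplace_le n (u : R) : 0 < u -> laplace (a n) u <= H n (1 - expR (- u)).
Proof. by move=> u0; rewrite laplaceE// gerBl; have [] := a_sub n. Qed.

(** Only k >= 1 contributes, and then (k - 1)(u - d) >= 0 gives exp(- k u) <= exp(d - u) exp(- k
    d). *)
Lemma laplace_decay n (d u : R) : 0 < d -> d <= u ->
  laplace (a n) u <= expR (d - u) * H n (1 - expR (- d)).
Proof.
move=> d0 du; have [a0 _] := a_sub n.
apply: (@le_trans _ _ (expR (d - u) * laplace (a n) d)); last first.
  by rewrite ler_wpM2l ?expR_ge0// laplace_le.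
rewrite /laplace -wsumZ ?expR_ge0//; last by move=> k; exact: laplace_weight_ge0.
apply: (le_wsum (M := expR (d - u))) => // k; last first.
  by rewrite ler_piMr ?expR_ge0//; have /andP[] := laplace_weight_in k (ltW d0).
rewrite laplace_weight_ge0/= /laplace_weight; case: ifP => k0; first by rewrite mulr0.
rewrite -expRD ler_expR.
have k1 : 1 <= k%:R :> R by rewrite ler1n lt0n k0.
have : 0 <= (k%:R - 1) * (u - d) by rewrite mulr_ge0 ?subr_ge0.
by move: (k%:R) => x; lra.
Qed.

(** For u <= 1, 1 - exp(- u) >= u / 2 and the bound on H applies; for u > 1, exponential decay from
    u = 1 beats any power of u. *)
Lemma laplace_upper : exists2 C : R, 0 < C & forall n (u : R), 0 < u ->
  n%:R `^ sig * laplace (a n) u <= C * u `^ (- sig).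
Proof.
have [B B0 hB] := asym_upper gam_gt0 sig_gt0 asym.
have [C1 C10 hC1] := powR_le_expR sig_gt0 (ltr01 : 0 < 1 :> R).
have e1 : 0 < 1 - expR (- 1) :> R by have /andP[] := onem_expR_in ltr01.
pose D := B * (1 - expR (- 1)) `^ (- sig).
have D0 : 0 < D by rewrite mulr_gt0 ?powR_gt0.
exists (B * 2 `^ sig + D * expR 1 * C1) => [|n u u0].
  by rewrite addr_gt0 ?mulr_gt0 ?powR_gt0 ?expR_gt0.
have us0 : 0 < u `^ (- sig) by rewrite powR_gt0.
have N0 : 0 <= n%:R `^ sig by exact: powR_ge0.
have P1 : 0 <= D * expR 1 * C1 by rewrite !mulr_ge0 ?expR_ge0 ?ltW.
have P2 : 0 <= B * 2 `^ sig by rewrite mulr_ge0 ?powR_ge0 ?ltW.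
have [u1|u1] := leP u 1.
  have t01 := onem_expR_in u0.
  apply: (@le_trans _ _ (B * (1 - expR (- u)) `^ (- sig))).
    by apply: le_trans (hB n _ t01); rewrite ler_wpM2l// laplace_le.
  apply: (@le_trans _ _ (B * 2 `^ sig * u `^ (- sig))); last first.
    by rewrite ler_wpM2r ?lerDl// ltW.
  rewrite -mulrA ler_wpM2l ?(ltW B0)//.
  have -> : 2 `^ sig * u `^ (- sig) = (u / 2) `^ (- sig).
    rewrite powRM ?(ltW u0)// mulrC; congr (_ * _).
    by rewrite -powR_inv1// -powRrM mulN1r opprK.
  rewrite !powRN lef_pV2 ?posrE ?powR_gt0//; [|by have /andP[] := t01|by rewrite divr_gt0].
  apply: ge0_ler_powR; rewrite ?nnegrE ?(ltW sig_gt0)//.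
  - by rewrite divr_ge0// ltW.
  - by have /andP[/ltW] := t01.
  apply: le_trans (onem_expRN_ge (ltW u0)).
  by rewrite ler_wpM2l ?(ltW u0)// lef_pV2 ?posrE//; lra.
apply: (@le_trans _ _ (D * expR 1 * C1 * u `^ (- sig))); last first.
  by rewrite ler_wpM2r ?lerDr// ltW.
apply: (@le_trans _ _ (n%:R `^ sig * (expR (1 - u) * H n (1 - expR (- 1))))).
  by rewrite ler_wpM2l// laplace_decay// ltW.
rewrite mulrCA; apply: (@le_trans _ _ (expR (1 - u) * D)).
  by rewrite ler_wpM2l ?expR_ge0// hB// onem_expR_in.
have key : expR (- u) <= C1 * u `^ (- sig).
  rewrite powRN ler_pdivlMr ?powR_gt0// expRN mulrC ler_pdivrMr ?expR_gt0//.
  by have := hC1 u u0; rewrite mul1r.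
have -> : expR (1 - u) * D = D * expR 1 * expR (- u) by rewrite expRD; ring.
by rewrite -[leRHS]mulrA ler_wpM2l// mulr_ge0 ?expR_ge0 ?(ltW D0).
Qed.

(** The transform differs from H by the atom a_n(0), which is O(n^-sig). *)
Lemma laplace_scaling (u : R) : 0 < u ->
  laplace (a n) (u / n%:R) @[n --> \oo] --> (1 + gam * u) `^ (- sig).
Proof.
move=> u0; have c1 := asym_scaling gam_gt0 sig_gt0 asym u0.
have [D D0 hD] := scaled_weight_bounded gam_gt0 sig_gt0 asym a_sub HE 0.
have c2 : a n 0 @[n --> \oo] --> (0 : R).
  apply/cvgrPdist_le => e e0.
  have [K K0 hK] := powRN_small sig_gt0 (divr_gt0 e0 D0).
  exists K => // n /= Kn; rewrite sub0r normrN ger0_norm; last by have [] := a_sub n.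
  have n0 : 0 < n%:R `^ sig :> R by rewrite powR_gt0// ltr0n (leq_trans K0).
  have := hD n; rewrite -ler_pdivlMl// => h; apply: le_trans h _.
  by rewrite -powRN -ler_pdivlMr// hK.
rewrite -[X in _ --> X]subr0 -cvg_shiftS /=.
have -> : (fun n => laplace (a n.+1) (u / n.+1%:R)) =
  (fun n => H n.+1 (1 - expR (- (u / n.+1%:R))) - a n.+1 0).
  by apply/funext => n; rewrite laplaceE// divr_gt0.
move: c1 c2; rewrite -cvg_shiftS /= => c1; rewrite -cvg_shiftS /= => c2.
exact: cvgB.
Qed.

Let moment_integral n (r : R) : 1 < r ->
  (\int[mu]_(u in `]0%R, +oo[) (u `^ (r - 1) * laplace (a n.+1) (u / n.+1%:R))%:E =
   (n.+1%:R `^ r * (wsum (a n.+1) (fun k => k%:R `^ (- r)) * Gamma r))%:E)%E.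
Proof.
move=> r1; rewrite harmonic_moment_integral ?invr_gt0//.
by rewrite -[X in X `^ (- r)]powR_inv1// -powRrM mulN1r opprK.
Qed.

Let laplace_scaled_upper : exists2 C : R, 0 < C & forall n (u : R), 0 < u ->
  laplace (a n.+1) (u / n.+1%:R) <= C * u `^ (- sig).
Proof.
have [C C0 hC] := laplace_upper; exists C => // n u u0.
have n0 : 0 < n.+1%:R :> R by [].
have := hC n.+1 (u / n.+1%:R) (divr_gt0 u0 n0).
rewrite powRM ?invr_ge0 ?(ltW u0) ?(ltW n0)//.
rewrite -[X in _ * (_ * X `^ (- sig))]powR_inv1// -powRrM mulN1r opprK.
by rewrite [C * _]mulrA [_ * (n.+1%:R `^ _)]mulrC ler_pM2l// powR_gt0.
Qed.

(** After u is replaced by u / n the integrand converges pointwise. It is at most 1 on (0, 1] and at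
    most C u^(r - 1 - sig) beyond; both are dominated by a multiple of (1 + u)^-p, with p = 1 + sig
    - r > 1 exactly because r < sig. *)
Lemma harmonic_moment_cvg (r : R) : 1 < r -> r < sig ->
  exists2 l : R,
    (\int[mu]_(s in `]0%R, +oo[) ((1 + gam * s) `^ (- sig) * s `^ (r - 1))%:E = l%:E)%E &
    n%:R `^ r * wsum (a n) (fun k => k%:R `^ (- r)) @[n --> \oo] --> l / Gamma r.
Proof.
move=> r1 rs; have [GE G0] := Gamma_integral r1; have g0 := gam_gt0.
pose p := 1 + sig - r; have p1 : 1 < p by rewrite /p; lra.
have [C C0 hC] := laplace_scaled_upper.
pose D : set R := `]0%R, +oo[%classic.
have mD : measurable D by exact: measurable_itv.
have D0 u : D u -> 0 < u by rewrite /D/= in_itv/= andbT.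
pose f_ n (u : R) : \bar R := (u `^ (r - 1) * laplace (a n.+1) (u / n.+1%:R))%:E.
pose f (u : R) : \bar R := ((1 + gam * u) `^ (- sig) * u `^ (r - 1))%:E.
pose g (u : R) : \bar R := ((1 + C) * 2 `^ p * (1 + u) `^ (- p))%:E.
have mg (A : set R) : measurable_fun A (fun u : R => (1 + u) `^ (- p)).
  by apply: measurable_powRl_comp; apply: measurable_funD.
have mf_ n : measurable_fun D (f_ n).
  apply/measurable_EFinP/measurable_funM; first exact: measurable_powRl_comp.
  by apply: measurable_laplace; rewrite ?invr_gt0// => u /D0 /ltW.
have mf : measurable_fun D f.
  apply/measurable_EFinP/measurable_funM; last exact: measurable_powRl_comp.
  by apply: measurable_powRl_comp; apply: measurable_funD => //; exact: measurable_funM.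
have f_f : {ae mu, forall u, D u -> f_ ^~ u @ \oo --> f u}.
  apply: aeW => u /D0 u0.
  apply: cvg_EFin; first exact: nearW.
  rewrite mulrC; apply: cvgM; first exact: cvg_cst.
  have := laplace_scaling u0; rewrite -cvg_shiftS; exact.
have ig : mu.-integrable D g.
  apply/integrableP; split; first by apply/measurable_EFinP/measurable_funM; [exact: measurable_cst|exact: mg].
  have K0 : 0 <= (1 + C) * 2 `^ p by rewrite mulr_ge0 ?powR_ge0//; lra.
  have -> : (\int[mu]_(u in D) `|g u| =
      \int[mu]_(u in D) (((1 + C) * 2 `^ p)%:E * ((1 + u) `^ (- p))%:E))%E.
    apply: eq_integral => u _.
    by rewrite /g gee0_abs ?EFinM// -EFinM lee_fin mulr_ge0 ?powR_ge0.
  rewrite ge0_integralZl//; last 2 first.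
  - by apply/measurable_EFinP; exact: mg.
  - by move=> u _; rewrite lee_fin powR_ge0.
  rewrite /D integral_itv0y ?mg//; apply: lte_mul_pinfty.
  - by rewrite lee_fin.
  - by [].
  - exact: integral_onedXN_lty.
have dom n (u : R) : 0 < u ->
    u `^ (r - 1) * laplace (a n.+1) (u / n.+1%:R) <= (1 + C) * 2 `^ p * (1 + u) `^ (- p).
  move=> u0; have u'0 : 0 <= u / n.+1%:R by rewrite divr_ge0// ltW.
  have /andP[L0 L1] := laplace_le1 (a_sub n.+1) u'0.
  (* Used with v = 1 when u <= 1 and with v = u when u > 1. *)
  have key (v : R) : 0 < v -> 1 + u <= 2 * v -> v `^ (- p) <= 2 `^ p * (1 + u) `^ (- p).
    move=> v0 uv; have u1 : 0 < 1 + u by rewrite addr_gt0.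
    rewrite !powRN ler_pdivlMr ?powR_gt0// mulrC ler_pdivrMr ?powR_gt0// -powRM ?(ltW v0)//.
    by apply: ge0_ler_powR; rewrite ?nnegrE//; lra.
  have P0 : 0 <= 2 `^ p * (1 + u) `^ (- p) by rewrite mulr_ge0 ?powR_ge0.
  have [u1|u1] := leP u 1.
    apply: (@le_trans _ _ 1).
      rewrite -[leRHS]mulr1 ler_pM ?powR_ge0//.
      apply: (@le_trans _ _ (1 `^ (r - 1))); last by rewrite powR1.
      by apply: ge0_ler_powR; rewrite ?nnegrE//; lra.
    have k1 : 1 <= 2 `^ p * (1 + u) `^ (- p).
      by have := key 1 ltr01; rewrite powR1; apply; lra.
    rewrite -mulrA; apply: le_trans k1 _.
    by rewrite mulrDl mul1r lerDl mulr_ge0// ltW.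
  apply: (@le_trans _ _ (C * u `^ (- p))).
    have -> : u `^ (- p) = u `^ (r - 1) * u `^ (- sig).
      rewrite -powRD; last by apply/implyP => _; rewrite gt_eqF.
      by congr (_ `^ _); rewrite /p; ring.
    by rewrite mulrCA ler_wpM2l ?powR_ge0// hC.
  rewrite -mulrA ler_pM ?(ltW C0) ?powR_ge0//; first lra.
  by apply: key; lra.
have f_g : {ae mu, forall u n, D u -> (`|f_ n u| <= g u)%E}.
  apply: aeW => u n /D0 u0; rewrite gee0_abs ?lee_fin ?dom//.
  rewrite mulr_ge0 ?powR_ge0//.
  have u'0 : 0 <= u / n.+1%:R by rewrite divr_ge0// ltW.
  by have /andP[] := laplace_le1 (a_sub n.+1) u'0.
have [fint _ fcvg] := dominated_convergence (mu := @lebesgue_measure R) mD mf_ mf f_f ig f_g.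
have ffin : (\int[@lebesgue_measure R]_(x in D) f x)%E \is a fin_num by apply: integrable_fin_num.
exists (fine (\int[mu]_(u in D) f u)%E); first by rewrite fineK.
set l := fine _.
have c1 : n.+1%:R `^ r * (wsum (a n.+1) (fun k => k%:R `^ (- r)) * Gamma r)
    @[n --> \oo] --> l.
  have fE : (fun n => \int[@lebesgue_measure R]_(u in D) f_ n u)%E =
      (fun n => (n.+1%:R `^ r *
        (wsum (a n.+1) (fun k => k%:R `^ (- r)) * Gamma r))%:E).
    by apply/funext => n; exact: moment_integral.
  move: fcvg; rewrite fE -(fineK ffin) => /fine_cvg; exact.
rewrite -cvg_shiftS.
rewrite (_ : (fun n => _) = (fun n => n.+1%:R `^ r *
  (wsum (a n.+1) (fun k => k%:R `^ (- r)) * Gamma r) / Gamma r)); last first.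
  by apply/funext => n /=; rewrite mulrA mulfK// gt_eqF.
by apply: cvgM; [exact: c1|exact: cvg_cst].
Qed.

(** In the range M <= u <= d n, the estimate of [asym_uniform] is moved from t = 1 - exp(- x) to x =
    u / n. The cost is a factor (x / t)^sig close to 1 and the atom at 0, which contributes
    O(x^sig). *)
Let laplace_uniform (e : R) : 0 < e -> exists d M : R, [/\ 0 < d, 0 < M &
  forall n (u : R), M <= u -> u <= d * n.+1%:R ->
  `|u `^ sig * laplace (a n.+1) (u / n.+1%:R) - gam `^ (- sig)| <= e].
Proof.
move=> e0; pose g := gam `^ (- sig); have g0 : 0 < g by rewrite powR_gt0.
have e4 : 0 < e / 4 by rewrite divr_gt0.
have [D D0 hD] := scaled_weight_bounded gam_gt0 sig_gt0 asym a_sub HE 0.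
have [d [M [/andP[d0 d1] M0 hdM]]] := asym_uniform gam_gt0 sig_gt0 asym e4.
have s0 := sig_gt0.
(* [eta] satisfies (1 + eta)(g + e / 4) = g + e / 2, and [x0] below satisfies x0^sig D = e / 2. *)
pose eta := e / 4 / (g + e / 4).
have eta0 : 0 < eta by rewrite divr_gt0// addr_gt0.
have /cvgrPdist_le/(_ _ eta0) := @continuous_powRl R sig 1 ltr01.
rewrite near_simpl => -[rho /= rho0 hrho].
pose x0 := (e / 2 / D) `^ (sig^-1).
have ed : 0 < e / 2 / D by rewrite !divr_gt0.
have x00 : 0 < x0 by rewrite powR_gt0.
pose del := Num.min (Num.min d (rho / 2)) x0.
have del0 : 0 < del by rewrite !lt_min d0 x00 divr_gt0.
have deld : del <= d by rewrite !ge_min lexx.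
have delr : del <= rho / 2 by rewrite !ge_min lexx orbT.
have delx : del <= x0 by rewrite ge_min lexx orbT.
(* The factor 2 compensates t >= x / 2, so that u >= 2 M forces n t >= M. *)
exists del, (2 * M); split => //; first by rewrite mulr_gt0.
move=> n u Mu un; have n0 : 0 < n.+1%:R :> R by [].
have u0 : 0 < u by apply: lt_le_trans Mu; rewrite mulr_gt0.
pose x := u / n.+1%:R; have xp : 0 < x by rewrite divr_gt0.
have xd : x <= del by rewrite ler_pdivrMr.
pose t := 1 - expR (- x); have t01 : 0 < t <= 1 by exact: onem_expR_in.
have /andP[t0 t1] := t01.
have tx : t <= x by exact: onem_expRN_le.
have xt : x / (1 + x) <= t by apply: onem_expRN_ge; exact: ltW.
have uE : u = n.+1%:R * x by rewrite /x mulrC mulfVK// gt_eqF.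
have x1 : 0 < 1 + x by rewrite addr_gt0.
have nt0 : 0 < n.+1%:R * t by rewrite mulr_gt0.
have xt' : x <= t * (1 + x) by rewrite -ler_pdivrMr.
have ntM : M <= n.+1%:R * t.
  have : 2 * M <= n.+1%:R * (t * (1 + x)).
    by apply: le_trans Mu _; rewrite {1}uE ler_wpM2l// ltW.
  have : n.+1%:R * (t * (1 + x)) <= n.+1%:R * (t * 2).
    by rewrite ler_wpM2l ?(ltW n0)// ler_wpM2l ?(ltW t0)//; lra.
  by rewrite mulrA; lra.
have hH := hdM n.+1 t ltac:(apply/andP; split; lra) ntM.
set h := H n.+1 t in hH.
have h0 : 0 <= h.
  rewrite /h -HE//; apply: wsum_ge0 => k; first by have [] := a_sub n.+1.
  by rewrite exprn_ge0 ?subr_ge0.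
pose y := x / t; have y1 : 1 <= y by rewrite ler_pdivlMr ?mul1r.
have yd : y <= 1 + del by rewrite ler_pdivrMr// mulrC; apply: le_trans xt' _; rewrite ler_wpM2l ?(ltW t0)//; lra.
have ys1 : 1 <= y `^ sig.
  by rewrite -[leLHS](powRr0 y); apply: ler_powR => //; exact: ltW.
have ys2 : y `^ sig <= 1 + eta.
  have := hrho y; rewrite /ball_/= powR1 => hy.
  have : `|1 - y `^ sig| <= eta by apply: hy; rewrite ler0_norm ?subr_le0//; lra.
  by rewrite ler_norml; lra.
have uS : u `^ sig = y `^ sig * (n.+1%:R * t) `^ sig.
  rewrite -powRM ?(ltW nt0)//; last lra.
  by congr (_ `^ _); rewrite uE /y; field; rewrite gt_eqF.
have a00 : 0 <= a n.+1 0 by have [] := a_sub n.+1.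
have uD : u `^ sig * a n.+1 0 <= e / 2.
  apply: (@le_trans _ _ (x0 `^ sig * (n.+1%:R `^ sig * a n.+1 0))).
    rewrite mulrA ler_wpM2r// uE mulrC powRM ?(ltW n0) ?(ltW xp)// ler_wpM2r ?powR_ge0//.
    by apply: ge0_ler_powR; rewrite ?nnegrE ?powR_ge0 ?(ltW xp) ?(ltW s0)//; lra.
  apply: (@le_trans _ _ (x0 `^ sig * D)); first by rewrite ler_wpM2l ?powR_ge0.
  rewrite /x0 -powRrM mulVf ?gt_eqF// powRr1 ?(ltW ed)//.
  by rewrite mulfVK// gt_eqF.
have uD0 : 0 <= u `^ sig * a n.+1 0 by rewrite mulr_ge0 ?powR_ge0.
rewrite laplaceE// -/x -/t -/h mulrBr uS -mulrA -uS.
move: hH; set W := _ * h; rewrite !ler_norml => /andP[W1 W2].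
have W0 : 0 <= W by rewrite mulr_ge0 ?powR_ge0.
have yW1 : W <= y `^ sig * W by rewrite -[leLHS]mul1r ler_wpM2r.
have yW2 : y `^ sig * W <= (1 + eta) * (g + e / 4).
  by rewrite ler_pM ?powR_ge0//; rewrite /g; lra.
have etaE : eta * (g + e / 4) = e / 4 by rewrite /eta divfK// gt_eqF// addr_gt0.
rewrite mulrDl mul1r etaE in yW2.
move: yW2; rewrite /g => yW2.
by apply/andP; split; lra.
Qed.

(** At r = sig the rescaled integrand is close to gam^-sig / u on M <= u <= d n, which contributes
    gam^-sig ln n up to O(1) and a relative error e'. The pieces u < M and u > d n stay bounded. *)
Lemma harmonic_moment_cvg_log :
  n%:R `^ sig / ln n%:R * wsum (a n) (fun k => k%:R `^ (- sig)) @[n --> \oo]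
    --> gam `^ (- sig) / Gamma sig.
Proof.
have [GE G0] := Gamma_integral sig_gt1; have s0 := sig_gt0; have s1 := sig_gt1.
pose g := gam `^ (- sig); have g0 : 0 < g by rewrite powR_gt0.
pose X n := n.+1%:R `^ sig * (wsum (a n.+1) (fun k => k%:R `^ (- sig)) * Gamma sig).
pose f n (u : R) := u `^ (sig - 1) * laplace (a n.+1) (u / n.+1%:R).
have XE n : (\int[mu]_(u in `]0%R, +oo[) (f n u)%:E = (X n)%:E)%E by exact: moment_integral.
have L01 n (u : R) : 0 <= u -> 0 <= laplace (a n.+1) (u / n.+1%:R) <= 1.
  by move=> u0; apply: laplace_le1 => //; rewrite divr_ge0.
have f0 n (u : R) : 0 <= u -> 0 <= f n u.
  by move=> u0; rewrite mulr_ge0 ?powR_ge0//; have /andP[] := L01 n u u0.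
have mf n (A : set R) : measurable A -> (forall u, A u -> 0 <= u) -> measurable_fun A (f n).
  move=> mA A0; apply: measurable_funM; first exact: measurable_powRl_comp.
  by apply: measurable_laplace; rewrite ?invr_gt0.
suff XL : X n / ln n.+1%:R @[n --> \oo] --> g.
  rewrite -cvg_shiftS.
  rewrite (_ : (fun n => _) = (fun n => X n / ln n.+1%:R / Gamma sig)); last first.
    apply/funext => n /=; rewrite /X -!mulrA; congr (_ * _).
    by rewrite [Gamma sig * _]mulrC divfK ?gt_eqF// mulrC.
  by apply: cvgM; [exact: XL|exact: cvg_cst].
apply/cvgrPdist_le => e e0.
pose e' := Num.min (e / 2) (g / 2).
have e'0 : 0 < e' by rewrite lt_min !divr_gt0.
have e'e : e' <= e / 2 by rewrite ge_min lexx.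
have e'g : e' <= g / 2 by rewrite ge_min lexx orbT.
have [d [M [d0 M0 hdM]]] := laplace_uniform e'0.
have [B B0 hB] := asym_upper gam_gt0 sig_gt0 asym.
have td := onem_expR_in d0.
pose Bd := B * (1 - expR (- d)) `^ (- sig).
have Bd0 : 0 <= Bd by rewrite mulr_ge0 ?powR_ge0 ?(ltW B0).
(* Bound for the piece u > d n: by [laplace_decay], the factor n^-sig of H is compensated by the
   n^sig from the scaling of the Gamma integral. *)
pose K2 := expR d * Bd * Gamma sig.
have fM n (u : R) : 0 < u -> M <= u -> u <= d * n.+1%:R ->
    (g - e') / u <= f n u <= (g + e') / u.
  move=> u0 Mu ud; have := hdM n u Mu ud.
  have -> : f n u = u `^ sig * laplace (a n.+1) (u / n.+1%:R) / u.
    by rewrite /f -(mulr_powRB1 (ltW u0) s0); field; rewrite gt_eqF.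
  rewrite -/g ler_norml => /andP[h1 h2].
  by rewrite !ler_wpM2r ?invr_ge0 ?(ltW u0)//; lra.
have lower n : M < d * n.+1%:R -> (g - e') * (ln (d * n.+1%:R) - ln M) <= X n.
  move=> Md; rewrite -lee_fin -XE EFinM -(integral_itvcc_invr M0 Md).
  rewrite -ge0_integralZl//=; last 3 first.
  - apply/measurable_EFinP; apply: measurable_invr => // u /=; rewrite in_itv/= => /andP[Mu _]; lra.
  - move=> u; rewrite in_itv/= => /andP[Mu _]; rewrite lee_fin invr_ge0; lra.
  - by rewrite lee_fin; lra.
  apply: (@le_trans _ _ (\int[mu]_(u in `[M, (d * n.+1%:R)%R]) (f n u)%:E)%E).
    apply: ge0_le_integral => //=.
    - move=> u; rewrite in_itv/= => /andP[Mu _].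
      by rewrite -EFinM lee_fin mulr_ge0 ?invr_ge0//; lra.
    - by apply/measurable_EFinP/measurable_funM => //; apply: measurable_invr => // u /=; rewrite in_itv/= => /andP[Mu _]; lra.
    - by apply/measurable_EFinP; apply: mf => // u /=; rewrite in_itv/= => /andP[Mu _]; lra.
    - move=> u; rewrite in_itv/= => /andP[Mu ud].
      by have /andP[] := fM n u (lt_le_trans M0 Mu) Mu ud.
  apply: ge0_subset_integral => //=.
  - by apply/measurable_EFinP; apply: mf => // u /=; rewrite in_itv/= andbT => /ltW.
  - by move=> u; rewrite in_itv/= andbT => u0; rewrite lee_fin f0// ltW.
  - by move=> u /=; rewrite !in_itv/= andbT => /andP[Mu _]; exact: lt_le_trans Mu.
have upper n : M < d * n.+1%:R ->
    X n <= M `^ sig + ((g + e') * (ln (d * n.+1%:R) - ln M) + K2).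
  move=> Md; set y := d * n.+1%:R in Md *; have y0 := lt_trans M0 Md.
  have n0 : 0 < n.+1%:R :> R by [].
  have D1 : `]0%R, +oo[%classic = `]0, M[%classic `|` (`[M, y]%classic `|` `]y, +oo[%classic) :> set R.
    apply/seteqP; split => u /=; rewrite !in_itv/= ?andbT.
      move=> u0; have [uM|Mu] := ltP u M; first by left; rewrite u0.
      by right; have [uy|yu] := leP u y; [left|right].
    by case=> [/andP[]//|[/andP[Mu _]|yu]]; [exact: lt_le_trans Mu|exact: lt_trans yu].
  have pos (u : R) : 0 <= u -> (0 <= (f n u)%:E)%E by move=> u0; rewrite lee_fin f0.
  have mE (A : set R) : measurable A -> (forall u, A u -> 0 <= u) ->
    measurable_fun A (fun u => (f n u)%:E).
    by move=> mA A0; apply/measurable_EFinP; exact: mf.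
  have A1 (u : R) : `]0%R, M[%classic u -> 0 <= u by rewrite /= in_itv/= => /andP[/ltW].
  have A2 (u : R) : `[M, y]%classic u -> 0 <= u.
    by rewrite /= in_itv/= => /andP[Mu _]; apply: le_trans Mu; exact: ltW.
  have A3 (u : R) : `]y, +oo[%classic u -> 0 <= u.
    by rewrite /= in_itv/= andbT => yu; apply/ltW; exact: lt_trans yu.
  have A23 (u : R) : (`[M, y]%classic `|` `]y, +oo[%classic) u -> 0 <= u.
    by case; [exact: A2|exact: A3].
  have A123 (u : R) : (`]0%R, M[%classic `|` (`[M, y]%classic `|` `]y, +oo[%classic)) u -> 0 <= u.
    by case; [exact: A1|exact: A23].
  rewrite -lee_fin -XE D1 ge0_integral_setU//=; last 4 first.
  - exact: measurableU.
  - by apply: mE A123 => //; do ?apply: measurableU.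
  - by move=> u /A123; exact: pos.
  - apply/disj_setPLR => u /= ; rewrite !in_itv/= andbT => /andP[_ uM].
    by case=> [/andP[Mu _]|yu]; [move: uM; rewrite ltNge Mu|have := lt_trans (lt_trans Md yu) uM; rewrite ltxx].
  rewrite ge0_integral_setU//=; last 3 first.
  - by apply: mE A23 => //; exact: measurableU.
  - by move=> u /A23; exact: pos.
  - by apply/disj_setPLR => u /=; rewrite !in_itv/= andbT => /andP[_ uy]; rewrite ltNge uy.
  rewrite EFinD; apply: leeD.
    apply: (@le_trans _ _ (\int[mu]_(u in `]0%R, M[) (cst (M `^ (sig - 1))%:E u))%E).
      apply: ge0_le_integral => //=.
      - by move=> u /A1; exact: pos.
      - exact: mE A1.
      - move=> u uin; have u0 := A1 u uin; rewrite lee_fin /f.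
        have /andP[l0 l1] := L01 n u u0.
        rewrite -[leRHS]mulr1 ler_pM ?powR_ge0//.
        move: uin; rewrite in_itv/= => /andP[_ uM].
        by apply: ge0_ler_powR; rewrite ?nnegrE//; lra.
    rewrite integral_cst//= lebesgue_measure_itv/= lte_fin M0 oppr0 adde0 -EFinM lee_fin.
    by rewrite mulrC mulr_powRB1// ltW.
  rewrite EFinD; apply: leeD.
    rewrite EFinM -(integral_itvcc_invr M0 Md) -ge0_integralZl//=; last 3 first.
    - apply/measurable_EFinP; apply: measurable_invr => // u /=; rewrite in_itv/= => /andP[Mu _]; lra.
    - by move=> u /A2 u0; rewrite lee_fin invr_ge0.
    - by rewrite lee_fin; lra.
    apply: ge0_le_integral => //=.
    - by move=> u /A2; exact: pos.
    - exact: mE A2.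
    - by apply/measurable_EFinP/measurable_funM => //; apply: measurable_invr => // u /=; rewrite in_itv/= => /andP[Mu _]; lra.
    - move=> u; rewrite in_itv/= => /andP[Mu ud].
      by have /andP[] := fM n u (lt_le_trans M0 Mu) Mu ud.
  pose K3 := expR d * Bd * n.+1%:R `^ (- sig).
  have K30 : 0 <= K3 by rewrite mulr_ge0 ?powR_ge0// mulr_ge0 ?expR_ge0.
  apply: (@le_trans _ _ (\int[mu]_(u in `]0%R, +oo[) (K3%:E * (gamma_kernel sig n.+1%:R^-1 u)%:E))%E).
    apply: (@le_trans _ _ (\int[mu]_(u in `]y, +oo[) (K3%:E * (gamma_kernel sig n.+1%:R^-1 u)%:E))%E).
      apply: ge0_le_integral => //=.
      - by move=> u /A3; exact: pos.
      - exact: mE A3.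
      - by apply/measurable_EFinP/measurable_funM => //; exact: measurable_gamma_kernel.
      - move=> u; rewrite in_itv/= andbT => yu; rewrite -EFinM lee_fin /f /gamma_kernel.
        rewrite mulrCA ler_wpM2l ?powR_ge0//.
        have du : d <= u / n.+1%:R by rewrite ler_pdivlMr// ltW.
        apply: le_trans (laplace_decay n.+1 d0 du) _.
        rewrite expRD /K3 [n.+1%:R^-1 * u]mulrC -!mulrA ler_wpM2l ?expR_ge0//.
        rewrite !mulrA [leLHS]mulrC ler_wpM2r ?expR_ge0//.
        by rewrite [n.+1%:R `^ _]powRN ler_pdivlMr ?powR_gt0// mulrC hB.
    apply: ge0_subset_integral => //=.
    - by apply/measurable_EFinP/measurable_funM => //; exact: measurable_gamma_kernel.
    - by move=> u _; rewrite -EFinM lee_fin mulr_ge0// gamma_kernel_ge0.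
    - by move=> u /=; rewrite !in_itv/= !andbT; exact: lt_trans.
  rewrite (_ : (\int[mu]_(u in _) _)%E = (K3%:E * \int[mu]_(u in `]0%R, +oo[) (gamma_kernel sig n.+1%:R^-1 u)%:E)%E); last first.
    apply: ge0_integralZl => //=.
    - by apply/measurable_EFinP; exact: measurable_gamma_kernel.
    - by move=> u _; rewrite lee_fin gamma_kernel_ge0.
  rewrite gamma_kernel_scaling ?invr_gt0// -EFinM lee_fin /K3 /K2.
  have -> : n.+1%:R^-1 `^ (- sig) = n.+1%:R `^ sig :> R by rewrite -powR_inv1// -powRrM mulN1r opprK.
  have -> : expR d * Bd * n.+1%:R `^ (- sig) * (n.+1%:R `^ sig * Gamma sig) =
    expR d * Bd * Gamma sig * (n.+1%:R `^ (- sig) * n.+1%:R `^ sig) by ring.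
  by rewrite powRN mulVf ?mulr1// gt_eqF// powR_gt0.
pose K := (g + e') * `|ln d - ln M| + M `^ sig + K2.
have K0 : 0 <= K.
  have K20 : 0 <= K2 by rewrite mulr_ge0 ?(ltW G0)// mulr_ge0 ?expR_ge0.
  by rewrite /K !addr_ge0 ?powR_ge0// mulr_ge0//; lra.
(* ln n >= T makes all the bounded terms, collected in [K], at most (e / 2) ln n. *)
pose T := 1 + K / (e / 2).
exists (Num.truncn (Num.max (M / d) (expR T))).+1 => // n /= hn.
have /andP[n1 n2] : (M / d < n.+1%:R) && (expR T < n.+1%:R).
  rewrite -gt_max; apply: lt_le_trans (truncnS_gt _) _; rewrite ler_nat.
  exact: leqW.
have Md : M < d * n.+1%:R by rewrite mulrC -ltr_pdivrMr.
have n0 : 0 < n.+1%:R :> R by [].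
set L := ln n.+1%:R; have LT : T <= L by rewrite -[leLHS]expRK ler_ln ?posrE ?expR_gt0// ltW.
have L0 : 0 < L by apply: lt_le_trans LT; rewrite /T ltr_wpDr// divr_ge0//; lra.
have KL : K <= e / 2 * L.
  rewrite -ler_pdivrMl ?divr_gt0// mulrC; apply: le_trans LT; rewrite /T; lra.
have lnE : ln (d * n.+1%:R) - ln M = L + (ln d - ln M).
  by rewrite lnM ?posrE// /L; ring.
have := lower n Md; have := upper n Md; rewrite lnE => up lo.
have ab := ler_norm (ln d - ln M); have ab' := ler_norm (- (ln d - ln M)).
rewrite normrN in ab'; rewrite /K in KL.
move: up lo ab ab' KL; set c := ln d - ln M => up lo ab ab' KL.
have -> : g - X n / L = (g * L - X n) / L by field; rewrite gt_eqF.
rewrite normrM normfV (gtr0_norm L0) ler_pdivrMr// ler_norml.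
have c1 : (g + e') * c <= (g + e') * `|c| by rewrite ler_wpM2l//; lra.
have c2 : (g - e') * (- c) <= (g + e') * `|c|.
  apply: (@le_trans _ _ ((g - e') * `|c|)); first by rewrite ler_wpM2l//; lra.
  by rewrite ler_wpM2r//; lra.
have eL : e' * L <= e / 2 * L by rewrite ler_wpM2r// ltW.
have eL2 : (e / 2) * L *+ 2 = e * L by field.
have P1 := powR_ge0 M sig.
have P2 : 0 <= K2 by rewrite mulr_ge0 ?(ltW G0)// mulr_ge0 ?expR_ge0.
apply/andP; split; lra.
Qed.

End harmonic_moments.

(** * Independence *)

Section pi_systems.
Context {d : measure_display} {T : measurableType d} {R : realType}.
Variable P : probability T R.
Local Open Scope ereal_scope.

(** With A fixed, B |-> P(B and A) and B |-> P(B) P(A) are finite measures that agree on a pi-system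
    containing the whole space, hence on the sigma-algebra it generates. *)
Lemma indep_event_sigma (G : set (set T)) (A : set T) :
  measurable A -> G `<=` measurable -> setI_closed G -> G setT ->
  (forall B, G B -> P (B `&` A) = P B * P A) ->
  forall B, <<s G >> B -> P (B `&` A) = P B * P A.
Proof.
move=> mA Gm GI GT GA B sB.
pose m1 := mrestr P mA.
have pA : (0 <= fine (P A))%R by exact: fine_ge0.
pose m2 := mscale (NngNum pA) P.
have PAE : (fine (P A))%:E = P A by rewrite fineK// fin_num_measure.
have -> : P (B `&` A) = m1 B by [].
have m2E C : m2 C = P C * P A by rewrite -[in RHS]PAE muleC.
rewrite -m2E.
apply: (@g_sigma_algebra_measure_unique _ _ _ G Gm (fun=> setT)) => //.
- by rewrite bigcup_const//; exists 0%N.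
- by move=> C GC; apply: etrans (esym (m2E C)); exact: GA.
- by move=> _; rewrite /= /mrestr setTI; apply: le_lt_trans (probability_le1 P mA) _; exact: ltry.
Qed.

Lemma indep_pi_systems (G1 G2 : set (set T)) :
  G1 `<=` measurable -> G2 `<=` measurable ->
  setI_closed G1 -> setI_closed G2 -> G1 setT -> G2 setT ->
  (forall A B, G1 A -> G2 B -> P (A `&` B) = P A * P B) ->
  forall A B, <<s G1 >> A -> <<s G2 >> B -> P (A `&` B) = P A * P B.
Proof.
move=> m1 m2 I1 I2 T1 T2 G12 A B sA sB.
have mB : measurable B by exact: (smallest_sub (@sigma_algebra_measurable _ T) m2).
apply: (indep_event_sigma mB m1 I1 T1) sA => A' GA'.
rewrite setIC muleC; apply: (indep_event_sigma (m1 _ GA') m2 I2 T2) sB => B' GB'.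
by rewrite setIC muleC G12.
Qed.

(** The joint law is the product of the marginal laws, as they agree on rectangles; Tonelli then
    factors the integral. *)
Lemma indep_expectationM (f g : T -> R) :
  measurable_fun setT f -> measurable_fun setT g ->
  (forall w, (0 <= f w)%R) -> (forall w, (0 <= g w)%R) ->
  (forall A B : set R, measurable A -> measurable B ->
    P (f @^-1` A `&` g @^-1` B) = P (f @^-1` A) * P (g @^-1` B)) ->
  \int[P]_w (f w * g w)%:E = \int[P]_w (f w)%:E * \int[P]_w (g w)%:E.
Proof.
move=> mf mg f0 g0 fg.
pose F : {RV P >-> R} := HB.pack f (@isMeasurableFun.Build _ _ _ _ f mf).
pose G : {RV P >-> R} := HB.pack g (@isMeasurableFun.Build _ _ _ _ g mg).
have mfg : measurable_fun setT (fun w => (f w, g w)) by exact/measurable_fun_pairP.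
pose FG : {RV P >-> (R * R)%type} := HB.pack (fun w => (f w, g w)) (@isMeasurableFun.Build _ _ _ _ _ mfg).
(* Positive parts make the integrand nonnegative on the whole plane; they change nothing on the
   values of f and g. *)
pose p (z : R * R) : \bar R := (Num.max z.1 0 * Num.max z.2 0)%:E.
have mp : measurable_fun setT p.
  apply/measurable_EFinP/measurable_funM.
    by apply: measurable_maxr => //; exact: measurable_cst.
  by apply: measurable_maxr => //; exact: measurable_cst.
have p0 z : 0 <= p z by rewrite lee_fin mulr_ge0// le_max lexx orbT.
have m0 (x : R) : (0 <= Num.max x 0)%R by rewrite le_max lexx orbT.
have mm : measurable_fun setT (fun x : R => (Num.max x 0)%:E).
  by apply/measurable_EFinP; apply: measurable_maxr => //; exact: measurable_cst.
have -> : \int[P]_w (f w * g w)%:E = \int[distribution P FG]_z p z.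
  rewrite ge0_integral_distribution//; apply: eq_integral => w _ /=.
  by rewrite /p/= !max_l.
have -> : \int[P]_w (f w)%:E = \int[distribution P F]_x (Num.max x 0)%:E.
  rewrite ge0_integral_distribution//.
  by apply: eq_integral => w _ /=; rewrite max_l.
have -> : \int[P]_w (g w)%:E = \int[distribution P G]_x (Num.max x 0)%:E.
  rewrite ge0_integral_distribution//.
  by apply: eq_integral => w _ /=; rewrite max_l.
rewrite (eq_measure_integral (distribution P F \x distribution P G)); last first.
  move=> A mA _; apply/esym; apply: product_measure_unique => // B C mB mC.
rewrite fubini_tonelli1//= /fubini_F/=.
transitivity (\int[distribution P F]_x ((Num.max x 0)%:E * \int[distribution P G]_y (Num.max y 0)%:E)).
  apply: eq_integral => x _; rewrite -ge0_integralZl//.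
  - by move=> y _; rewrite lee_fin m0.
  - by rewrite lee_fin m0.
rewrite ge0_integralZr//.
  by move=> x _; rewrite lee_fin m0.
by apply: integral_ge0 => x _; rewrite lee_fin m0.
Qed.

End pi_systems.

Section blocks.
Context {d : measure_display} {T : measurableType d} {R : realType}.
Variable P : probability T R.
Context {I : choiceType} {d' : measure_display} {U : measurableType d'}.
Variable X : I -> T -> U.
Hypothesis mX : forall i, measurable_fun setT (X i).
Local Open Scope ereal_scope.

(** For [J = setT] this generates [family_sigma_algebra] by definition, which lets the hypotheses of
    [independent_families] apply to events shown measurable with respect to a block. *)
Definition block_gen (J : set I) : set (set T) :=
  \bigcup_(i in J) preimage_set_system setT (X i) measurable.

Lemma measurable_block (J : set I) i : J i ->
  measurable_fun setT (X i : g_sigma_algebraType (block_gen J) -> U).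
Proof.
move=> Ji _ A mA; apply: sub_sigma_algebra; exists i => //.
by exists A.
Qed.

(** A pi-system, which [block_gen] need not be, generating a sigma-algebra that contains that of the
    block. *)
Let cylinders (J : set I) : set (set T) :=
  [set C | exists F : {fset I}, exists A : I -> set U,
    [/\ [set` F] `<=` J, forall i, measurable (A i) &
        C = \bigcap_(i in [set` F]) X i @^-1` A i]].

Let cylinders_setI J : setI_closed (cylinders J).
Proof.
move=> _ _ [F1 [A1 [FJ1 mA1 ->]]] [F2 [A2 [FJ2 mA2 ->]]].
exists (F1 `|` F2)%fset.
exists (fun i => (if i \in F1 then A1 i else setT) `&` (if i \in F2 then A2 i else setT)).
split.
- by move=> i /=; rewrite in_fsetU => /orP[/FJ1|/FJ2].
- by move=> i; apply: measurableI; case: ifP.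
apply/seteqP; split => w /=.
  move=> [h1 h2] i /=; rewrite in_fsetU => iF; split.
    by case: ifP => // /h1.
  by case: ifP => // /h2.
move=> h; split => i /= iF.
  by have := h i; rewrite /= in_fsetU iF => /(_ isT) [].
by have := h i; rewrite /= in_fsetU iF orbT => /(_ isT) [].
Qed.

Let cylindersT J : cylinders J setT.
Proof. by exists fset0, (fun=> setT); split => //; apply/seteqP; split. Qed.

Let cylinders_measurable J : cylinders J `<=` measurable.
Proof.
move=> _ [F [A [_ mA ->]]]; apply: fin_bigcap_measurable => // i _.
by rewrite -[X in measurable X]setTI; exact: mX.
Qed.

Let block_sub_cylinders J : <<s block_gen J >> `<=` <<s cylinders J >>.
Proof.
apply: sub_sigma_algebra2 => _ [i Ji [A mA <-]].
exists [fset i]%fset, (fun=> A); split => //.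
  by move=> j /=; rewrite in_fset1 => /eqP ->.
apply/seteqP; split => w /=.
  by move=> [_ Aw] j /=; rewrite in_fset1 => /eqP ->.
by move=> /(_ i); rewrite /= in_fset1 eqxx => /(_ isT).
Qed.

(** Cylinders over disjoint finite index sets intersect in a cylinder over the union, whose
    probability factors; the pi-system argument does the rest. *)
Lemma indep_blocks (J1 J2 : set I) : mutually_independent P X ->
  J1 `&` J2 = set0 -> forall A B, <<s block_gen J1 >> A -> <<s block_gen J2 >> B ->
  P (A `&` B) = P A * P B.
Proof.
move=> Xind J12 A B /block_sub_cylinders sA /block_sub_cylinders sB.
apply: (indep_pi_systems _ _ _ _ _ _ _ sA sB) => //.
move=> _ _ [F1 [A1 [FJ1 mA1 ->]]] [F2 [A2 [FJ2 mA2 ->]]].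
have F12 i : i \in F1 -> i \in F2 -> False.
  by move=> /FJ1 h1 /FJ2 h2; have : (J1 `&` J2) i by []; rewrite J12.
pose C i := if i \in F1 then A1 i else A2 i.
have mC i : measurable (C i) by rewrite /C; case: ifP.
have -> : \bigcap_(i in [set` F1]) X i @^-1` A1 i `&` \bigcap_(i in [set` F2]) X i @^-1` A2 i
    = \bigcap_(i in [set` (F1 `|` F2)%fset]) X i @^-1` C i.
  apply/seteqP; split => w /=.
    move=> [h1 h2] i /=; rewrite in_fsetU /C; case: ifP => [iF _|_ /= iF]; first exact: h1.
    exact: h2.
  move=> h; split => i /= iF.
    by have := h i; rewrite /= in_fsetU iF /C iF => /(_ isT).
  have := h i; rewrite /= in_fsetU iF orbT /C => /(_ isT).
  by case: ifP => // iF1; have := F12 _ iF1 iF.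
rewrite !Xind//.
rewrite (perm_big (F1 ++ F2)) /=; last first.
  apply: uniq_perm => [||i]; rewrite ?fset_uniq//.
    rewrite cat_uniq !fset_uniq andbT/=; apply/hasPn => i iF; apply/negP => iF'; exact: F12 iF.
  by rewrite mem_cat in_fsetU.
rewrite big_cat/=; congr (_ * _); apply: eq_big_seq => i iF; rewrite /C ?iF//.
by case: ifP => // iF1; have := F12 _ iF1 iF.
Qed.

Lemma expectation_prod (s : seq I) (g : I -> U -> R) : mutually_independent P X ->
  uniq s -> (forall i, measurable_fun setT (g i)) -> (forall i x, (0 <= g i x)%R) ->
  \int[P]_w (\prod_(i <- s) g i (X i w))%:E = \prod_(i <- s) \int[P]_w (g i (X i w))%:E.
Proof.
move=> Xind us mg g0; elim: s us => [_|i s IH /= /andP[si us]].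
  rewrite big_nil; under eq_integral do rewrite big_nil.
  by rewrite integral_cst//= probability_setT mule1.
rewrite big_cons -IH//; under eq_integral do rewrite big_cons.
apply: indep_expectationM => //.
- exact: measurableT_comp.
- by apply: measurable_prod => j _; exact: measurableT_comp.
- by move=> w; apply: prodr_ge0 => j _.
move=> A B mA mB; apply: (indep_blocks (J1 := [set i]) (J2 := [set` s]) Xind).
- by apply/seteqP; split => j //= -[-> js]; rewrite js in si.
- rewrite -[X in <<s _ >> X]setTI.
  have /(_ measurableT A mA) := measurableT_comp (mg i) (@measurable_block [set i] i erefl).
  by [].
- rewrite -[X in <<s _ >> X]setTI.
  have m j : j \in s -> measurable_fun setT ((fun w => g j (X j w)) : g_sigma_algebraType (block_gen [set` s]) -> R).
    move=> js; exact: measurableT_comp (mg j) (@measurable_block [set` s] j js).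
  have /(_ measurableT B mB) := measurable_prod m.
  by [].
Qed.

End blocks.

(** * Sums of independent variables *)

Lemma eq_ler (R : realType) (x y : R) : x = y -> x <= y.
Proof. by move=> ->. Qed.

(** From (1 - z) exp z <= 1, exp z - 1 - z <= z (exp z - 1). For z >= 0 this is at most z^2 exp z;
    for z < 0 use exp z - 1 >= z. *)
Lemma expR_le_quadratic (R : realType) (z L : R) : 0 <= L -> z <= L ->
  expR z <= 1 + z + z ^+ 2 * expR L.
Proof.
move=> L0 zL.
have h1 : 1 + z <= expR z by exact: expR_ge1Dx.
have h2 : (1 - z) * expR z <= 1.
  have : 1 + - z <= expR (- z) by exact: expR_ge1Dx.
  by rewrite expRN -ler_pdivlMr ?expR_gt0// mul1r.
have h3 : expR z <= expR L by rewrite ler_expR.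
have h4 : 1 <= expR L by rewrite -expR0 ler_expR.
have e0 := expR_gt0 z.
set E := expR z in h1 h2 h3 e0 *; set F := expR L in h3 h4 *.
have [z0|z0] := leP 0 z.
  have : z * (E - 1) <= z * (z * F).
    rewrite ler_wpM2l//; have : z * E <= z * F by rewrite ler_wpM2l.
    lra.
  rewrite expr2; lra.
have : z * (E - 1) <= z * z.
  by rewrite ler_nM2l//; lra.
have : z * z * 1 <= z * z * F by rewrite ler_wpM2l// -expr2 sqr_ge0.
rewrite expr2; lra.
Qed.

Section events.
Context {d : measure_display} {T : measurableType d} {R : realType}.
Variable P : probability T R.
Implicit Types A B : set T.

Definition pr A : R := fine (P A).

Lemma pr_ge0 A : 0 <= pr A. Proof. exact: fine_ge0. Qed.

Lemma prE A : measurable A -> P A = (pr A)%:E.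
Proof. by move=> mA; rewrite fineK// fin_num_measure. Qed.

Lemma pr_le1 A : measurable A -> pr A <= 1.
Proof. by move=> mA; rewrite -lee_fin -prE// probability_le1. Qed.

Lemma le_pr A B : measurable A -> measurable B -> A `<=` B -> pr A <= pr B.
Proof. by move=> mA mB AB; rewrite -lee_fin -!prE// le_measure// inE. Qed.

Lemma prU A B : measurable A -> measurable B -> pr (A `|` B) <= pr A + pr B.
Proof.
move=> mA mB; rewrite -lee_fin EFinD -!prE//; last exact: measurableU.
exact: measureU2.
Qed.

Lemma prD A B : measurable A -> measurable B -> B `<=` A ->
  pr A = pr (A `\` B) + pr B.
Proof.
move=> mA mB BA; apply: EFin_inj; rewrite EFinD -!prE//; last exact: measurableD.
by rewrite (measureDI P mA mB) setIC (setIidl BA).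
Qed.

Lemma prC A : measurable A -> pr (~` A) = 1 - pr A.
Proof.
move=> mA; apply: EFin_inj; rewrite EFinB -!prE ?probability_setC//.
exact: measurableC.
Qed.

Lemma measurable_exists (I : eqType) (s : seq I) (A : I -> set T) :
  (forall i, measurable (A i)) -> measurable [set w | exists2 i, i \in s & A i w].
Proof.
move=> mA; rewrite (_ : [set _ | _] = \bigcup_(i in [set` s]) A i).
  by apply: fin_bigcup_measurable => //; exact: finite_seq.
by apply/seteqP; split => w /= -[i]; exists i.
Qed.

Lemma pr_exists (I : eqType) (s : seq I) (A : I -> set T) :
  (forall i, measurable (A i)) ->
  pr [set w | exists2 i, i \in s & A i w] <= \sum_(i <- s) pr (A i).
Proof.
move=> mA; elim: s => [|i s IH].
  rewrite big_nil (_ : [set _ | _] = set0) ?/pr ?measure0//.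
  by apply/seteqP; split => w //= -[].
rewrite big_cons (_ : [set _ | _] = A i `|` [set w | exists2 i, i \in s & A i w]).
  apply: le_trans (prU _ _) _ => //; first exact: measurable_exists.
  by rewrite lerD2l.
apply/seteqP; split => w /=.
  move=> [j]; rewrite in_cons => /orP[/eqP ->|js] Aj; first by left.
  by right; exists j.
move=> [Ai|[j js Aj]]; first by exists i; rewrite ?mem_head.
by exists j; rewrite ?in_cons ?js ?orbT.
Qed.

Lemma pr_disjoint (I : eqType) (s : seq I) (A : I -> set T) B :
  uniq s -> (forall i, measurable (A i)) -> measurable B ->
  (forall i, i \in s -> A i `<=` B) ->
  (forall i j w, i \in s -> j \in s -> A i w -> A j w -> i = j) ->
  \sum_(i <- s) pr (A i) <= pr B.
Proof.
move=> us mA mB AB dA; elim: s B us mB AB dA => [|i s IH] B /=.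
  by rewrite big_nil pr_ge0.
move=> /andP[si us] mB AB dA; rewrite big_cons (@prD B (A i))//; last first.
  by apply: AB; rewrite mem_head.
rewrite addrC lerD2r IH//; first exact: measurableD; last first.
  by move=> j l w js ls; apply: dA; rewrite in_cons ?js ?ls orbT.
move=> j js w Aj; split; first by apply: AB Aj; rewrite in_cons js orbT.
by move=> Ai; move: si; rewrite (dA i j w) ?js ?mem_head// in_cons js orbT.
Qed.

(** Markov's inequality, with the level absorbed in f. *)
Lemma prob_le_integral A (f : T -> R) : measurable A -> measurable_fun setT f ->
  (forall w, 0 <= f w) -> (forall w, A w -> 1 <= f w) ->
  (P A <= \int[P]_w (f w)%:E)%E.
Proof.
move=> mA mf f0 f1; rewrite -[X in P X](setIT) -integral_indic//.
apply: ge0_le_integral => //=.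
- by apply/measurable_EFinP; exact: measurable_indic.
- exact/measurable_EFinP.
- move=> w _; rewrite lee_fin indicE; case: (boolP (w \in A)) => [/set_mem/f1//|_].
  exact: f0.
Qed.

End events.

Section identically_distributed_sequence.
Context {d : measure_display} {T : measurableType d} {R : realType}.
Variable P : probability T R.
Variables (V : nat -> T -> R) (s : R).
Hypothesis mV : forall i, measurable_fun setT (V i).
Hypothesis Vind : mutually_independent P V.
Hypothesis Vid : forall i A, measurable A -> P (V i @^-1` A) = P (V 0%N @^-1` A).
Hypothesis EV : (\int[P]_w (V 0%N w)%:E = 0)%E.
Hypothesis EV2 : (\int[P]_w (V 0%N w ^+ 2)%:E = s%:E)%E.

Lemma identically_distributed_integral (g : R -> R) i : measurable_fun setT g ->
  (forall x, 0 <= g x) ->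
  (\int[P]_w (g (V i w))%:E = \int[P]_w (g (V 0%N w))%:E)%E.
Proof.
move=> mg g0.
pose W j : {RV P >-> R} := HB.pack (V j) (@isMeasurableFun.Build _ _ _ _ (V j) (mV j)).
have mg' : measurable_fun setT (EFin \o g) by exact/measurable_EFinP.
have E j : (\int[P]_w (g (V j w))%:E = \int[distribution P (W j)]_x (g x)%:E)%E.
  by rewrite (ge0_integral_distribution (W j) mg')// => x; rewrite /= lee_fin.
rewrite !E; apply: eq_measure_integral => A mA _; exact: Vid.
Qed.

Lemma second_moment_ge0 : 0 <= s.
Proof. by rewrite -lee_fin -EV2; apply: integral_ge0 => w _; rewrite lee_fin sqr_ge0. Qed.

Let measurable_sqr : measurable_fun setT (fun w => V 0%N w ^+ 2).
Proof. exact: measurable_funX. Qed.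

Let integrable_sqr : P.-integrable setT (fun w => (V 0%N w ^+ 2)%:E).
Proof.
apply/integrableP; split; first exact/measurable_EFinP.
under eq_integral do rewrite gee0_abs ?lee_fin ?sqr_ge0//.
by rewrite EV2 ltry.
Qed.

Let integrable_one : P.-integrable setT (fun w : T => (1 : R)%:E).
Proof. exact: finite_measure_integrable_cst. Qed.

Lemma integrable_first_moment : P.-integrable setT (fun w => (V 0%N w)%:E).
Proof.
apply: (@le_integrable _ _ _ P _ measurableT _ (fun w => 1%:E + (V 0%N w ^+ 2)%:E)%E).
- exact/measurable_EFinP.
- move=> w _ /=; rewrite lee_fin [leRHS]ger0_norm ?addr_ge0 ?sqr_ge0//.
  rewrite -real_normK ?num_real//; have := sqr_ge0 (`|V 0%N w| - 1).
  have := sqr_ge0 (`|V 0%N w|); rewrite !expr2; lra.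
- exact: integrableD.
Qed.

Lemma tail_le_second_moment i y : 0 < y ->
  pr P [set w | y <= V i w] <= s / y ^+ 2.
Proof.
move=> y0; have y2 : 0 < y ^+ 2 by rewrite exprn_gt0.
have mA j : measurable [set w | y <= V j w].
  rewrite (_ : [set _ | _] = setT `&` V j @^-1` `[y, +oo[%classic); first exact: mV.
  by rewrite setTI; apply/seteqP; split => w /=; rewrite in_itv/= andbT.
have -> : pr P [set w | y <= V i w] = pr P [set w | y <= V 0%N w].
  have E j : [set w | y <= V j w] = V j @^-1` `[y, +oo[%classic.
    by apply/seteqP; split => w /=; rewrite in_itv/= andbT.
  by rewrite /pr !E Vid.
rewrite -lee_fin -prE//.
apply: le_trans (prob_le_integral P (f := fun w => (y ^+ 2)^-1 * V 0%N w ^+ 2) _ _ _ _) _ => //.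
- by apply: measurable_funM => //.
- by move=> w; rewrite mulr_ge0 ?sqr_ge0 ?invr_ge0 ?(ltW y2).
- move=> w /= yV; rewrite mulrC ler_pdivlMr// mul1r ler_sqr ?nnegrE ?(ltW y0)//.
  exact: le_trans (ltW y0) yV.
under eq_integral do rewrite EFinM.
by rewrite integralZl// EV2 -EFinM mulrC.
Qed.

(** The value beyond y is 0, not 1: a product of such factors thus carries the indicator that no
    variable reaches y. *)
Definition truncated_exp (lam y x : R) : R := expR (lam * x) * \1_(`]-oo, y[%classic) x.

Lemma measurable_truncated_exp lam y : measurable_fun setT (truncated_exp lam y).
Proof.
apply: measurable_funM; last exact: measurable_indic.
by apply: measurable_expR_comp; exact: measurable_funM.
Qed.

Lemma truncated_exp_ge0 lam y x : 0 <= truncated_exp lam y x.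
Proof. by rewrite mulr_ge0 ?expR_ge0// indicE. Qed.

(** The quadratic bound on exp holds below y, and its right-hand side is nonnegative above y, where
    the truncated function is 0. The linear term disappears because the mean is 0. *)
Lemma integral_truncated_exp lam y i : 0 <= lam -> 0 <= y ->
  (\int[P]_w (truncated_exp lam y (V i w))%:E <=
     (1 + s * (lam ^+ 2 * expR (lam * y)))%:E)%E.
Proof.
move=> l0 y0.
rewrite identically_distributed_integral; last 2 first.
- exact: measurable_truncated_exp.
- by move=> x; exact: truncated_exp_ge0.
have b0 (x : R) : truncated_exp lam y x <= 1 + (lam * x + lam ^+ 2 * expR (lam * y) * x ^+ 2).
  have q0 : 0 <= lam ^+ 2 * expR (lam * y) * x ^+ 2 by apply: mulr_ge0; [apply: mulr_ge0; [exact: sqr_ge0|exact: expR_ge0]|exact: sqr_ge0].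
  rewrite /truncated_exp indicE; have [xy|yx] := ltP x y.
    rewrite mem_set /= ?in_itv//= mulr1.
    have := @expR_le_quadratic R (lam * x) (lam * y).
    rewrite mulr_ge0// ler_wpM2l ?(ltW xy)// => /(_ isT isT).
    rewrite exprMn; set E := expR (lam * y); rewrite expr2 (expr2 x); lra.
  rewrite memNset /= ?in_itv/= ?mulr0; last by apply/negP; rewrite -leNgt.
  have : 0 <= lam * x by rewrite mulr_ge0// (le_trans y0).
  lra.
pose c := lam ^+ 2 * expR (lam * y).
have c0 : 0 <= c by rewrite mulr_ge0 ?sqr_ge0 ?expR_ge0.
apply: (@le_trans _ _ (\int[P]_w (1%:E + (lam%:E * (V 0%N w)%:E + c%:E * (V 0%N w ^+ 2)%:E)))%E).
  apply: ge0_le_integral => //=.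
  - by move=> w _; rewrite lee_fin truncated_exp_ge0.
  - by apply/measurable_EFinP; exact: measurableT_comp (measurable_truncated_exp _ _) (mV 0%N).
  - apply/measurable_EFinP; apply: measurable_funD => //.
    by apply: measurable_funD; apply: measurable_funM.
  - by move=> w _; rewrite -!EFinM -!EFinD lee_fin.
have i0 := integrable_first_moment.
have i1 : P.-integrable setT (fun w => lam%:E * (V 0%N w)%:E)%E by exact: integrableZl.
have i2 : P.-integrable setT (fun w => c%:E * (V 0%N w ^+ 2)%:E)%E by exact: integrableZl.
rewrite integralD//; last exact: integrableD.
rewrite integralD// !integralZl// EV EV2 mule0 add0e integral_cst//= probability_setT mule1.
by rewrite -EFinM -EFinD lee_fin [c * s]mulrC.
Qed.

(* Chernoff's bound for the truncated variables, at lam = ln k / (2 dl k). *)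
Lemma exponential_bound (x dl : R) : 0 < dl -> exists2 C : R, 0 <= C &
  forall (k : nat) (F : seq nat), (0 < k)%N -> uniq F -> (size F <= k)%N ->
  pr P [set w | x * k%:R <= \sum_(i <- F) V i w /\ forall i, i \in F -> V i w < dl * k%:R]
    <= C * k%:R `^ (- (x / (2 * dl))).
Proof.
move=> d0; exists (expR (4 * s / dl ^+ 2)); first exact: expR_ge0.
move=> k F k0 uF sF; have s0 := second_moment_ge0.
have kR0 : 0 < k%:R :> R by rewrite ltr0n.
have k1 : 1 <= k%:R :> R by rewrite ler1n.
(* With this choice exp(lam dl k) = sqrt k, and exp(- lam x k) is the announced power of k. *)
pose lam := ln k%:R / (2 * dl * k%:R).
have den0 : 0 < 2 * dl * k%:R by rewrite !mulr_gt0.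
have l0 : 0 <= lam by rewrite divr_ge0 ?ln_ge0 ?(ltW den0).
have y0 : 0 <= dl * k%:R by rewrite mulr_ge0 ?(ltW d0).
have mA : measurable [set w | x * k%:R <= \sum_(i <- F) V i w /\ forall i, i \in F -> V i w < dl * k%:R].
  rewrite (_ : [set _ | _] = (setT `&` (fun w => \sum_(i <- F) V i w) @^-1` `[x * k%:R, +oo[%classic)
      `&` \bigcap_(i in [set` F]) (setT `&` V i @^-1` `]-oo, dl * k%:R[%classic)).
    apply: measurableI; first by apply: measurable_sum.
    by apply: fin_bigcap_measurable => [|i _]; [exact: finite_seq|exact: mV].
  apply/seteqP; split => w /=; rewrite in_itv/= andbT.
    by move=> [-> h]; split => // i /= /h; rewrite in_itv/=.
  by move=> [[_ ->] h]; split => // i /h /= [_]; rewrite in_itv/=.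
rewrite -lee_fin -prE//.
pose f w := expR (- (lam * (x * k%:R))) * \prod_(i <- F) truncated_exp lam (dl * k%:R) (V i w).
have mp : measurable_fun setT (fun w => \prod_(i <- F) truncated_exp lam (dl * k%:R) (V i w)).
  apply: measurable_prod => i _.
  exact: measurableT_comp (measurable_truncated_exp _ _) (mV i).
have p0 w : 0 <= \prod_(i <- F) truncated_exp lam (dl * k%:R) (V i w).
  by apply: prodr_ge0 => i _; exact: truncated_exp_ge0.
apply: le_trans (prob_le_integral P (f := f) _ _ _ _) _ => //.
- exact: measurable_funM.
- by move=> w; rewrite mulr_ge0 ?expR_ge0.
- move=> w /= [xS VF].
  have -> : f w = expR (lam * (\sum_(i <- F) V i w - x * k%:R)).
    rewrite mulrBr addrC expRD /f; congr (_ * _).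
    rewrite mulr_sumr expR_sum; apply: eq_big_seq => i iF.
    by rewrite /truncated_exp indicE mem_set ?mulr1//= in_itv/= VF.
  by rewrite -[leLHS]expR0 ler_expR mulr_ge0// subr_ge0.
rewrite /f; under eq_integral do rewrite EFinM.
rewrite ge0_integralZl//; last 2 first.
- exact/measurable_EFinP.
- by move=> w _; rewrite lee_fin.
rewrite (expectation_prod mV (g := fun=> truncated_exp lam (dl * k%:R)))//; last 2 first.
- by move=> _; exact: measurable_truncated_exp.
- by move=> _ z; exact: truncated_exp_ge0.
pose M := 1 + s * (lam ^+ 2 * expR (lam * (dl * k%:R))).
have M1 : 1 <= M.
  by rewrite lerDl; apply: mulr_ge0 => //; apply: mulr_ge0; [exact: sqr_ge0|exact: expR_ge0].
have pE : (\prod_(i <- F) \int[P]_w (truncated_exp lam (dl * k%:R) (V i w))%:E <= (M ^+ k)%:E)%E.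
  apply: (@le_trans _ _ (M ^+ size F)%:E); last by rewrite lee_fin ler_weXn2l.
  elim: {sF uF mA f mp p0} F => [|i F IH]; first by rewrite big_nil.
  rewrite big_cons exprS EFinM; apply: lee_pmul => //.
  - by apply: integral_ge0 => w _; rewrite lee_fin truncated_exp_ge0.
  - elim/big_rec: _ => // j z _ z0; apply: mule_ge0 => //.
    by apply: integral_ge0 => w _; rewrite lee_fin truncated_exp_ge0.
  - exact: integral_truncated_exp.
have e0 : (0 <= (expR (- (lam * (x * k%:R))))%:E)%E by rewrite lee_fin expR_ge0.
apply: le_trans (lee_wpmul2l e0 pE) _; rewrite -EFinM lee_fin mulrC.
have -> : expR (- (lam * (x * k%:R))) = k%:R `^ (- (x / (2 * dl))).
  rewrite /powR gt_eqF//; congr expR; rewrite /lam; field.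
  by rewrite !gt_eqF.
rewrite ler_wpM2r ?powR_ge0//.
apply: (@le_trans _ _ (expR (M - 1) ^+ k)).
  apply: lerXn2r; rewrite ?nnegrE ?expR_ge0//; first by lra.
  by have := expR_ge1Dx (M - 1); lra.
rewrite -expRM_natl ler_expR /M [1 + _]addrC addrK.
have -> : lam * (dl * k%:R) = ln k%:R / 2.
  by rewrite /lam; field; rewrite !gt_eqF.
have l4 : ln k%:R <= 4 * expR (ln k%:R / 4) :> R.
  have := expR_ge1Dx (ln k%:R / 4 : R); lra.
have l2 : ln k%:R ^+ 2 <= 16 * expR (ln k%:R / 2) :> R.
  have -> : 16 * expR (ln k%:R / 2) = (4 * expR (ln k%:R / 4)) ^+ 2 :> R.
    have -> : ln k%:R / 2 = ln k%:R / 4 + ln k%:R / 4 :> R by field.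
    by rewrite expRD expr2; ring.
  by rewrite ler_sqr ?nnegrE ?ln_ge0 ?mulr_ge0 ?expR_ge0.
set E := expR (ln k%:R / 2) in l2 *.
have E0 : 0 < E by exact: expR_gt0.
have EE : E * E = k%:R.
  rewrite /E -expRD (_ : _ + _ = ln k%:R); first by rewrite lnK ?posrE.
  by field.
(* The product of k factors is bounded by the exponential of this quantity; it stays bounded since
   (ln k)^2 <= 16 sqrt k, which also explains the constant 4 s / dl^2. *)
have -> : k%:R * (s * (lam ^+ 2 * E)) = s / (4 * dl ^+ 2) * (ln k%:R ^+ 2 / E).
  rewrite /lam -EE; field.
  by rewrite !gt_eqF.
have -> : 4 * s / dl ^+ 2 = s / (4 * dl ^+ 2) * 16 by field; rewrite gt_eqF.
rewrite ler_wpM2l//; first by rewrite divr_ge0// mulr_ge0// sqr_ge0.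
by rewrite ler_pdivrMr.
Qed.

(** Truncating at x k / 2 makes the exponential bound exactly of order 1 / k; that some variable
    exceeds x k / 2 costs at most k times Chebyshev's bound, again of order 1 / k. *)
Lemma sum_tail (x : R) : 0 < x -> exists2 C : R, 0 <= C &
  forall (k : nat) (F : seq nat), (0 < k)%N -> uniq F -> (size F <= k)%N ->
  pr P [set w | x * k%:R <= \sum_(i <- F) V i w] <= C / k%:R.
Proof.
move=> x0; have d0 : 0 < x / 2 by rewrite divr_gt0.
have s0 := second_moment_ge0.
have [C C0 hC] := exponential_bound x d0.
exists (C + s / (x / 2) ^+ 2); first by rewrite addr_ge0// divr_ge0// sqr_ge0.
move=> k F k0 uF sF.
have kR0 : 0 < k%:R :> R by rewrite ltr0n.
set A := [set w | _].
pose A1 := [set w | x * k%:R <= \sum_(i <- F) V i w /\ forall i, i \in F -> V i w < x / 2 * k%:R].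
pose A2 := [set w | exists2 i, i \in F & x / 2 * k%:R <= V i w].
have mVi i : measurable [set w | x / 2 * k%:R <= V i w].
  rewrite (_ : [set _ | _] = setT `&` V i @^-1` `[x / 2 * k%:R, +oo[%classic); first exact: mV.
  by rewrite setTI; apply/seteqP; split => w /=; rewrite in_itv/= andbT.
have mA : measurable A.
  rewrite (_ : A = setT `&` (fun w => \sum_(i <- F) V i w) @^-1` `[x * k%:R, +oo[%classic).
    by apply: measurable_sum.
  by rewrite setTI; apply/seteqP; split => w /=; rewrite in_itv/= andbT.
have mA2 : measurable A2 by exact: measurable_exists.
have A1E : A1 = A `\` A2.
  apply/seteqP; split => w /=.
    move=> [xS h]; split => // -[i /h iF]; by rewrite leNgt iF.
  move=> [xS h]; split => // i iF; rewrite ltNge; apply/negP => Vi.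
  by apply: h; exists i.
have mA1 : measurable A1 by rewrite A1E; exact: measurableD.
(* The union bound has [size F <= k] terms; it is compared with exactly k copies of the same
   term. *)
have -> : (C + s / (x / 2) ^+ 2) / k%:R = C * k%:R `^ (- (x / (2 * (x / 2)))) + \sum_(i <- nseq k 0%N) s / (x / 2 * k%:R) ^+ 2.
  rewrite big_nseq iter_addr_0 -[X in _ = _ + X]mulr_natr.
  have -> : x / (2 * (x / 2)) = 1 by field; rewrite gt_eqF.
  rewrite powR_inv1 ?(ltW kR0)//; field.
  by rewrite !gt_eqF.
apply: (@le_trans _ _ (pr P A1 + pr P A2)).
  apply: le_trans (prU _ mA1 mA2); apply: le_pr => //; first exact: measurableU.
  by move=> w Aw; have [h|h] := pselect (A2 w); [right|left; rewrite A1E].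
apply: lerD; first exact: hC.
apply: (@le_trans _ _ (\sum_(i <- F) s / (x / 2 * k%:R) ^+ 2)).
  apply: le_trans (pr_exists _ _ mVi) _; apply: ler_sum => i _.
  by apply: tail_le_second_moment; rewrite mulr_gt0.
rewrite !big_const_seq !count_predT size_nseq !iter_addr_0.
by rewrite ler_wpMn2l// divr_ge0// sqr_ge0.
Qed.

End identically_distributed_sequence.

Lemma cvg_divn (R : realType) (c : R) : c / n%:R @[n --> \oo] --> 0.
Proof.
rewrite -cvg_shiftS.
suff : c / n.+1%:R @[n --> \oo] --> c * 0 by rewrite mulr0.
by apply: cvgM; [exact: cvg_cst|exact: cvg_harmonic].
Qed.

Section measurable_events.
Context {d : measure_display} {T : measurableType d} {R : realType}.
Implicit Types (f : T -> R) (s : seq nat) (h : nat -> T -> R).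

Lemma measurable_geE f c : [set w | c <= f w] = f @^-1` `[c, +oo[%classic.
Proof. by apply/seteqP; split => w /=; rewrite in_itv/= andbT. Qed.

Lemma measurable_ltE f c : [set w | f w < c] = f @^-1` `]-oo, c[%classic.
Proof. by apply/seteqP; split => w /=; rewrite in_itv/=. Qed.

Lemma measurable_ge f c : measurable_fun setT f -> measurable [set w | c <= f w].
Proof. by move=> mf; rewrite measurable_geE -[X in measurable X]setTI; exact: mf. Qed.

Lemma measurable_lt f c : measurable_fun setT f -> measurable [set w | f w < c].
Proof. by move=> mf; rewrite measurable_ltE -[X in measurable X]setTI; exact: mf. Qed.

Lemma measurable_sum_seq s h : (forall i, i \in s -> measurable_fun setT (h i)) ->
  measurable_fun setT (fun w => \sum_(i <- s) h i w).
Proof.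
move=> mh.
rewrite (_ : (fun w => _) = fun w => \sum_(i <- s) (if i \in s then h i else cst 0) w).
  by apply: measurable_sum => i; case: ifP => // /mh.
by apply/funext => w; apply: eq_big_seq => i ->.
Qed.

Lemma measurable_forall s (A : nat -> set T) :
  (forall i, i \in s -> measurable (A i)) ->
  measurable [set w | forall i, i \in s -> A i w].
Proof.
move=> mA; rewrite (_ : [set _ | _] = \bigcap_(i in [set` s]) A i).
  by apply: fin_bigcap_measurable => //; exact: finite_seq.
by apply/seteqP; split.
Qed.

End measurable_events.

(** * Probability of a large average: one big summand *)

Section large_deviation.
Context {d : measure_display} {T : measurableType d} {R : realType}.
Variable P : probability T R.
Variables (V : nat -> T -> R) (s : R).
Hypothesis mV : forall i, measurable_fun setT (V i).
Hypothesis Vind : mutually_independent P V.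
Hypothesis Vid : forall i A, measurable A -> P (V i @^-1` A) = P (V 0%N @^-1` A).
Hypothesis EV : (\int[P]_w (V 0%N w)%:E = 0)%E.
Hypothesis EV2 : (\int[P]_w (V 0%N w ^+ 2)%:E = s%:E)%E.

Let tail (x : R) : R := pr P [set w | x <= V 0%N w].

Let pr_tail i x : pr P [set w | x <= V i w] = tail x.
Proof. by rewrite /tail /pr !measurable_geE Vid. Qed.

Let tail_ge0 x : 0 <= tail x. Proof. exact: pr_ge0. Qed.

Lemma pr_indep_rest i (F : seq nat) (A : set R) (B : set T) :
  i \notin F -> measurable A -> <<s block_gen V [set` F] >> B ->
  pr P (V i @^-1` A `&` B) = pr P (V i @^-1` A) * pr P B.
Proof.
move=> iF mA sB.
have mVA : measurable (V i @^-1` A) by rewrite -[X in measurable X]setTI; exact: mV.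
have mB : measurable B.
  apply: (smallest_sub (@sigma_algebra_measurable _ T) _) sB.
  by move=> _ [j _ [C mC <-]]; exact: mV.
apply: EFin_inj; rewrite EFinM -!prE//; last exact: measurableI.
apply: (indep_blocks mV (J1 := [set i]) (J2 := [set` F]) Vind) => //.
  by apply/seteqP; split => j //= -[-> js]; rewrite js in iF.
by rewrite -[X in <<s _ >> X]setTI; exact: (@measurable_block _ _ _ _ _ V [set i] i erefl).
Qed.

Let sigma_ge (F : seq nat) c : <<s block_gen V [set` F] >> [set w | c <= \sum_(i <- F) V i w].
Proof.
have m : measurable_fun setT ((fun w => \sum_(i <- F) V i w) : g_sigma_algebraType (block_gen V [set` F]) -> R).
  by apply: measurable_sum_seq => i iF; exact: (@measurable_block _ _ _ _ _ V [set` F] i iF).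
exact: (measurable_ge c m).
Qed.

Let sigma_lt_ge (F : seq nat) b c : <<s block_gen V [set` F] >>
  [set w | (forall i, i \in F -> V i w < b) /\ c <= \sum_(i <- F) V i w].
Proof.
have m i : i \in F -> measurable_fun setT (V i : g_sigma_algebraType (block_gen V [set` F]) -> R).
  by move=> iF; exact: (@measurable_block _ _ _ _ _ V [set` F] i iF).
have h : measurable ([set w | forall i, i \in F -> V i w < b] : set (g_sigma_algebraType (block_gen V [set` F]))).
  by apply: (measurable_forall (A := fun i => [set w : g_sigma_algebraType (block_gen V [set` F]) | V i w < b])) => i /m; exact: measurable_lt.
exact: (measurableI _ _ h (measurable_ge c (measurable_sum_seq m))).
Qed.

Let average (eps : R) k := pr P [set w | k%:R * eps <= \sum_(i <- iota 0 k) V i w].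

Let mSum (F : seq nat) : measurable_fun setT (fun w => \sum_(i <- F) V i w).
Proof. exact: measurable_sum_seq. Qed.

(* If the average exceeds eps then either a single variable exceeds
   (1 - eta) eps k, or one exceeds dl k while the others sum to at least
   eta eps k, or all variables stay below dl k. *)
Lemma average_le (eps dl eta : R) : 0 < dl -> 0 < eta -> 0 < eps ->
  exists C D : R, forall k, (0 < k)%N ->
    average eps k <= k%:R * tail ((1 - eta) * eps * k%:R) + C * tail (dl * k%:R)
      + D * k%:R `^ (- (eps / (2 * dl))).
Proof.
move=> d0 eta0 e0.
have [C C0 hC] := sum_tail mV Vind Vid EV EV2 (mulr_gt0 eta0 e0).
have [D D0 hD] := exponential_bound mV Vind Vid EV EV2 eps d0.
exists C, D => k k0.
have kR0 : 0 < k%:R :> R by rewrite ltr0n.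
pose F := iota 0 k; have uF : uniq F by exact: iota_uniq.
pose A1 i := [set w | (1 - eta) * eps * k%:R <= V i w].
pose A2 i := [set w | dl * k%:R <= V i w] `&` [set w | eta * eps * k%:R <= \sum_(j <- rem i F) V j w].
pose A3 := [set w | eps * k%:R <= \sum_(i <- F) V i w /\ forall i, i \in F -> V i w < dl * k%:R].
pose B1 := [set w | exists2 i, i \in F & A1 i w].
pose B2 := [set w | exists2 i, i \in F & A2 i w].
have mA1 i : measurable (A1 i) by exact: measurable_ge.
have mA2 i : measurable (A2 i) by apply: measurableI; exact: measurable_ge.
have mB1 : measurable B1 by exact: measurable_exists.
have mB2 : measurable B2 by exact: measurable_exists.
have mA3 : measurable A3.
  apply: measurableI; first exact: measurable_ge.
  by apply: (measurable_forall (A := fun i => [set w | V i w < dl * k%:R])) => i _; exact: measurable_lt.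
apply: (@le_trans _ _ (pr P B1 + pr P B2 + pr P A3)).
  apply: (@le_trans _ _ (pr P ((B1 `|` B2) `|` A3))); last first.
    apply: le_trans (prU _ _ _) _ => //; first exact: measurableU.
    by rewrite lerD2r; exact: prU.
  apply: le_pr; [exact: measurable_ge|by do 2?apply: measurableU|].
  move=> w /= Sw; have [[i iF Vi]|nV] := pselect (exists2 i, i \in F & dl * k%:R <= V i w).
    left; have [V1|V1] := leP ((1 - eta) * eps * k%:R) (V i w); first by left; exists i.
    right; exists i => //; split => //=.
    by move: Sw; rewrite (big_rem i)//= -/F; lra.
  right; split; first by rewrite /= mulrC.
  by move=> i iF; rewrite ltNge; apply/negP => Vi; apply: nV; exists i.
apply: lerD; [apply: lerD|].
- apply: le_trans (pr_exists _ _ mA1) _.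
  under eq_bigr do rewrite pr_tail.
  by rewrite big_const_seq count_predT size_iota iter_addr_0 mulr_natl.
- apply: le_trans (pr_exists _ _ mA2) _.
  apply: (@le_trans _ _ (\sum_(i <- F) (tail (dl * k%:R) * (C / k%:R)))).
    rewrite big_seq [leRHS]big_seq; apply: ler_sum => i iF.
    rewrite /A2 measurable_geE (@pr_indep_rest i (rem i F))//; last by rewrite mem_rem_uniq// inE eqxx.
    rewrite -measurable_geE pr_tail ler_wpM2l//.
    by apply: hC => //; [exact: rem_uniq|rewrite size_rem// size_iota; exact: leq_pred].
  rewrite big_const_seq count_predT size_iota iter_addr_0 -[leLHS]mulr_natr.
  by apply: eq_ler; field; rewrite gt_eqF.
- by apply: hD => //; rewrite size_iota.
Qed.

(* The events "V_i is the only variable above (1 + eta) eps k and the others sum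
   to at least - eta eps k" are disjoint. *)
Lemma average_ge (eps eta : R) : 0 < eta -> 0 < eps ->
  exists D : R, forall k, (0 < k)%N ->
    k%:R * tail ((1 + eta) * eps * k%:R) * (1 - D / k%:R) <= average eps k.
Proof.
move=> eta0 e0.
have eta1 : 0 < (1 + eta) * eps by rewrite mulr_gt0// addr_gt0.
(* The opposite variables satisfy the same hypotheses, so [sum_tail] also bounds the lower
   deviations of the other summands. *)
pose N i w := - V i w.
have mN i : measurable_fun setT (N i) by exact: measurable_funN.
have NE i (A : set R) : N i @^-1` A = V i @^-1` [set x | A (- x)] by [].
have mopp (A : set R) : measurable A -> measurable [set x | A (- x)].
  by move=> mA; have := @measurable_funN _ _ R setT idfun (@measurable_id _ _ _) measurableT A mA; rewrite setTI.
have Nind : mutually_independent P N.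
  move=> J A mA; rewrite (Vind J (A := fun i => [set x | A i (- x)]))// => i.
  exact: mopp.
have Nid i A : measurable A -> P (N i @^-1` A) = P (N 0%N @^-1` A).
  by move=> mA; rewrite !NE Vid//; exact: mopp.
have EN : (\int[P]_w (N 0%N w)%:E = 0)%E.
  rewrite (_ : (\int[P]_w (N 0%N w)%:E)%E = (\int[P]_w ((-1)%:E * (V 0%N w)%:E))%E); last first.
    by apply: eq_integral => w _; rewrite -EFinM mulN1r.
  by rewrite integralZl ?EV ?mule0//; exact: integrable_first_moment EV2.
have EN2 : (\int[P]_w (N 0%N w ^+ 2)%:E = s%:E)%E.
  by rewrite -EV2; apply: eq_integral => w _; rewrite sqrrN.
have [C C0 hC] := sum_tail mN Nind Nid EN EN2 (mulr_gt0 eta0 e0).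
exists (s / ((1 + eta) * eps) ^+ 2 + C) => k k0.
have kR0 : 0 < k%:R :> R by rewrite ltr0n.
set b := (1 + eta) * eps * k%:R; have b0 : 0 < b by rewrite mulr_gt0.
pose c := eta * eps * k%:R.
pose F := iota 0 k; have uF : uniq F by exact: iota_uniq.
pose D i := [set w | (forall j, j \in rem i F -> V j w < b) /\ - c <= \sum_(j <- rem i F) V j w].
pose A i := [set w | b <= V i w] `&` D i.
have mD i : measurable (D i).
  apply: measurableI; last exact: measurable_ge.
  by apply: (measurable_forall (A := fun i => [set w | V i w < b])) => j _; exact: measurable_lt.
have mA i : measurable (A i) by apply: measurableI => //; exact: measurable_ge.
apply: (@le_trans _ _ (\sum_(i <- F) pr P (A i))); last first.
  apply: pr_disjoint => //; first exact: measurable_ge.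
    move=> i iF w /= [/= bV [_ cV]]; rewrite (big_rem i)//= -/F.
    have : b - c = k%:R * eps by rewrite /b /c; ring.
    lra.
  move=> i j w iF jF [/= bi [Di _]] [/= bj _]; apply/eqP/negP => /negP ij.
  have /Di : j \in rem i F by rewrite mem_rem_uniq// inE eq_sym ij.
  lra.
apply: (@le_trans _ _ (\sum_(i <- F) tail b * (1 - (s / ((1 + eta) * eps) ^+ 2 + C) / k%:R))).
  rewrite big_const_seq count_predT size_iota iter_addr_0 -[leRHS]mulr_natl.
  by apply: eq_ler; ring.
rewrite big_seq [leRHS]big_seq; apply: ler_sum => i iF.
rewrite /A measurable_geE (@pr_indep_rest i (rem i F))//; last 2 first.
- by rewrite mem_rem_uniq// inE eqxx.
- exact: sigma_lt_ge.
rewrite -measurable_geE pr_tail ler_wpM2l//.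
(* The complement of [D i] requires another variable above b, of cost k s / b^2, or a sum of the
   others below - c; both are O(1 / k). *)
suff : pr P (~` D i) <= (s / ((1 + eta) * eps) ^+ 2 + C) / k%:R by rewrite prC//; lra.
pose E1 := [set w | exists2 j, j \in rem i F & b <= V j w].
pose E2 := [set w | c <= \sum_(j <- rem i F) N j w].
have mE1 : measurable E1 by apply: measurable_exists => j; exact: measurable_ge.
have mE2 : measurable E2 by apply: measurable_ge; exact: measurable_sum_seq.
apply: (@le_trans _ _ (pr P E1 + pr P E2)).
  apply: le_trans (prU _ mE1 mE2); apply: le_pr; [exact: measurableC|exact: measurableU|].
  move=> w /= nD; have [|nE1] := pselect (E1 w); first by left.
  right; rewrite /E2/= sumrN lerNr leNgt; apply/negP => h; apply: nD; split; last exact: ltW.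
  by move=> j jF; rewrite ltNge; apply/negP => bj; apply: nE1; exists j.
have sR : (size (rem i F) <= k)%N by rewrite size_rem// size_iota; exact: leq_pred.
have uR : uniq (rem i F) by exact: rem_uniq.
rewrite mulrDl; apply: lerD; last exact: hC.
apply: le_trans (pr_exists _ _ _) _; first by move=> j; exact: measurable_ge.
apply: (@le_trans _ _ (\sum_(j <- rem i F) s / b ^+ 2)).
  by apply: ler_sum => j _; exact: tail_le_second_moment.
rewrite big_const_seq count_predT iter_addr_0.
have s0 : 0 <= s by exact: second_moment_ge0 EV2.
apply: (@le_trans _ _ ((s / b ^+ 2) *+ k)); first by rewrite ler_wpMn2l// divr_ge0// sqr_ge0.
by rewrite -[leLHS]mulr_natl /b; apply: eq_ler; field; rewrite !gt_eqF// addr_gt0.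
Qed.

Variables (a alpha : R).
Hypothesis a_gt0 : 0 < a.
Hypothesis alpha_gt0 : 0 < alpha.
Hypothesis tail_equiv : tail x / (a * x `^ (- alpha)) @[x --> +oo] --> (1 : R).

Let tail_scaled c : 0 < c ->
  k%:R `^ alpha * tail (c * k%:R) @[k --> \oo] --> a * c `^ (- alpha).
Proof.
move=> c0.
have ck : c * k%:R @[k --> \oo] --> +oo.
  apply: (cvg_comp (fun k : nat => k%:R : R) (fun x : R => c * x) cvgr_idn).
  exact: gt0_cvgMry.
have := cvg_comp _ _ ck tail_equiv => h.
suff : a * c `^ (- alpha) * (tail (c * k%:R) / (a * (c * k%:R) `^ (- alpha))) @[k --> \oo]
    --> a * c `^ (- alpha) * 1.
  rewrite mulr1; apply: cvg_trans; apply: near_eq_cvg; near=> k.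
  have k0 : 0 < k%:R :> R by rewrite ltr0n; near: k; exact: nbhs_infty_gt.
  rewrite powRM ?(ltW c0) ?(ltW k0)// !powRN; field.
  by rewrite !gt_eqF ?powR_gt0.
by apply: cvgM; [exact: cvg_cst|exact: h].
Unshelve. all: end_near. Qed.

(** Multiplied by k^(alpha - 1), the upper and lower bounds converge to a ((1 - eta) eps)^-alpha and
    a ((1 + eta) eps)^-alpha, both within e / 2 of the target for [eta] small. *)
Lemma average_asymptotics (eps : R) : 0 < eps ->
  average eps k * k%:R `^ (alpha - 1) @[k --> \oo] --> a * eps `^ (- alpha).
Proof.
move=> e0; apply/cvgrPdist_le => e e_gt0.
have ae0 : 0 < e / 2 / a by rewrite !divr_gt0.
have /cvgrPdist_le/(_ _ ae0) := @continuous_powRl R (- alpha) eps e0.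
rewrite near_simpl => -[r /= r0 hr].
pose eta := Num.min (1 / 2) (r / (2 * eps)).
have eta0 : 0 < eta by rewrite lt_min !divr_gt0// mulr_gt0.
have eta12 : eta <= 1 / 2 by rewrite ge_min lexx.
have etar : eta * eps < r.
  apply: (@le_lt_trans _ _ (r / 2)); last by lra.
  have : eta <= r / (2 * eps) by rewrite ge_min lexx orbT.
  by rewrite -[in X in X -> _](ler_pM2r e0) (_ : r / (2 * eps) * eps = r / 2)//; field; rewrite gt_eqF.
have near_pow z : `|eps - z| < r -> `|a * eps `^ (- alpha) - a * z `^ (- alpha)| <= e / 2.
  move=> zr; rewrite -mulrBr normrM (gtr0_norm a_gt0) mulrC -ler_pdivlMr//.
  exact: hr.
(* Gives eps / (2 dl) = alpha: the exponential term is k^-alpha, negligible against k^(1 -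
   alpha). *)
pose dl := eps / (2 * alpha); have d0 : 0 < dl by rewrite divr_gt0// mulr_gt0.
have [C [D up]] := average_le d0 eta0 e0.
have [G lo] := average_ge eta0 e0.
have e1 : 0 < (1 - eta) * eps by rewrite mulr_gt0//; lra.
have e2 : 0 < (1 + eta) * eps by rewrite mulr_gt0//; lra.
have powE k : (0 < k)%N -> k%:R `^ (alpha - 1) * k%:R = k%:R `^ alpha :> R.
  by move=> k0; rewrite mulrC mulr_powRB1// ler0n.
have U1 : k%:R `^ alpha * tail ((1 - eta) * eps * k%:R)
   + (C / k%:R * (k%:R `^ alpha * tail (dl * k%:R)) + D / k%:R) @[k --> \oo]
   --> a * ((1 - eta) * eps) `^ (- alpha).
  rewrite -[X in _ --> X]addr0; apply: cvgD; first exact: tail_scaled.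
  rewrite -[X in _ --> X]addr0; apply: cvgD; last exact: cvg_divn.
  by rewrite -[X in _ --> X](mul0r (a * dl `^ (- alpha))); apply: cvgM; [exact: cvg_divn|exact: tail_scaled].
have L1 : k%:R `^ alpha * tail ((1 + eta) * eps * k%:R) * (1 - G / k%:R) @[k --> \oo]
   --> a * ((1 + eta) * eps) `^ (- alpha).
  rewrite -[X in _ --> X]mulr1; apply: cvgM; first exact: tail_scaled.
  rewrite -[X in _ --> X]subr0; apply: cvgB; [exact: cvg_cst|exact: cvg_divn].
have e20 : 0 < e / 2 by rewrite divr_gt0.
move: U1 L1 => /cvgrPdist_le/(_ _ e20) U1 /cvgrPdist_le/(_ _ e20) L1.
have N1 := near_pow ((1 - eta) * eps); have N2 := near_pow ((1 + eta) * eps).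
have {}N1 : `|a * eps `^ (- alpha) - a * ((1 - eta) * eps) `^ (- alpha)| <= e / 2.
  apply: N1; rewrite (_ : eps - _ = eta * eps); last by ring.
  by rewrite gtr0_norm ?mulr_gt0.
have {}N2 : `|a * eps `^ (- alpha) - a * ((1 + eta) * eps) `^ (- alpha)| <= e / 2.
  apply: N2; rewrite (_ : eps - _ = - (eta * eps)); last by ring.
  by rewrite normrN gtr0_norm ?mulr_gt0.
near=> k.
have k0 : (0 < k)%N by near: k; exact: nbhs_infty_gt.
have kR0 : 0 < k%:R :> R by rewrite ltr0n.
have hU : `|a * ((1 - eta) * eps) `^ (- alpha) - (k%:R `^ alpha * tail ((1 - eta) * eps * k%:R)
   + (C / k%:R * (k%:R `^ alpha * tail (dl * k%:R)) + D / k%:R))| <= e / 2 by near: k.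
have hL : `|a * ((1 + eta) * eps) `^ (- alpha) - k%:R `^ alpha * tail ((1 + eta) * eps * k%:R) * (1 - G / k%:R)| <= e / 2.
  by near: k.
have hu : average eps k * k%:R `^ (alpha - 1) <= k%:R `^ alpha * tail ((1 - eta) * eps * k%:R)
   + (C / k%:R * (k%:R `^ alpha * tail (dl * k%:R)) + D / k%:R).
  have := up k k0; rewrite -(ler_pM2r (powR_gt0 (alpha - 1) kR0)) => /le_trans; apply.
  have -> : - (eps / (2 * dl)) = - alpha by rewrite /dl; field; rewrite !gt_eqF.
  have -> : k%:R `^ (- alpha) = (k%:R `^ alpha)^-1 :> R by rewrite powRN.
  rewrite -(powE _ k0); apply: eq_ler; field.
  by rewrite !gt_eqF ?powR_gt0.
have hl : k%:R `^ alpha * tail ((1 + eta) * eps * k%:R) * (1 - G / k%:R) <= average eps k * k%:R `^ (alpha - 1).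
  have := lo k k0; rewrite -(ler_pM2r (powR_gt0 (alpha - 1) kR0)); apply: le_trans.
  by rewrite -(powE _ k0); apply: eq_ler; ring.
move: N1 N2 hU hL; rewrite !ler_norml; lra.
Unshelve. all: end_near. Qed.

End large_deviation.

(** * Generating functions *)

(** Stated as a real limit of partial sums, so that expansions with signed terms such as (1 - t)^k -
    1 + k t can be combined linearly. *)
Definition has_psum {R : realType} (p phi : nat -> R) (l : R) : Prop :=
  series (fun k => p k * phi k) n @[n --> \oo] --> l.

Definition psum {R : realType} (p phi : nat -> R) : R :=
  limn (series (fun k => p k * phi k)).

Section psum_theory.
Context {R : realType}.
Implicit Types (p phi psi : nat -> R) (l m c : R).

Lemma has_psumD p phi psi l m : has_psum p phi l -> has_psum p psi m ->
  has_psum p (fun k => phi k + psi k) (l + m).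
Proof.
move=> h1 h2; rewrite /has_psum.
rewrite (_ : series _ = series (fun k => p k * phi k) \+ series (fun k => p k * psi k)).
  exact: cvgD.
by apply/funext => n; rewrite /series/= -big_split/=; apply: eq_bigr => k _; rewrite mulrDr.
Qed.

Lemma has_psumZ p phi l c : has_psum p phi l -> has_psum p (fun k => c * phi k) (c * l).
Proof.
move=> h1; rewrite /has_psum.
rewrite (_ : series _ = fun n => c * series (fun k => p k * phi k) n).
  by apply: cvgM; [exact: cvg_cst|exact: h1].
by apply/funext => n; rewrite /series/= mulr_sumr; apply: eq_bigr => k _; rewrite mulrCA.
Qed.

Lemma has_psumB p phi psi l m : has_psum p phi l -> has_psum p psi m ->
  has_psum p (fun k => phi k - psi k) (l - m).
Proof.
move=> h1 h2; have {}h2 := has_psumZ (c := -1) h2; rewrite -mulN1r.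
rewrite (_ : (fun k => _) = fun k => phi k + -1 * psi k); first exact: has_psumD.
by apply/funext => k; rewrite mulN1r.
Qed.

Lemma has_psum_sum p J (phi : nat -> nat -> R) (l : nat -> R) :
  (forall j, has_psum p (phi j) (l j)) ->
  has_psum p (fun k => \sum_(j < J) phi j k) (\sum_(j < J) l j).
Proof.
move=> h; elim: J => [|J IH].
  rewrite big_ord0 /has_psum (_ : series _ = cst 0); first exact: cvg_cst.
  by apply/funext => n; rewrite /series/= big1// => k _; rewrite big_ord0 mulr0.
rewrite big_ord_recr/= (_ : (fun k => _) = fun k => (\sum_(j < J) phi j k) + phi J k).
  exact: has_psumD.
by apply/funext => k; rewrite big_ord_recr.
Qed.

Lemma has_psum_delta0 p : has_psum p (fun k => (k == 0%N)%:R) (p 0%N).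
Proof.
rewrite /has_psum -cvg_shiftS (_ : (fun n => _) = cst (p 0%N)); first exact: cvg_cst.
apply/funext => n; rewrite /series/= big_nat_recl//= mulr1 big1 ?addr0// => k _.
by rewrite mulr0.
Qed.

Lemma le_has_psum p phi psi l m : (forall k, 0 <= p k) ->
  (forall k, phi k <= psi k) -> has_psum p phi l -> has_psum p psi m -> l <= m.
Proof.
move=> p0 le h1 h2; apply: (ler_cvg_to h1 h2); near=> n.
by apply: ler_sum => k _; rewrite ler_wpM2l.
Unshelve. all: end_near. Qed.

Lemma has_psum_ge_term p phi l (k : nat) : (forall k, 0 <= p k) ->
  (forall k, 0 <= phi k) -> has_psum p phi l -> p k * phi k <= l.
Proof.
move=> p0 phi0 h; apply: (cvgr_to_ge h); near=> n.
rewrite /series/= (bigD1_seq k) ?iota_uniq//=.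
  by rewrite lerDl sumr_ge0// => i _; rewrite mulr_ge0.
by rewrite mem_index_iota/=; near: n; exact: nbhs_infty_gt.
Unshelve. all: end_near. Qed.

Lemma has_psum_dom p phi psi m : (forall k, 0 <= p k) ->
  (forall k, 0 <= phi k <= psi k) -> has_psum p psi m -> has_psum p phi (psum p phi).
Proof.
move=> p0 le h; apply: (@series_le_cvg _ _ (fun k => p k * psi k)).
- by move=> k; rewrite mulr_ge0//; have /andP[] := le k.
- by move=> k; rewrite mulr_ge0//; have /andP[h1 h2] := le k; exact: le_trans h2.
- by move=> k; rewrite ler_wpM2l//; have /andP[] := le k.
- by apply/cvg_ex; exists m.
Qed.

Lemma nneseries_has_psum p phi : (forall k, 0 <= p k) -> (forall k, 0 <= phi k) ->
  (\sum_(k <oo) (p k * phi k)%:E < +oo)%E ->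
  has_psum p phi (psum p phi) /\ (\sum_(k <oo) (p k * phi k)%:E = (psum p phi)%:E)%E.
Proof.
move=> p0 phi0 fin; pose b := fine (\sum_(k <oo) (p k * phi k)%:E)%E.
have t0 k : 0 <= p k * phi k by rewrite mulr_ge0.
have bE : (\sum_(k <oo) (p k * phi k)%:E = b%:E)%E.
  rewrite fineK// ge0_fin_numE//; apply: nneseries_ge0 => k _ _; by rewrite lee_fin.
have cv : cvgn (series (fun k => p k * phi k)).
  apply: nondecreasing_is_cvgn; first by apply: nondecreasing_series => k _ _.
  exists b => _ [n _ <-]; rewrite -lee_fin -bE /series/= -sumEFin.
  by apply: nneseries_lim_ge => k _ _; rewrite lee_fin.
split; first exact: cv.
rewrite -EFin_lim//; apply: congr_lim; apply/funext => n /=.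
by rewrite /series/= sumEFin.
Qed.

End psum_theory.

Section generating_function_derivatives.
Context {R : realType}.
Implicit Types c p : nat -> R.

(** For nonnegative coefficients, a radius of convergence at least 1, in a form stable under formal
    differentiation, whereas boundedness of the coefficients is not. *)
Definition geometrically_bounded c : Prop :=
  forall K : R, 0 < K < 1 -> exists M : R, forall k, c k * K ^+ k <= M.

(** With K = y^2, one factor y^k absorbs k + 1, as (k + 1) y^k <= 1 / (1 - y), and the other
    controls the coefficient. *)
Lemma geometrically_bounded_diffs c : (forall k, 0 <= c k) ->
  geometrically_bounded c -> geometrically_bounded (pseries_diffs c).
Proof.
move=> c0 gc K /andP[K0 K1]; pose y := Num.sqrt K.
have y0 : 0 < y by rewrite sqrtr_gt0.
have y2 : y ^+ 2 = K by rewrite sqr_sqrtr// ltW.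
have y1 : y < 1 by rewrite -[ltRHS]sqrtr1 ltr_sqrt.
have [M hM] := gc y ltac:(by rewrite y0 y1).
have M0 : 0 <= M by apply: le_trans (hM 0%N); rewrite mulr_ge0.
exists ((1 - y)^-1 * (M / y)) => k; rewrite /pseries_diffs.
have -> : k.+1%:R * c k.+1 * K ^+ k = (k.+1%:R * y ^+ k) * (c k.+1 * y ^+ k.+1 / y).
  rewrite -y2 -exprM mulnC exprM expr2 exprS; field.
  by rewrite gt_eqF.
apply: ler_pM.
- by rewrite mulr_ge0// exprn_ge0// ltW.
- by rewrite divr_ge0 ?(ltW y0)// mulr_ge0 ?exprn_ge0 ?(ltW y0).
- rewrite -[leRHS]mul1r ler_pdivlMr ?subr_gt0//.
  apply: (@le_trans _ _ ((\sum_(i < k.+1) y ^+ i) * (1 - y))).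
    rewrite ler_pM2r ?subr_gt0// -[in leLHS](card_ord k.+1) mulr_natl -sumr_const.
    by apply: ler_sum => i _; rewrite ler_wiXn2l ?(ltW y0) ?(ltW y1)// -ltnS.
  have := subrX1 y k.+1; have := exprn_ge0 k.+1 (ltW y0); lra.
- by rewrite ler_wpM2r ?invr_ge0 ?(ltW y0).
Qed.

Lemma geometrically_bounded_cvg c (s : R) : (forall k, 0 <= c k) ->
  geometrically_bounded c -> 0 < s < 1 -> cvgn (pseries c s).
Proof.
move=> c0 gc /andP[s0 s1]; pose y := Num.sqrt s.
have y0 : 0 < y by rewrite sqrtr_gt0.
have y2 : y ^+ 2 = s by rewrite sqr_sqrtr// ltW.
have y1 : y < 1 by rewrite -[ltRHS]sqrtr1 ltr_sqrt.
have [M hM] := gc y ltac:(by rewrite y0 y1).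
have M0 : 0 <= M by apply: le_trans (hM 0%N); rewrite mulr_ge0.
apply: (@series_le_cvg _ _ (geometric M y)).
- by move=> k; rewrite mulr_ge0// exprn_ge0// ltW.
- by move=> k; rewrite /geometric/= mulr_ge0// exprn_ge0// ltW.
- move=> k; rewrite /geometric/= -y2 -exprM mulnC exprM expr2 mulrA.
  by rewrite ler_wpM2r ?hM ?exprn_ge0// ltW.
- by apply: is_cvg_geometric_series; rewrite gtr0_norm.
Qed.

Lemma pseries_is_derive c (s : R) : (forall k, 0 <= c k) ->
  geometrically_bounded c -> 0 < s < 1 ->
  is_derive s 1 (fun x : R => limn (pseries c x)) (limn (pseries (pseries_diffs c) s)).
Proof.
move=> c0 gc /andP[s0 s1].
have d0 k : 0 <= pseries_diffs c k by rewrite mulr_ge0.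
have dd0 k : 0 <= pseries_diffs (pseries_diffs c) k by rewrite mulr_ge0.
have gd := geometrically_bounded_diffs c0 gc.
have gdd := geometrically_bounded_diffs d0 gd.
have K01 : 0 < (1 + s) / 2 < 1 by apply/andP; split; lra.
apply: (@pseries_snd_diffs _ _ ((1 + s) / 2)).
- exact: geometrically_bounded_cvg.
- exact: geometrically_bounded_cvg.
- exact: geometrically_bounded_cvg.
- by rewrite (gtr0_norm s0) gtr0_norm; lra.
Qed.

(** A converse of Abel's theorem, valid because the coefficients are nonnegative: each partial sum
    is a limit of partial sums at s < 1, hence at most b; conversely the power series at s < 1 is at
    most the sum. *)
Lemma abel_limit c (b : R) : (forall k, 0 <= c k) -> geometrically_bounded c ->
  limn (pseries c s) @[s --> (1 : R)^'-] --> b -> series c n @[n --> \oo] --> b.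
Proof.
move=> c0 gc cb.
have le1 n : series c n <= b.
  have ps : (\sum_(0 <= k < n) c k * s ^+ k) @[s --> (1 : R)^'-] --> series c n.
    rewrite /series/=; elim: n => [|n IH].
      rewrite big_geq// (_ : (fun s => _) = cst 0); first exact: cvg_cst.
      by apply/funext => s; rewrite big_geq.
    rewrite big_nat_recr//= (_ : (fun s => _) = fun s : R => (\sum_(0 <= k < n) c k * s ^+ k) + c n * s ^+ n).
      apply: cvgD; first exact: IH.
      suff : c n * x ^+ n @[x --> (1 : R)^'-] --> c n * 1 ^+ n by rewrite expr1n mulr1.
      apply: cvgM; first exact: cvg_cst.
      apply: cvg_at_left_filter; exact: exprn_continuous.
    by apply/funext => s; rewrite big_nat_recr.
  apply: (ler_cvg_to ps cb); near=> s.
  have s01 : 0 < s < 1.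
    by apply/andP; split; near: s; [exact: nbhs_left_gt|exact: nbhs_left_lt].
  have cv := geometrically_bounded_cvg c0 gc s01.
  apply: nondecreasing_cvgn_le => //; apply: nondecreasing_series => k _ _.
  by rewrite mulr_ge0// exprn_ge0//; have /andP[/ltW] := s01.
have cv : cvgn (series c).
  apply: nondecreasing_is_cvgn; first exact: nondecreasing_series.
  by exists b => _ [n _ <-].
suff -> : b = limn (series c) by [].
apply/eqP; rewrite eq_le; apply/andP; split; last first.
  by apply: limr_le => //; near=> n.
apply: (cvgr_to_le cb); near=> s.
have s01 : 0 < s < 1.
  by apply/andP; split; near: s; [exact: nbhs_left_gt|exact: nbhs_left_lt].
have /andP[s0 s1] := s01.
apply: lim_series_le => //; first exact: geometrically_bounded_cvg.
by move=> k; rewrite -[leRHS]mulr1 ler_wpM2l// exprn_ile1 ?(ltW s0) ?(ltW s1).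
Unshelve. all: end_near. Qed.

Lemma gen_fun_deriv1_psum p (b : R) : (forall k, 0 <= p k) -> geometrically_bounded p ->
  gen_fun_deriv_at1 p 1 b -> has_psum p (fun k => k%:R) b.
Proof.
move=> p0 gp pb; have d0 k : 0 <= pseries_diffs p k by rewrite mulr_ge0.
have gd := geometrically_bounded_diffs p0 gp.
have : series (pseries_diffs p) n @[n --> \oo] --> b.
  apply: abel_limit => //; move: pb; apply: cvg_trans; apply: near_eq_cvg; near=> s.
  have s01 : 0 < s < 1.
    by apply/andP; split; near: s; [exact: nbhs_left_gt|exact: nbhs_left_lt].
  rewrite /= derive1E; have := pseries_is_derive p0 gp s01 => -[_ ?] //.
rewrite /has_psum -[X in _ -> X]cvg_shiftS; apply: cvg_trans; apply: near_eq_cvg.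
near=> n; rewrite /series/= big_nat_recl//= mulr0 add0r.
by apply: eq_bigr => k _; rewrite mulrC.
Unshelve. all: end_near. Qed.

Lemma gen_fun_deriv2_psum p (b : R) : (forall k, 0 <= p k) -> geometrically_bounded p ->
  gen_fun_deriv_at1 p 2 b -> has_psum p (fun k => k%:R * (k%:R - 1)) b.
Proof.
move=> p0 gp pb; have d0 k : 0 <= pseries_diffs p k by rewrite mulr_ge0.
have dd0 k : 0 <= pseries_diffs (pseries_diffs p) k by rewrite mulr_ge0.
have gd := geometrically_bounded_diffs p0 gp.
have gdd := geometrically_bounded_diffs d0 gd.
have : series (pseries_diffs (pseries_diffs p)) n @[n --> \oo] --> b.
  apply: abel_limit => //; move: pb; apply: cvg_trans; apply: near_eq_cvg; near=> s.
  have s01 : 0 < s < 1.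
    by apply/andP; split; near: s; [exact: nbhs_left_gt|exact: nbhs_left_lt].
  rewrite derive1nS derive1E.
  rewrite (near_eq_derive (g := fun x : R => limn (pseries (pseries_diffs p) x))).
    by have := pseries_is_derive d0 gd s01 => -[_ ?].
  (* Differentiating a second time needs the first derivative on a neighbourhood of s. *)
  have : \forall x \near s, 0 < x < 1 by apply: near_in_itvoo; rewrite in_itv.
  apply: filterS => x x01; rewrite /= derive1E.
  by have := pseries_is_derive p0 gp x01 => -[_ ?].
rewrite /has_psum -[X in _ -> X]cvg_shiftS -[X in _ -> X]cvg_shiftS; apply: cvg_trans; apply: near_eq_cvg.
near=> n; rewrite /series/= big_nat_recl//= mul0r mulr0 add0r.
rewrite big_nat_recl//= subrr mulr0 mulr0 add0r.
apply: eq_bigr => k _; rewrite /pseries_diffs -[k.+2%:R]natr1; ring.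
Unshelve. all: end_near. Qed.

End generating_function_derivatives.

Section bernoulli_inequalities.
Context {R : realType}.
Implicit Types t : R.

(** The indicator term repairs k = 0, where k - 1 = - 1. After averaging against the critical law (k
    - 1) t^2 vanishes, and the indicator alone leaves p_0 t^2. *)
Lemma onemX_lower t k : 0 <= t <= 1 ->
  1 + (k%:R - 1) * t ^+ 2 + (k == 0%N)%:R * t ^+ 2 <= (1 - t) ^+ k + k%:R * t.
Proof.
move=> /andP[t0 t1]; case: k => [|k]; first by rewrite expr0 /=; lra.
rewrite mul0r addr0; elim: k => [|k IH]; first by rewrite expr1; lra.
rewrite [(1 - t) ^+ k.+2]exprS -[k.+2%:R]natr1.
have : t * (1 - t) ^+ k.+1 <= t * (1 - t).
  rewrite ler_wpM2l// exprS ler_piMr ?exprn_ile1//; lra.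
move: IH; rewrite expr2; lra.
Qed.

Lemma onemX_upper t k : 0 <= t <= 1 ->
  (1 - t) ^+ k <= 1 - k%:R * t + k%:R * (k%:R - 1) / 2 * t ^+ 2.
Proof.
move=> /andP[t0 t1]; elim: k => [|k IH]; first by rewrite expr0; lra.
rewrite [(1 - t) ^+ _]exprS.
have h : (1 - t) * (1 - t) ^+ k <= (1 - t) * (1 - k%:R * t + k%:R * (k%:R - 1) / 2 * t ^+ 2).
  by rewrite ler_wpM2l//; lra.
apply: (le_trans h); rewrite -[k.+1%:R]natr1 -subr_ge0.
have [->|k0] := posnP k; first by rewrite expr2; lra.
have k1 : 1 <= k%:R :> R by rewrite ler1n.
have -> : 1 - (k%:R + 1) * t + (k%:R + 1) * (k%:R + 1 - 1) / 2 * t ^+ 2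
  - (1 - t) * (1 - k%:R * t + k%:R * (k%:R - 1) / 2 * t ^+ 2) = k%:R * (k%:R - 1) / 2 * t ^+ 3 by field.
by rewrite !mulr_ge0 ?exprn_ge0// subr_ge0.
Qed.

(** The crude coefficient k^3 lets the induction close: the step reduces to the sign of t^3 times a
    polynomial with nonnegative coefficients. *)
Lemma onemX_lower3 t k : 0 <= t <= 1 ->
  1 - k%:R * t + k%:R * (k%:R - 1) / 2 * t ^+ 2 - k%:R ^+ 3 * t ^+ 3 <= (1 - t) ^+ k.
Proof.
move=> /andP[t0 t1]; elim: k => [|k IH]; first by rewrite expr0 expr0n/=; lra.
rewrite [(1 - t) ^+ _]exprS.
have h : (1 - t) * (1 - k%:R * t + k%:R * (k%:R - 1) / 2 * t ^+ 2 - k%:R ^+ 3 * t ^+ 3) <= (1 - t) * (1 - t) ^+ k.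
  by rewrite ler_wpM2l//; lra.
apply: (le_trans _ h); rewrite -[k.+1%:R]natr1 -subr_ge0.
have k0 : 0 <= k%:R :> R by [].
move: k0; set x : R := k%:R => k0.
have -> : (1 - t) * (1 - x * t + x * (x - 1) / 2 * t ^+ 2 - x ^+ 3 * t ^+ 3)
  - (1 - (x + 1) * t + (x + 1) * (x + 1 - 1) / 2 * t ^+ 2 - (x + 1) ^+ 3 * t ^+ 3)
  = t ^+ 3 * (1 + 5 / 2 * x ^+ 2 + 7 / 2 * x + x ^+ 3 * t) by field.
by rewrite mulr_ge0 ?exprn_ge0// !addr_ge0 ?mulr_ge0 ?exprn_ge0.
Qed.

(* t^2 k^2 min(1, k t) bounds the remainder of the expansion of (1 - t)^k at
   order 2; its mean is summable along t = 1 / (1 + c j) precisely thanks to the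
   moment E[xi^2 log xi]. *)
Definition cubic_kernel t k : R := k%:R ^+ 2 * Num.min 1 (k%:R * t).

Lemma cubic_kernel_ge0 t k : 0 <= t -> 0 <= cubic_kernel t k.
Proof. by move=> t0; rewrite mulr_ge0 ?sqr_ge0// le_min ler01 mulr_ge0. Qed.

Lemma cubic_kernel_le t k : cubic_kernel t k <= k%:R ^+ 2.
Proof. by rewrite -[leRHS]mulr1 ler_wpM2l ?sqr_ge0// ge_min lexx. Qed.

(** For k t < 1 the cubic lower bound is used; for k t >= 1 the whole second-order term is already
    at most k^2 t^2. *)
Lemma onemX_remainder t k : 0 <= t <= 1 ->
  0 <= k%:R * (k%:R - 1) / 2 * t ^+ 2 - ((1 - t) ^+ k - 1 + k%:R * t) <= t ^+ 2 * cubic_kernel t k.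
Proof.
move=> t01; have /andP[t0 t1] := t01.
have h1 := onemX_upper k t01; have h2 := onemX_lower3 k t01; have h3 := onemX_lower k t01.
apply/andP; split; first by lra.
rewrite /cubic_kernel; have [kt|kt] := leP 1 (k%:R * t); last first.
  by rewrite (_ : _ * (_ * (_ * t)) = k%:R ^+ 3 * t ^+ 3); [lra|ring].
rewrite mulr1.
have h4 : 0 <= (k%:R - 1) * t ^+ 2 + (k == 0%N)%:R * t ^+ 2.
  rewrite -mulrDl mulr_ge0 ?sqr_ge0//; case: k {kt h1 h2 h3} => [|k] /=; first by lra.
  by rewrite addr0 subr_ge0 ler1n.
have h5 : k%:R * (k%:R - 1) / 2 * t ^+ 2 <= t ^+ 2 * k%:R ^+ 2.
  rewrite [leRHS]mulrC ler_wpM2r ?sqr_ge0// expr2.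
  have k0 : 0 <= k%:R :> R by []; have := sqr_ge0 (k%:R : R); rewrite expr2; lra.
lra.
Qed.

(** Up to j = k the terms are bounded by the harmonic ones and add up to 1 + ln k; beyond, they are
    below k / j - k / (j + 1) and telescope to at most 1. This is the origin of the logarithmic
    moment. *)
Lemma harmonic_kernel k J : (0 < k)%N ->
  \sum_(j < J) Num.min (1 / (1 + j%:R)) (k%:R / (1 + j%:R) ^+ 2) <= 2 + ln k%:R :> R.
Proof.
move=> k0; pose S (J : nat) : R := \sum_(j < J) Num.min (1 / (1 + j%:R)) (k%:R / (1 + j%:R) ^+ 2).
have kR : 0 < k%:R :> R by rewrite ltr0n.
have lnk : 0 <= ln k%:R :> R by rewrite ln_ge0// ler1n.
have S1 i : S i.+1 <= 1 + ln i.+1%:R.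
  elim: i => [|i IH].
    by rewrite /S big_ord_recl big_ord0 ln1 !addr0 ge_min divr1 lexx.
  rewrite /S big_ord_recr/= -/(S i.+1).
  have i0 : 0 < i.+1%:R :> R by [].
  have := @ln_ge_1BV R (i.+2%:R / i.+1%:R); rewrite divr_gt0// => /(_ isT).
  rewrite ln_div ?posrE// => h.
  have h2 : Num.min (1 / (1 + i.+1%:R)) (k%:R / (1 + i.+1%:R) ^+ 2) <= 1 - (i.+2%:R / i.+1%:R)^-1 :> R.
    rewrite ge_min; apply/orP; left; apply: eq_ler.
    rewrite -[i.+2%:R]natr1; field; rewrite !gt_eqF// addr_gt0//.
  by apply: le_trans (lerD IH (le_trans h2 h)) _; rewrite -addrA lerD2l addrC subrK.
have S2 i : S (k + i)%N <= S k + 1 - k%:R / (k + i)%:R.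
  elim: i => [|i IH]; first by rewrite addn0 divff ?gt_eqF//; lra.
  have Sr : S (k + i).+1 = S (k + i)%N + Num.min (1 / (1 + (k + i)%:R)) (k%:R / (1 + (k + i)%:R) ^+ 2).
    by rewrite /S big_ord_recr.
  rewrite addnS Sr.
  have i0 : 0 < (k + i)%:R :> R by rewrite ltr0n addn_gt0 k0.
  have h2 : Num.min (1 / (1 + (k + i)%:R)) (k%:R / (1 + (k + i)%:R) ^+ 2)
      <= k%:R / (k + i)%:R - k%:R / (k + i).+1%:R :> R.
    rewrite ge_min; apply/orP; right; rewrite -[(k + i).+1%:R]natr1.
    move: i0; move: ((k + i)%:R : R) => y y0; have y1 : 0 < y + 1 by lra.
    rewrite [1 + y]addrC.
    have -> : k%:R / y - k%:R / (y + 1) = k%:R / (y * (y + 1)).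
      by field; rewrite !gt_eqF.
    rewrite ler_wpM2l// lef_pV2 ?posrE ?mulr_gt0 ?exprn_gt0//.
    by rewrite expr2 ler_wpM2r//; lra.
  by apply: le_trans (lerD IH h2) _; rewrite addrA subrK.
rewrite -/(S J); have [Jk|kJ] := leqP J k.
  case: J Jk => [|J] Jk; first by rewrite /S big_ord0 addr_ge0.
  have := S1 J; have : ln J.+1%:R <= ln k%:R :> R by rewrite ler_ln ?posrE// ler_nat.
  lra.
have := S2 (J - k)%N; rewrite subnKC ?(ltnW kJ)//.
have : 0 <= k%:R / J%:R :> R by rewrite divr_ge0.
have := S1 k.-1; rewrite prednK//; lra.
Qed.

End bernoulli_inequalities.

(** * The orbit hypotheses for the offspring and immigration laws *)

Section offspring_and_immigration.
Context {R : realType}.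
Implicit Types t : R.
Variables (p h : nat -> R) (beta gam sig : R).
Hypotheses (p_ge0 : forall k, 0 <= p k) (h_ge0 : forall k, 0 <= h k)
  (p_sum : has_psum p (fun=> 1) 1) (h_sum : has_psum h (fun=> 1) 1)
  (p_mean : has_psum p (fun k => k%:R) 1) (h_mean : has_psum h (fun k => k%:R) beta)
  (p_var : has_psum p (fun k => k%:R * (k%:R - 1)) (2 * gam))
  (p_0 : 0 < p 0%N < 1) (h_0 : 0 < h 0%N)
  (p_log : exists M : R, has_psum p (fun k => k%:R ^+ 2 * ln k%:R) M)
  (h_sqr : exists M : R, has_psum h (fun k => k%:R ^+ 2) M)
  (gam_gt0 : 0 < gam) (beta_gt0 : 0 < beta) (betaE : beta = sig * gam).

Let pow_dom (q : nat -> R) t : (forall k, 0 <= q k) -> has_psum q (fun=> 1) 1 -> 0 <= t <= 1 ->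
  has_psum q (fun k => (1 - t) ^+ k) (psum q (fun k => (1 - t) ^+ k)).
Proof.
move=> q0 q1 /andP[t0 t1]; apply: (has_psum_dom q0 _ q1) => k.
have h0 : 0 <= 1 - t by lra.
by rewrite exprn_ge0// exprn_ile1//; lra.
Qed.

Let g (t : R) : R := 1 - psum p (fun k => (1 - t) ^+ k).
Let hh (t : R) : R := psum h (fun k => (1 - t) ^+ k).

Let p_sqr : has_psum p (fun k => k%:R ^+ 2) (2 * gam + 1).
Proof.
have := has_psumD p_var p_mean; rewrite (_ : (fun k => _) = fun k => k%:R ^+ 2)//.
by apply/funext => k; ring.
Qed.

Let etab t : R := psum p (cubic_kernel t).

Let etab_has t : 0 <= t -> has_psum p (cubic_kernel t) (etab t).
Proof.
move=> t0; apply: (has_psum_dom p_ge0 _ p_sqr) => k.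
by rewrite cubic_kernel_ge0// cubic_kernel_le.
Qed.

Let excess (q : nat -> R) b t : (forall k, 0 <= q k) -> has_psum q (fun=> 1) 1 ->
  has_psum q (fun k => k%:R) b -> 0 <= t <= 1 ->
  has_psum q (fun k => (1 - t) ^+ k - 1 + k%:R * t) (psum q (fun k => (1 - t) ^+ k) - 1 + b * t).
Proof.
move=> q0 q1 qb t01; have := has_psumD (has_psumB (pow_dom q0 q1 t01) q1) (has_psumZ (c := t) qb).
rewrite [t * b]mulrC (_ : (fun k => _) = fun k => (1 - t) ^+ k - 1 + k%:R * t)//.
by apply/funext => k; ring.
Qed.

Let in01 t : 0 < t <= 1 -> 0 <= t <= 1.
Proof. by move=> /andP[/ltW -> ->]. Qed.

Let g_ge t : 0 < t <= 1 -> (1 - p 0%N) * t <= g t.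
Proof.
move=> /in01 t01; have /andP[t0 t1] := t01.
have h1 := has_psumB p_sum (pow_dom p_ge0 p_sum t01).
have h2 := has_psumZ (c := t) (has_psumB p_sum (@has_psum_delta0 R p)).
rewrite mulrC; apply: (le_has_psum p_ge0 _ h2 h1) => k.
case: k => [|k] /=; first by rewrite expr0 !subrr mulr0.
rewrite subr0 mulr1 exprS.
have : (1 - t) * (1 - t) ^+ k <= (1 - t) * 1.
  by rewrite ler_wpM2l ?exprn_ile1//; lra.
lra.
Qed.

(** Criticality makes the mean of k - 1 zero, so t^2 (k - 1) can be subtracted freely; every
    remaining term is nonnegative, and the one at k = 0 equals p_0 t^2. *)
Let g_le t : 0 < t <= 1 -> g t <= t - p 0%N * t ^+ 2.
Proof.
move=> /in01 t01; have h1 := excess p_ge0 p_sum p_mean t01.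
have h2 := has_psumZ (c := t ^+ 2) (has_psumB p_mean p_sum).
have h3 := has_psumB h1 h2.
suff : p 0%N * t ^+ 2 <= psum p (fun k => (1 - t) ^+ k) - 1 + 1 * t - t ^+ 2 * (1 - 1).
  by rewrite /g; lra.
apply: le_trans (has_psum_ge_term 0%N p_ge0 _ h3); first by rewrite expr0; lra.
move=> k; have := onemX_lower k t01.
have : 0 <= (k == 0%N)%:R * t ^+ 2 by rewrite mulr_ge0 ?sqr_ge0.
lra.
Qed.

Let g_approx t : 0 < t <= 1 -> `|g t - t + gam * t ^+ 2| <= t ^+ 2 * (t + etab t).
Proof.
move=> t01'; have t01 := in01 t01'; have /andP[t0 t1] := t01.
have h1 := has_psumB (has_psumZ (c := t ^+ 2 / 2) p_var) (excess p_ge0 p_sum p_mean t01).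
have h2 := has_psumZ (c := t ^+ 2) (etab_has t0).
have E : g t - t + gam * t ^+ 2 = t ^+ 2 / 2 * (2 * gam) - (psum p (fun k => (1 - t) ^+ k) - 1 + 1 * t).
  by rewrite /g; field.
have rem k := onemX_remainder k t01.
have l1 : 0 <= g t - t + gam * t ^+ 2.
  rewrite E; apply: le_trans (has_psum_ge_term 0%N p_ge0 _ h1).
    by rewrite expr0 mulr_ge0//; lra.
  by move=> k; have /andP[+ _] := rem k; lra.
rewrite ger0_norm// mulrDr.
suff : g t - t + gam * t ^+ 2 <= t ^+ 2 * etab t.
  have : 0 <= t ^+ 2 * t by rewrite mulr_ge0 ?sqr_ge0.
  lra.
rewrite E; apply: (le_has_psum p_ge0 _ h1 h2) => k.
by have /andP[_] := rem k; lra.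
Qed.

Let hh_ge t : 0 < t <= 1 -> h 0%N <= hh t.
Proof.
move=> /in01 t01; have := has_psum_ge_term 0%N h_ge0 _ (pow_dom h_ge0 h_sum t01).
rewrite expr0 mulr1; apply => k; rewrite exprn_ge0//.
by have /andP[_] := t01; lra.
Qed.

Let hh_approx : exists2 C : R, 0 <= C & forall t : R, 0 < t <= 1 -> `|hh t - 1 + beta * t| <= C * t ^+ 2.
Proof.
have [M hM] := h_sqr.
have M0 : 0 <= M.
  apply: le_trans (has_psum_ge_term 0%N h_ge0 _ hM); first by rewrite expr0n mulr0.
  by move=> k; rewrite sqr_ge0.
exists M => // t /in01 t01; have h1 := excess h_ge0 h_sum h_mean t01.
have l1 : 0 <= hh t - 1 + beta * t.
  apply: le_trans (has_psum_ge_term 0%N h_ge0 _ h1).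
    by rewrite expr0 mulr_ge0//; lra.
  move=> k; have := onemX_lower k t01.
  have : 0 <= (k%:R - 1) * t ^+ 2 + (k == 0%N)%:R * t ^+ 2.
    rewrite -mulrDl mulr_ge0 ?sqr_ge0//; case: k => [|k] /=; first by lra.
    by rewrite addr0 subr_ge0 ler1n.
  lra.
rewrite ger0_norm// [leRHS]mulrC; apply: (le_has_psum h_ge0 _ h1 (has_psumZ (c := t ^+ 2) hM)) => k.
have := onemX_upper k t01.
have : t ^+ 2 * (k%:R * (k%:R - 1) / 2) <= t ^+ 2 * k%:R ^+ 2.
  rewrite ler_wpM2l ?sqr_ge0// expr2.
  have k0 : 0 <= k%:R :> R by []; have := sqr_ge0 (k%:R : R); rewrite expr2; lra.
lra.
Qed.

Let w (t : R) : R := t + etab t.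

Let w_homo (s t : R) : 0 < s -> s <= t -> t <= 1 -> w s <= w t.
Proof.
move=> s0 st t1; apply: lerD => //.
have t0 : 0 <= t by apply: le_trans st; exact: ltW.
apply: (le_has_psum p_ge0 _ (etab_has (ltW s0)) (etab_has t0)) => k.
rewrite ler_wpM2l ?sqr_ge0// le_min ge_min lexx/= ge_min; apply/orP; right.
by rewrite ler_wpM2l.
Qed.

Let etab_ge0 t : 0 <= t -> 0 <= etab t.
Proof.
move=> t0; apply: le_trans (has_psum_ge_term 0%N p_ge0 _ (etab_has t0)).
  by rewrite /cubic_kernel expr0n/= mul0r mulr0.
by move=> k; exact: cubic_kernel_ge0.
Qed.

Let c := p 0%N.

Let tau_ge j : c * (1 + j%:R) <= 1 + c * j%:R.
Proof. by rewrite mulrDr lerD2r mulr1; have /andP[_ /ltW] := p_0. Qed.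

(** Exchanging the sums over j and k turns the partial sum into a mean of xi^2 times a kernel sum
    bounded by c^-2 (2 + ln xi), finite by [p_log]. The factor c^-2 comes from 1 + c j >= c (1 +
    j). *)
Let w_sum : cvgn (series (fun j => w (1 + c * j%:R)^-1 / (1 + c * j%:R))).
Proof.
have [c0 c1] : 0 < c /\ c < 1 by split; have /andP[] := p_0.
have den j : 0 < 1 + c * j%:R by rewrite ltr_pwDl// mulr_ge0// ltW.
have j1 j : 0 < 1 + j%:R :> R by rewrite ltr_pwDl.
have t0 j : 0 <= w (1 + c * j%:R)^-1 / (1 + c * j%:R).
  rewrite divr_ge0 ?(ltW (den j))// addr_ge0 ?etab_ge0 ?invr_ge0// ltW//.
have inv1 j : (1 + c * j%:R)^-1 <= c^-1 * (1 + j%:R)^-1.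
  by rewrite -invfM lef_pV2 ?posrE ?mulr_gt0//; exact: tau_ge.
have ic : 1 <= c^-1 by rewrite invf_ge1// ltW.
have ic0 : 0 < c^-1 by rewrite invr_gt0.
have kern k j : (1 + c * j%:R)^-1 * Num.min 1 (k%:R * (1 + c * j%:R)^-1)
    <= c^-1 ^+ 2 * Num.min (1 / (1 + j%:R)) (k%:R / (1 + j%:R) ^+ 2).
  have i0 : 0 <= (1 + c * j%:R)^-1 by rewrite invr_ge0 ltW.
  have i0' : 0 <= (1 + j%:R)^-1 :> R by rewrite invr_ge0 ltW.
  rewrite (minr_pMr _ _ i0) (minr_pMr _ _ (exprn_ge0 2 (ltW ic0))).
  rewrite le_min !ge_min; apply/andP; split; apply/orP; [left|right].
    rewrite mulr1 mul1r; apply: (le_trans (inv1 j)); rewrite ler_wpM2r//.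
    by rewrite expr2 ler_peMl// ltW.
  rewrite mulrCA [leRHS]mulrCA ler_wpM2l// -exprVn -exprMn -expr2.
  by rewrite ler_sqr ?nnegrE ?mulr_ge0 ?(ltW ic0).
have [M hM] := p_log.
apply: nondecreasing_is_cvgn; first exact: nondecreasing_series.
exists (c^-1 ^+ 2 * 2 + c^-1 ^+ 2 * (2 * (2 * gam + 1) + M)) => _ [J _ <-].
rewrite /series/= big_mkord.
rewrite (eq_bigr (fun j : 'I_J => (1 + c * j%:R)^-1 * (1 + c * j%:R)^-1 + (1 + c * j%:R)^-1 * etab (1 + c * j%:R)^-1)); last first.
  by move=> j _; rewrite /w mulrDl [etab _ / _]mulrC.
rewrite big_split/=; apply: lerD.
  (* The part of w equal to t is the same kernel at k = 1, whose logarithm is 0. *)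
  apply: (@le_trans _ _ (c^-1 ^+ 2 * \sum_(j < J) Num.min (1 / (1 + j%:R)) (1%:R / (1 + j%:R) ^+ 2))).
    rewrite mulr_sumr; apply: ler_sum => j _; apply: le_trans (kern 1%N j).
    rewrite mul1r ler_wpM2l ?invr_ge0 ?(ltW (den j))// le_min lexx andbT.
    by rewrite invf_le1// lerDl mulr_ge0// ltW.
  rewrite ler_wpM2l ?exprn_ge0 ?(ltW ic0)//.
  by have := @harmonic_kernel R 1 J isT; rewrite ln1 addr0.
have h1 : has_psum p (fun k => \sum_(j < J) (1 + c * j%:R)^-1 * cubic_kernel (1 + c * j%:R)^-1 k)
    (\sum_(j < J) (1 + c * j%:R)^-1 * etab (1 + c * j%:R)^-1).
  apply: (has_psum_sum (phi := fun j k => (1 + c * j%:R)^-1 * cubic_kernel (1 + c * j%:R)^-1 k)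
    (l := fun j => (1 + c * j%:R)^-1 * etab (1 + c * j%:R)^-1)) => j.
  by apply: has_psumZ; apply: etab_has; rewrite invr_ge0 ltW.
have h2 := has_psumZ (c := c^-1 ^+ 2) (has_psumD (has_psumZ (c := 2) p_sqr) hM).
apply: (le_has_psum p_ge0 _ h1 h2) => k.
have [->|k0] := posnP k.
  rewrite expr0n/= !mul0r mulr0 addr0 mulr0 big1// => j _.
  by rewrite /cubic_kernel expr0n/= mul0r mulr0.
apply: (@le_trans _ _ (k%:R ^+ 2 * (c^-1 ^+ 2 * \sum_(j < J) Num.min (1 / (1 + j%:R)) (k%:R / (1 + j%:R) ^+ 2)))).
  rewrite !mulr_sumr; apply: ler_sum => j _; rewrite /cubic_kernel mulrCA.
  by rewrite ler_wpM2l ?sqr_ge0.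
have := @harmonic_kernel R k J k0.
rewrite -(ler_pM2l (_ : 0 < c^-1 ^+ 2 * k%:R ^+ 2)); last by rewrite mulr_gt0 ?exprn_gt0// ltr0n.
by move=> hk; apply: le_trans (le_trans hk _); apply: eq_ler; ring.
Qed.

Lemma offspring_traj_prod_asymptotics : critical_asymptotics gam sig
  (traj_prod (fun t => 1 - psum p (fun k => (1 - t) ^+ k))
             (fun t => psum h (fun k => (1 - t) ^+ k))).
Proof.
have [C C0 hC] := hh_approx; have /andP[p00 p01] := p_0.
apply: (traj_prod_asymptotics (w := w) (c := c) (q0 := 1 - p 0%N) (h0 := h 0%N) (C := C) (beta := beta)) => //.
- by rewrite subr_gt0.
- by move=> t /andP[t0 _]; rewrite lerDl etab_ge0// ltW.
Qed.

End offspring_and_immigration.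

(** * The process with immigration *)

Section natural_valued_functions.
Context {d : measure_display} {T : measurableType d}.

Lemma measurable_natP (f : T -> nat) :
  measurable_fun setT f <-> forall A : set nat, measurable (f @^-1` A).
Proof.
split=> [mf A|h _ A _]; last by rewrite setTI.
by rewrite -[X in measurable X]setTI; exact: mf.
Qed.

Lemma measurable_random_index (N : T -> nat) (d' : measure_display)
    (U : measurableType d') (F : nat -> T -> U) :
  measurable_fun setT N -> (forall k, measurable_fun setT (F k)) ->
  measurable_fun setT (fun w => F (N w) w).
Proof.
move=> /measurable_natP mN mF _ A mA; rewrite setTI.
rewrite (_ : _ @^-1` A = \bigcup_k (N @^-1` [set k] `&` (setT `&` F k @^-1` A))).
  by apply: bigcup_measurable => k _; apply: measurableI => //; exact: mF.
apply/seteqP; split => w /=; first by move=> FA; exists (N w).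
by move=> [k _ [/= <- [_ +]]].
Qed.

Lemma measurable_addn (f g : T -> nat) : measurable_fun setT f ->
  measurable_fun setT g -> measurable_fun setT (fun w => (f w + g w)%N).
Proof.
move=> mf /measurable_natP mg.
apply: (measurable_random_index (F := fun k w => (k + g w)%N)) => // k.
apply/measurable_natP => A.
by rewrite (_ : _ @^-1` A = g @^-1` [set x | A (k + x)%N]).
Qed.

Lemma measurable_sumn (F : nat -> T -> nat) k : (forall i, measurable_fun setT (F i)) ->
  measurable_fun setT (fun w => (\sum_(i < k) F i w)%N).
Proof.
move=> mF; elim: k => [|k IH].
  by rewrite (_ : (fun w => _) = cst 0%N)//; apply/funext => w; rewrite big_ord0.
rewrite (_ : (fun w => _) = fun w => (\sum_(i < k) F i w + F k w)%N).
  exact: measurable_addn.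
by apply/funext => w; rewrite big_ord_recr.
Qed.

End natural_valued_functions.

Section conditioning_on_a_natural.
Context {d : measure_display} {T : measurableType d} {R : realType}.
Variable P : probability T R.

Lemma integral_indic_pr (A : set T) : measurable A ->
  (\int[P]_w (\1_A w)%:E = (pr P A)%:E)%E.
Proof. by move=> mA; rewrite integral_indic// setIT; exact: prE. Qed.

Lemma integral_random_index (N : T -> nat) (F : nat -> T -> R) :
  measurable_fun setT N -> (forall k, measurable_fun setT (F k)) ->
  (forall k w, 0 <= F k w) ->
  (\int[P]_w (F (N w) w)%:E =
   \sum_(k <oo) \int[P]_w (\1_(N @^-1` [set k]) w * F k w)%:E)%E.
Proof.
move=> mN mF F0; have /measurable_natP mN' := mN.
have i0 k w : 0 <= \1_(N @^-1` [set k]) w * F k w by rewrite mulr_ge0// indicE.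
rewrite -integral_nneseries//; last 2 first.
- by move=> k; apply/measurable_EFinP/measurable_funM.
- by move=> k w _; rewrite lee_fin.
apply: eq_integral => w _; apply/esym.
rewrite (@nneseriesD1 _ _ (N w))//; last by move=> k _; rewrite lee_fin.
rewrite indicE mem_set//= mul1r eseries0 ?adde0// => k _ /= kN.
by rewrite indicE memNset ?mul0r//= => /esym/eqP; rewrite (negPf kN).
Qed.

Lemma integral_nat_function (N : T -> nat) (phi : nat -> R) :
  measurable_fun setT N -> (forall k, 0 <= phi k) ->
  (\int[P]_w (phi (N w))%:E = \sum_(k <oo) (pr P (N @^-1` [set k]) * phi k)%:E)%E.
Proof.
move=> mN phi0; have /measurable_natP mN' := mN.
rewrite (integral_random_index (F := fun k _ => phi k))//.
apply: eq_eseriesr => k _.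
under eq_integral do rewrite mulrC EFinM.
rewrite integralZl//; last first.
  by apply: integrable_indic => //; rewrite ltey_eq fin_num_measure.
by rewrite integral_indic_pr// -EFinM mulrC.
Qed.

Lemma law_weights (N : T -> nat) : measurable_fun setT N ->
  subprobability_weights (fun k => pr P (N @^-1` [set k])) /\
  has_psum (fun k => pr P (N @^-1` [set k])) (fun=> 1) 1.
Proof.
move=> mN; have E : (\sum_(k <oo) (pr P (N @^-1` [set k]) * 1)%:E = 1)%E.
  rewrite -(integral_nat_function (phi := fun=> 1))// integral_cst//= probability_setT mule1//.
have p0 k : 0 <= pr P (N @^-1` [set k]) by exact: pr_ge0.
split; first split => //.
  by move: E; under eq_eseriesr do rewrite mulr1; move=> ->.
have [||h e] := nneseries_has_psum (phi := fun=> 1) p0 => //.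
  by rewrite E ltry.
have e1 : psum (fun k => pr P (N @^-1` [set k])) (fun=> 1) = 1 by apply: EFin_inj; rewrite -e E.
by rewrite -[X in has_psum _ _ X]e1.
Qed.

End conditioning_on_a_natural.

Section immigration_process.
Context {d : measure_display} {T : measurableType d} {R : realType}.
Variable P : probability T R.
Variables (xi : nat -> nat -> {RV P >-> nat}) (Y : nat -> {RV P >-> nat}).
Hypothesis xi_iid : iid (fun k : nat * nat => xi k.1 k.2).
Hypothesis Y_iid : iid Y.
Hypothesis Y_xi_indep : independent_families P Y (fun k : nat * nat => xi k.1 k.2).

(** Gathers offspring and immigration variables in one family, so that blocks mixing both kinds can
    be separated. *)
Let I : choiceType := ((nat * nat) + nat)%type.

Let W (i : I) : T -> nat := match i with inl k => xi k.1 k.2 | inr n => Y n end.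

Let mW i : measurable_fun setT (W i). Proof. by case: i. Qed.

Let W_indep : mutually_independent P W.
Proof.
move=> J A mA.
pose J1 : {fset nat * nat} := [fset k | k in pmap (fun i : I => if i is inl k then Some k else None) J]%fset.
pose J2 : {fset nat} := [fset k | k in pmap (fun i : I => if i is inr k then Some k else None) J]%fset.
have J1E k : (k \in J1) = (inl k \in J).
  rewrite in_fset/= mem_pmap; apply/mapP/idP => [[[k'|n] kJ //= [->]]//|kJ].
  by exists (inl k).
have J2E n : (n \in J2) = (inr n \in J).
  rewrite in_fset/= mem_pmap; apply/mapP/idP => [[[k'|m] nJ //= [->]]//|nJ].
  by exists (inr n).
have -> : \bigcap_(i in [set` J]) W i @^-1` A i =
    \bigcap_(n in [set` J2]) Y n @^-1` A (inr n) `&`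
    \bigcap_(k in [set` J1]) xi k.1 k.2 @^-1` A (inl k).
  apply/seteqP; split => w /=.
    move=> h; split => [n|k] /=; first by rewrite J2E => /h.
    by rewrite J1E => /h.
  move=> [h2 h1] [k|n] /= iJ; first by apply: h1; rewrite /= J1E.
  by apply: h2; rewrite /= J2E.
rewrite Y_xi_indep; last 2 first.
- have : @measurable _ (g_sigma_algebraType (block_gen Y setT)) (\bigcap_(n in [set` J2]) Y n @^-1` A (inr n)).
    apply: fin_bigcap_measurable => [|n _]; first exact: finite_fset.
    by rewrite -[X in measurable X]setTI; exact: (@measurable_block _ _ _ _ _ Y setT n Logic.I).
  by [].
- have : @measurable _ (g_sigma_algebraType (block_gen (fun k : nat * nat => xi k.1 k.2 : T -> nat) setT))
      (\bigcap_(k in [set` J1]) xi k.1 k.2 @^-1` A (inl k)).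
    apply: fin_bigcap_measurable => [|n _]; first exact: finite_fset.
    by rewrite -[X in measurable X]setTI; exact: (@measurable_block _ _ _ _ _ (fun k : nat * nat => xi k.1 k.2 : T -> nat) setT n Logic.I).
  by [].
rewrite (Y_iid.1 _ (fun n => A (inr n)))// (xi_iid.1 _ (fun k => A (inl k)))//.
rewrite (perm_big ([seq inr n | n <- J2] ++ [seq inl k | k <- J1] : seq I))/=; last first.
  apply: uniq_perm; first exact: fset_uniq.
    rewrite cat_uniq !map_inj_uniq ?fset_uniq//=; last 2 first.
    - by move=> ? ? [].
    - by move=> ? ? [].
    by rewrite andbT; apply/hasPn => _ /mapP[k _ ->]; apply/mapP => -[].
  move=> [k|n]; rewrite mem_cat.
    rewrite -J1E orbC mem_map; last by move=> ? ? [].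
    by case: (k \in J1) => //=; apply/esym/mapP => -[].
  rewrite -J2E mem_map; last by move=> ? ? [].
  by case: (n \in J2) => //=; apply/esym/mapP => -[].
by rewrite big_cat/= !big_map.
Qed.

(** Z_n is a function of the [past n] variables, and the step to Z_(n+1) uses only those of
    [present n]; the two blocks are disjoint. *)
Let past n : set I := [set i | match i with inl k => (k.1 < n)%N | inr m => (m < n)%N end].
Let present n : set I := [set i | match i with inl k => k.1 = n | inr m => m = n end].

Let Z := gwi xi Y.

Let Z_past n m : (n <= m)%N ->
  measurable_fun setT (Z n : g_sigma_algebraType (block_gen W (past m)) -> nat).
Proof.
elim: n => [|n IH] nm; first exact: measurable_cst.
rewrite /Z/=; apply: measurable_addn; last first.
  exact: (@measurable_block _ _ _ _ _ W (past m) (inr n) nm).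
apply: (@measurable_random_index _ (g_sigma_algebraType (block_gen W (past m))) (Z n) _ _
    (fun k w => (\sum_(i < k) xi n i w)%N)).
  by apply: IH; exact: ltnW.
move=> k; apply: (@measurable_sumn _ (g_sigma_algebraType (block_gen W (past m))) (fun i => xi n i)) => i.
exact: (@measurable_block _ _ _ _ _ W (past m) (inl (n, i)) nm).
Qed.

Lemma measurable_gwi n : measurable_fun setT (Z n).
Proof.
elim: n => [|n IH]; first exact: measurable_cst.
rewrite /Z/=; apply: measurable_addn => //.
apply: (measurable_random_index (N := Z n) (F := fun k w => (\sum_(i < k) xi n i w)%N)) => // k.
by apply: (measurable_sumn (F := fun i => xi n i)).
Qed.

Let a n k : R := pr P (Z n @^-1` [set k]).

Let p := law_nat (xi 0%N 0%N).
Let h := law_nat (Y 0%N).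

Let pow_integral (N : {RV P >-> nat}) (s : R) : 0 <= s <= 1 ->
  (\int[P]_w (s ^+ N w)%:E = (psum (law_nat N) (fun k => s ^+ k))%:E)%E.
Proof.
move=> /andP[s0 s1]; rewrite (@integral_nat_function _ _ _ P _ (fun k => s ^+ k))//; last first.
  by move=> k; rewrite exprn_ge0.
have [sub one] := law_weights P (N := N) ltac:(by []).
have p0 k : 0 <= pr P (N @^-1` [set k]) by exact: pr_ge0.
have [||_ ->//] := nneseries_has_psum (phi := fun k => s ^+ k) p0.
  by move=> k; rewrite exprn_ge0.
rewrite (wsumE (M := 1)) ?ltry// => k.
by rewrite exprn_ge0// exprn_ile1.
Qed.

Let same_law (N M : {RV P >-> nat}) (s : R) : 0 <= s ->
  (forall A, measurable A -> distribution P N A = distribution P M A) ->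
  (\int[P]_w (s ^+ N w)%:E = \int[P]_w (s ^+ M w)%:E)%E.
Proof.
move=> s0 NM; rewrite !(@integral_nat_function _ _ _ P _ (fun k => s ^+ k))//; last 2 first.
- by move=> k; rewrite exprn_ge0.
- by move=> k; rewrite exprn_ge0.
by apply: eq_eseriesr => k _; congr (_ * _)%:E; rewrite /pr; congr fine; exact: NM.
Qed.

Let pgf (n : nat) (s : R) : R := wsum (a n) (fun k => s ^+ k).

Let pgfE n (s : R) : 0 <= s <= 1 -> (\int[P]_w (s ^+ Z n w)%:E = (pgf n s)%:E)%E.
Proof.
move=> /andP[s0 s1]; rewrite (@integral_nat_function _ _ _ P _ (fun k => s ^+ k)); last 2 first.
- exact: measurable_gwi.
- by move=> k; rewrite exprn_ge0.
rewrite (wsumE (M := 1))//.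
  by have [] := law_weights P (measurable_gwi n).
by move=> k; rewrite exprn_ge0// exprn_ile1.
Qed.

Let f s := psum p (fun k => s ^+ k).

Let f_in s : 0 <= s <= 1 -> 0 <= f s <= 1.
Proof.
move=> s01; have /andP[s0 s1] := s01.
rewrite -!lee_fin -pow_integral//; apply/andP; split.
  by apply: integral_ge0 => w _; rewrite lee_fin exprn_ge0.
apply: (@le_trans _ _ (\int[P]_w (cst 1%:E w))%E); last first.
  by rewrite integral_cst//= probability_setT mule1.
apply: ge0_le_integral => //=.
- by move=> w _; rewrite lee_fin exprn_ge0.
- apply/measurable_EFinP; apply: (measurable_random_index (N := xi 0%N 0%N) (F := fun k _ => s ^+ k)) => //.
- by move=> w _; rewrite lee_fin exprn_ile1.
Qed.

Let pgf0 s : 0 <= s <= 1 -> pgf 0 s = 1.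
Proof.
move=> s01; apply: EFin_inj; rewrite -pgfE// /Z/=.
by under eq_integral do rewrite expr0; rewrite integral_cst//= probability_setT mule1.
Qed.

Let measurable_pow (N : T -> nat) (s : R) : measurable_fun setT N ->
  measurable_fun setT (fun w => s ^+ N w).
Proof. by move=> mN; apply: (measurable_random_index (F := fun k _ => s ^+ k)). Qed.

(** On Z_n = k the next generation is a sum of k offspring and one immigration variable, all in the
    present block: the indicator factors out, then the product of powers. *)
Let step n k (s : R) : 0 <= s <= 1 ->
  (\int[P]_w (\1_(Z n @^-1` [set k]) w * s ^+ (\sum_(i < k) xi n i w + Y n w))%:E
   = (a n k * (psum h (fun k => s ^+ k) * f s ^+ k))%:E)%E.
Proof.
move=> s01; have /andP[s0 s1] := s01.
have mZ := measurable_gwi n; have /measurable_natP mZ' := mZ.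
have mS : measurable_fun setT (fun w => (\sum_(i < k) xi n i w + Y n w)%N).
  by apply: measurable_addn => //; apply: (measurable_sumn (F := fun i => xi n i)).
rewrite indep_expectationM; last 5 first.
- exact: measurable_indic.
- exact: measurable_pow.
- by move=> w; rewrite indicE.
- by move=> w; rewrite exprn_ge0.
- move=> A B mA mB; apply: (indep_blocks mW (J1 := past n) (J2 := present n) W_indep).
  + apply/seteqP; split => [[k' [/= k1 k2]|m [/= k1 k2]]|//].
      by move: k1; rewrite k2 ltnn.
    by move: k1; rewrite k2 ltnn.
  + have m1 : measurable_fun setT (\1_(Z n @^-1` [set k]) : g_sigma_algebraType (block_gen W (past n)) -> R).
      by apply: measurable_indic; have /measurable_natP := Z_past (leqnn n).
    by have := m1 measurableT A mA; rewrite setTI.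
  + have m2 : measurable_fun setT ((fun w => s ^+ (\sum_(i < k) xi n i w + Y n w)) : g_sigma_algebraType (block_gen W (present n)) -> R).
      apply: (measurable_random_index (N := fun w : g_sigma_algebraType (block_gen W (present n)) => (\sum_(i < k) xi n i w + Y n w)%N) (F := fun k _ => s ^+ k)) => //.
      apply: measurable_addn; last exact: (@measurable_block _ _ _ _ _ W (present n) (inr n) erefl).
      apply: (@measurable_sumn _ (g_sigma_algebraType (block_gen W (present n))) (fun i => xi n i)) => i.
      exact: (@measurable_block _ _ _ _ _ W (present n) (inl (n, i)) erefl).
    by have := m2 measurableT B mB; rewrite setTI.
rewrite integral_indic_pr// EFinM; congr (_ * _)%E.
pose sq : seq I := inr n :: [seq inl (n, i) | i <- iota 0 k].
rewrite (_ : (\int[P]_w _)%E = (\int[P]_w (\prod_(i <- sq) s ^+ W i w)%:E)%E); last first.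
  apply: eq_integral => w _; rewrite /sq big_cons big_map exprD mulrC/=; congr (_ * _)%:E.
  rewrite -prodrXr -(big_mkord xpredT (fun i => s ^+ xi n i w)) /index_iota subn0//.
rewrite (expectation_prod mW (g := fun _ x => s ^+ x))//; last 2 first.
- rewrite /sq/= map_inj_uniq ?iota_uniq ?andbT//; last by move=> ? ? [].
  by apply/mapP => -[].
- by move=> i x; rewrite exprn_ge0.
rewrite /sq big_cons big_map/= EFinM; congr (_ * _)%E.
  by rewrite (same_law (M := Y 0%N)) ?pow_integral//; exact: Y_iid.2.
have E i : (\int[P]_w (s ^+ xi n i w)%:E = (f s)%:E)%E.
  rewrite (same_law (M := xi 0%N 0%N)) ?pow_integral//.
  exact: (xi_iid.2 (n, i) (0%N, 0%N)).
elim: (k) => [|j IH]; first by rewrite big_nil.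
rewrite -addn1 iotaD big_cat/= IH big_cons big_nil E mule1 -EFinM.
by rewrite addn1 exprSr.
Qed.

Let pgfS n s : 0 <= s <= 1 -> pgf n.+1 s = psum h (fun k => s ^+ k) * pgf n (f s).
Proof.
move=> s01; have /andP[s0 s1] := s01; apply: EFin_inj; rewrite -pgfE//.
rewrite /Z/= (@integral_random_index _ _ _ P (Z n) (fun k w => s ^+ (\sum_(i < k) xi n i w + Y n w))); last 3 first.
- exact: measurable_gwi.
- by move=> k; apply: measurable_pow; apply: measurable_addn => //; apply: (measurable_sumn (F := fun i => xi n i)).
- by move=> k w; rewrite exprn_ge0.
under eq_eseriesr do rewrite step// mulrCA.
have hs0 : 0 <= psum h (fun k => s ^+ k).
  rewrite -lee_fin -pow_integral//; apply: integral_ge0 => w _; by rewrite lee_fin exprn_ge0.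
have /andP[f0 f1] := f_in s01.
under eq_eseriesr do rewrite EFinM.
rewrite nneseriesZl//; last by move=> k _; rewrite lee_fin mulr_ge0 ?pr_ge0// exprn_ge0.
rewrite (wsumE (M := 1))//.
  by have [] := law_weights P (measurable_gwi n).
by move=> k; rewrite exprn_ge0// exprn_ile1.
Qed.

(** The branching recursion pgf_(n+1)(s) = h(s) pgf_n(f(s)), written in t = 1 - s: f becomes g, and
    each step peels off the first factor of the orbit product. *)
Lemma gwi_generating_function n (t : R) : 0 <= t <= 1 ->
  wsum (fun k => pr P (gwi xi Y n @^-1` [set k])) (fun k => (1 - t) ^+ k) =
  traj_prod (fun t => 1 - psum (law_nat (xi 0%N 0%N)) (fun k => (1 - t) ^+ k))
    (fun t => psum (law_nat (Y 0%N)) (fun k => (1 - t) ^+ k)) n t.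
Proof.
rewrite -/Z -/(a n) -/(pgf n (1 - t)).
elim: n t => [|n IH] t t01; have s01 : 0 <= 1 - t <= 1 by move/andP: t01 => [? ?]; apply/andP; split; lra.
  by rewrite pgf0// /traj_prod big_ord0.
rewrite pgfS// /traj_prod big_ord_recl/=; congr (_ * _).
have /andP[f0 f1] := f_in s01.
have t01' : 0 <= 1 - f (1 - t) <= 1 by apply/andP; split; lra.
rewrite -[f (1 - t)](subKr 1) IH// /traj_prod; apply: eq_bigr => i _.
by rewrite /traj/= -iterSr.
Qed.

Variable X : nat -> {RV P >-> R}.
Hypothesis X_Z_indep : independent_families P X (gwi xi Y).

(** Total probability over Z_n = k, then independence of X and Z. The term k = 0 is absent because
    the mean is set to 0 there, below eps. *)
Lemma random_mean_law n (eps : R) : 0 < eps ->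
  (P [set w | (eps <= random_mean (gwi xi Y) X n w)%R] =
   \sum_(k <oo) (pr P (gwi xi Y n @^-1` [set k]) *
     (if k == 0%N then 0 else
        pr P [set w | (k%:R * eps <= \sum_(i <- iota 0 k) X i w)%R]))%:E)%E.
Proof.
move=> e0; have mZ := measurable_gwi n; have /measurable_natP mZ' := mZ.
pose B k := [set w | (k%:R * eps <= \sum_(i <- iota 0 k) X i w)%R].
have mB k : measurable (B k) by apply: measurable_ge; exact: measurable_sum.
pose F k := if k == 0%N then set0 else Z n @^-1` [set k] `&` B k.
have mF k : measurable (F k) by rewrite /F; case: ifP => // _; exact: measurableI.
have sumE k w : \sum_(i <- iota 0 k) X i w = \sum_(i < k) X i w.
  by rewrite -(big_mkord xpredT (fun i => X i w)) /index_iota subn0.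
have -> : [set w | eps <= random_mean (gwi xi Y) X n w] = \bigcup_k F k.
  apply/seteqP; split => w /=; rewrite /random_mean -/Z.
    case: ifP => [Z0|_ eL]; last by move: e0; rewrite ltNge eL.
    rewrite ler_pdivlMr ?ltr0n// => eL; exists (Z n w) => //.
    rewrite /F gtn_eqF//; split => //; rewrite /B/= mulrC.
    by rewrite sumE.
  move=> [k _]; rewrite /F; case: ifP => // /negbT; rewrite -lt0n => k0 [/= Zk].
  rewrite Zk k0 /B/= ler_pdivlMr ?ltr0n// mulrC.
  by rewrite sumE.
have tF : trivIset setT F.
  have FZ i w : F i w -> Z n w = i by rewrite /F; case: ifP => //= _ [].
  apply/trivIsetP => i j _ _ ij; apply/seteqP; split => w //= -[/FZ Zi /FZ Zj].
  by rewrite -Zi -Zj eqxx in ij.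
rewrite measure_semi_bigcup//; last exact: bigcup_measurable.
apply: eq_eseriesr => k _.
rewrite /F; case: ifP => _; first by rewrite measure0 mulr0.
rewrite -/(B k) -/Z EFinM muleC setIC.
apply: etrans (_ : P (B k) * P (Z n @^-1` [set k]) = _)%E; last by congr (_ * _)%E; exact: prE.
apply: X_Z_indep.
- have m1 : measurable_fun setT ((fun w => \sum_(i <- iota 0 k) X i w) : g_sigma_algebraType (block_gen X setT) -> R).
    apply: measurable_sum => i; exact: (@measurable_block _ _ _ _ _ X setT i Logic.I).
  exact: (measurable_ge (k%:R * eps) m1).
- have m2 := (@measurable_block _ _ _ _ _ Z setT n Logic.I).
  have /measurable_natP := m2; exact.
Qed.

End immigration_process.

(** * Averages over a critical population *)

Lemma squeeze_cvg0 {R : realType} (u v : nat -> R) (D : R) :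
  (forall n, 0 <= u n <= D * v n) -> v n @[n --> \oo] --> 0 -> u n @[n --> \oo] --> 0.
Proof.
move=> uv v0; apply: (squeeze_cvgr (f := cst 0) (h := fun n => D * v n)).
- by near=> n; exact: uv.
- exact: cvg_cst.
- suff : D * v n @[n --> \oo] --> D * 0 by rewrite mulr0.
  by apply: cvgM; [exact: cvg_cst|exact: v0].
Unshelve. all: end_near. Qed.

Lemma cvg_invr_ln {R : realType} : (ln n%:R)^-1 @[n --> \oo] --> (0 : R).
Proof.
apply/cvgrPdist_le => e e0; exists (Num.truncn (expR e^-1)).+1 => // n /= Nn.
have en : expR e^-1 <= n%:R.
  by apply: le_trans (ltW (truncnS_gt _)) _; rewrite ler_nat.
have n0 : 0 < n%:R :> R by apply: lt_le_trans en; exact: expR_gt0.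
have le : e^-1 <= ln n%:R by rewrite -[leLHS]expRK ler_ln ?posrE ?expR_gt0.
have l0 : 0 < ln n%:R :> R by apply: lt_le_trans le; rewrite invr_gt0.
rewrite sub0r normrN gtr0_norm ?invr_gt0//.
by rewrite -[leRHS]invrK lef_pV2 ?posrE ?invr_gt0.
Qed.

Lemma cvg_powRN {R : realType} (q : R) : 0 < q -> n%:R `^ (- q) @[n --> \oo] --> (0 : R).
Proof.
move=> q0; apply/cvgrPdist_le => e e0; have [K K0 hK] := powRN_small q0 e0.
by exists K => // n /= /hK; rewrite sub0r normrN ger0_norm ?powR_ge0.
Qed.

Section critical_weights.
Context {R : realType}.
Variables (gam sig : R) (H : nat -> R -> R) (a : nat -> nat -> R).
Hypotheses (gam_gt0 : 0 < gam) (sig_gt1 : 1 < sig)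
  (asym : critical_asymptotics gam sig H)
  (a_sub : forall n, subprobability_weights (a n))
  (HE : forall n (t : R), 0 < t <= 1 -> wsum (a n) (fun k => (1 - t) ^+ k) = H n t).
Variables (B : nat -> R) (c r : R).
Hypotheses (c_gt0 : 0 < c) (B01 : forall k, 0 <= B k <= 1)
  (B_equiv : B k * k%:R `^ r @[k --> \oo] --> c).

Let sig_gt0 : 0 < sig. Proof. exact: lt_trans sig_gt1. Qed.

Lemma weighted_average_gt : sig < r ->
  exists2 q : R, 0 < q & n%:R `^ sig * wsum (a n) B @[n --> \oo] --> q.
Proof.
move=> sr; have c2 : 0 < c / 2 by rewrite divr_gt0.
have r0 : 0 < r by apply: lt_trans sr.
have /cvgrPdist_le/(_ _ c2)[K _ hK] := B_equiv.
have E k : (0 < k)%N -> B k = B k * k%:R `^ r * k%:R `^ (- r).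
  by move=> k0; rewrite powRN mulfK// gt_eqF// powR_gt0// ltr0n.
(* 2 c serves for k >= K; below K the bound B <= 1 is enough, as 1 <= (K + 1)^r k^-r. *)
pose D := Num.max (2 * c) (K.+1%:R `^ r).
apply: (moment_cvg_gt0 gam_gt0 sig_gt0 asym a_sub HE (r := r) (D := D) (d := c / 2) (K := K.+1) (M := 1)) => //.
- move=> k k0; have pk := powR_ge0 (k%:R : R) (- r).
  have [Kk|kK] := leqP K k.
    rewrite E// ler_wpM2r// le_max; apply/orP; left.
    by have := hK k Kk; rewrite ler_norml; lra.
  apply: (@le_trans _ _ 1); first by have /andP[] := B01 k.
  apply: (@le_trans _ _ (K.+1%:R `^ r * k%:R `^ (- r))).
    rewrite powRN ler_pdivlMr ?powR_gt0 ?ltr0n// mul1r.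
    apply: ge0_ler_powR; rewrite ?nnegrE ?ler0n ?(ltW r0)//.
    by rewrite ler_nat; apply: ltnW; exact: leqW.
  by rewrite ler_wpM2r// le_max lexx orbT.
- move=> k Kk; rewrite [leRHS]E ?(leq_trans _ Kk)// ler_wpM2r ?powR_ge0//.
  by have := hK k (ltnW Kk); rewrite ler_norml; lra.
Qed.

Lemma weighted_average_eq : r = sig ->
  n%:R `^ sig / ln n%:R * wsum (a n) B @[n --> \oo] --> c * (gam `^ (- sig) / Gamma sig).
Proof.
(* Nonnegativity must hold for every n; at n = 0 and n = 1 the logarithm is 0 and so is its
   inverse. *)
move=> rE; have ln0 n : 0 <= (ln n%:R)^-1 :> R.
  by rewrite invr_ge0; case: n => [|n]; [rewrite ln0|rewrite ln_ge0// ler1n].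
apply: (moment_equivalent a_sub (r := sig) (M := 1)) => //.
- by move=> n; rewrite mulr_ge0 ?powR_ge0.
- exact: (harmonic_moment_cvg_log gam_gt0 sig_gt1 asym a_sub HE).
- move=> k; have [D D0 hD] := scaled_weight_bounded gam_gt0 sig_gt0 asym a_sub HE k.
  apply: (@squeeze_cvg0 _ _ (fun n => (ln n%:R)^-1) D _ cvg_invr_ln) => n.
  have a0 : 0 <= a n k by have [] := a_sub n.
  by rewrite mulrAC ler_wpM2r// andbT !mulr_ge0// powR_ge0.
- by rewrite -rE.
Qed.

Lemma weighted_average_lt : 1 < r -> r < sig -> exists2 l : R,
  (\int[lebesgue_measure]_(s in `]0%R, +oo[)
     ((1 + gam * s) `^ (- sig) * s `^ (r - 1))%:E = l%:E)%E &
  n%:R `^ r * wsum (a n) B @[n --> \oo] --> c * (l / Gamma r).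
Proof.
move=> r1 rs.
have [l lE hl] := harmonic_moment_cvg gam_gt0 sig_gt1 asym a_sub HE r1 rs.
exists l => //; apply: (moment_equivalent a_sub (r := r) (M := 1)) => //.
- exact: lt_trans r1.
- move=> k; have [D D0 hD] := scaled_weight_bounded gam_gt0 sig_gt0 asym a_sub HE k.
  have sr0 : 0 < sig - r by rewrite subr_gt0.
  apply: (@squeeze_cvg0 _ _ (fun n => n%:R `^ (- (sig - r))) D _ (cvg_powRN sr0)) => n.
  have a0 : 0 <= a n k by have [] := a_sub n.
  rewrite mulr_ge0 ?powR_ge0//=.
  have [->|n0] := posnP n.
    rewrite powR0 ?mul0r ?gt_eqF ?(lt_trans _ r1)//.
    by rewrite mulr_ge0 ?powR_ge0 ?(ltW D0).
  (* For r < sig the normalisation is weaker than n^sig, so each individual weight vanishes in the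
     limit. *)
  have -> : n%:R `^ r = n%:R `^ sig * n%:R `^ (- (sig - r)) :> R.
    by rewrite -powRD ?pnatr_eq0 ?gtn_eqF ?implybT//; congr (_ `^ _); ring.
  by rewrite mulrAC ler_wpM2r ?powR_ge0.
Qed.

End critical_weights.

(** * The three tail regimes *)

Local Open Scope ereal_scope.

Theorem corollary1p6 (R : realType) (d : measure_display)
    (T : measurableType d) (P : probability T R)
    (xi : nat -> nat -> {RV P >-> nat}) (Y : nat -> {RV P >-> nat})
    (X : nat -> {RV P >-> R}) (beta gamma sigma eps : R)
    (xi_iid : iid (fun k : nat * nat => xi k.1 k.2))
    (Y_iid : iid Y)
    (Y_xi_indep : independent_families P Y (fun k : nat * nat => xi k.1 k.2))
    (A : condition_A (law_nat (xi 0%N 0%N)) (law_nat (Y 0%N))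
           'E_P[fun w => ((xi 0%N 0%N w)%:R : R)] beta gamma)
    (sigmaE : sigma = (beta / gamma)%R) (sigma_gt1 : (1 < sigma)%R)
    (X_iid : iid X)
    (X_Z_indep : independent_families P X (gwi xi Y))
    (EX : 'E_P[X 0%N] = 0)
    (EX2 : 0 < 'E_P[fun w => (X 0%N w ^+ 2)%R] < +oo)
    (eps_gt0 : (0 < eps)%R) :
  let L := random_mean (gwi xi Y) X in
  let PL n := P [set w | (eps <= L n w)%R] in
  [/\ forall a alpha : R, (1 + sigma < alpha)%R ->
        tail_index (X 0%N) a alpha ->
        exists2 q : R, (0 < q)%R &
          (n%:R `^ sigma)%:E * PL n @[n --> \oo] --> q%:E,
      forall a alpha : R, alpha = (1 + sigma)%R ->
        tail_index (X 0%N) a alpha ->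
        (n%:R `^ sigma / ln n%:R)%:E * PL n @[n --> \oo] -->
          (eps `^ (- (sigma + 1)) * a)%:E * I_const gamma sigma sigma /\
        (eps `^ (- (sigma + 1)) * a)%:E * I_const gamma sigma sigma < +oo &
      forall a alpha : R, (2 < alpha < 1 + sigma)%R ->
        tail_index (X 0%N) a alpha ->
        (n%:R `^ (alpha - 1))%:E * PL n @[n --> \oo] -->
          (eps `^ (- alpha) * a)%:E * I_const gamma (alpha - 1) sigma /\
        (eps `^ (- alpha) * a)%:E * I_const gamma (alpha - 1) sigma < +oo].
Proof.
move=> L PL.
case: A => _ [p01 h01] mE [beta0 hbeta gamma0 pgamma] [plog hsqr].
pose p := law_nat (xi 0%N 0%N); pose h := law_nat (Y 0%N).
have [_ p1] := law_weights P (N := xi 0%N 0%N) ltac:(by []).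
have [_ h1] := law_weights P (N := Y 0%N) ltac:(by []).
have law0 (N : {RV P >-> nat}) k : (0 <= law_nat N k)%R by exact: pr_ge0.
have lawg (N : {RV P >-> nat}) : geometrically_bounded (law_nat N).
  move=> K /andP[K0 K1]; exists 1%R => k; rewrite -[leRHS]mulr1 ler_pM ?exprn_ge0 ?exprn_ile1 ?(ltW K0) ?(ltW K1)//.
  apply: pr_le1; have mN : measurable_fun setT N by [].
  exact: ((measurable_natP N).1 mN [set k]).
have p_mean : has_psum p (fun k => k%:R) 1%R.
  move: mE; rewrite unlock (@integral_nat_function _ _ _ P _ (fun k => k%:R))// => mE.
  have [||hp ep] := @nneseries_has_psum R p (fun k => k%:R) (law0 _) => //.
    by rewrite mE ltry.
  have e1 : psum p (fun k => k%:R) = 1%R by apply: EFin_inj; rewrite -ep mE.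
  by rewrite -[X in has_psum _ _ X]e1.
have h_mean := gen_fun_deriv1_psum (law0 _) (lawg _) hbeta.
have p_var := gen_fun_deriv2_psum (law0 _) (lawg _) pgamma.
have p_log : exists M : R, has_psum p (fun k => k%:R ^+ 2 * ln k%:R)%R M.
  exists (psum p (fun k => k%:R ^+ 2 * ln k%:R)%R).
  have q0 k : (0 <= (k%:R : R) ^+ 2 * ln k%:R)%R.
    by case: k => [|k]; rewrite ?expr0n ?mul0r// mulr_ge0 ?sqr_ge0// ln_ge0// ler1n.
  have [|hp _] := @nneseries_has_psum R p _ (law0 _) q0; last exact: hp.
  (* The series of condition (A) starts at 1; the term at 0 vanishes. *)
  rewrite nneseries_recl//; last by move=> k _; rewrite lee_fin mulr_ge0// law0.
  rewrite expr0n/= mul0r mulr0 add0e.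
  by under eq_eseriesr do rewrite mulrA.
have h_sqr : exists M : R, has_psum h (fun k => k%:R ^+ 2)%R M.
  exists (psum h (fun k => k%:R ^+ 2)%R).
  have q0 k : (0 <= (k%:R : R) ^+ 2)%R by exact: sqr_ge0.
  have [|hp _] := @nneseries_has_psum R h _ (law0 _) q0; last exact: hp.
  rewrite nneseries_recl//; last by move=> k _; rewrite lee_fin mulr_ge0// law0.
  by rewrite expr0n/= mulr0 add0e.
have betaE : beta = (sigma * gamma)%R by rewrite sigmaE divfK// gt_eqF.
have asym := offspring_traj_prod_asymptotics (law0 _) (law0 _) p1 h1 p_mean h_mean p_var
  p01 (proj1 (andP h01)) p_log h_sqr gamma0 beta0 betaE.
pose a n k := pr P (gwi xi Y n @^-1` [set k]).
have a_sub n : subprobability_weights (a n) by have [] := law_weights P (measurable_gwi xi Y n).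
pose H := traj_prod (fun t => 1 - psum p (fun k => (1 - t) ^+ k))%R
  (fun t => psum h (fun k => (1 - t) ^+ k))%R.
have HE n (t : R) : (0 < t <= 1)%R -> wsum (a n) (fun k => (1 - t) ^+ k)%R = H n t.
  by move=> /andP[t0 t1]; apply: (gwi_generating_function xi_iid Y_iid Y_xi_indep); rewrite (ltW t0).
pose S k := [set w | (k%:R * eps <= \sum_(i <- iota 0 k) X i w)%R].
pose B k := if k == 0%N then 0%R else pr P (S k).
have mS k : measurable (S k) by apply: measurable_ge; exact: measurable_sum.
have B01 k : (0 <= B k <= 1)%R.
  by rewrite /B; case: ifP => _; rewrite ?lexx ?ler01// pr_ge0 pr_le1.
have PLE n : PL n = (wsum (a n) B)%:E.
  by rewrite /PL (random_mean_law X_Z_indep)// -(wsumE (M := 1)).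
have EXi : \int[P]_w (X 0%N w)%:E = 0 by move: EX; rewrite unlock.
have EX2i : \int[P]_w (X 0%N w ^+ 2)%:E = (fine (\int[P]_w (X 0%N w ^+ 2)%:E))%:E.
  move: EX2; rewrite unlock => /andP[e0 e1]; rewrite fineK// ge0_fin_numE//; exact: ltW.
have Xid i (C : set R) : measurable C -> P (X i @^-1` C) = P (X 0%N @^-1` C).
  by move=> mC; exact: X_iid.2.
have B_equiv b alpha : (0 < alpha)%R -> tail_index (X 0%N) b alpha ->
    (0 < b * eps `^ (- alpha))%R /\
    (B k * k%:R `^ (alpha - 1))%R @[k --> \oo] --> (b * eps `^ (- alpha))%R.
  move=> al0 [b0 tl]; split; first by rewrite mulr_gt0// powR_gt0.
  (* For x > 0 the events x <= max(X, 0) and x <= X coincide. *)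
  have tl' : (pr P [set w | (x <= X 0%N w)%R] / (b * x `^ (- alpha)))%R @[x --> +oo%R] --> (1 : R)%R.
    apply: cvg_trans tl; apply: near_eq_cvg; near=> x.
    have x0 : (0 < x)%R by near: x; exact: nbhs_pinfty_gt.
    congr (fine (P _) / _)%R; apply/seteqP; split => w /=; rewrite le_max.
      by move=> /orP[//|]; rewrite leNgt x0.
    by move=> ->.
  have mX i : measurable_fun setT (X i) by [].
  apply: cvg_trans (average_asymptotics mX X_iid.1 Xid EXi EX2i b0 al0 tl' eps_gt0).
  apply: near_eq_cvg; near=> k; rewrite /B gtn_eqF//.
  by near: k; exact: nbhs_infty_gt.
have toE (u : nat -> R) (l : R) : (u n * wsum (a n) B)%R @[n --> \oo] --> l ->
    (u n)%:E * PL n @[n --> \oo] --> l%:E.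
  move=> ul; apply/fine_cvgP; split; first by near=> n; rewrite PLE.
  by apply: cvg_trans ul; apply: near_eq_cvg; near=> n; rewrite /= PLE.
split => b alpha.
- move=> al tl; have al0 : (0 < alpha)%R by lra.
  have [c0 Bc] := B_equiv _ _ al0 tl.
  have sr : (sigma < alpha - 1)%R by lra.
  have [q q0 hq] := weighted_average_gt gamma0 sigma_gt1 asym a_sub HE c0 B01 Bc sr.
  by exists q => //; exact: toE.
- move=> alE tl; have al0 : (0 < alpha)%R by lra.
  have [c0 Bc] := B_equiv _ _ al0 tl.
  (* The exponent r of the harmonic moment is alpha - 1, so its comparison with sigma separates the
     three cases. *)
  have rs : (alpha - 1)%R = sigma by rewrite alE; ring.
  have hq := weighted_average_eq gamma0 sigma_gt1 asym a_sub HE B01 Bc rs.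
  have -> : (eps `^ (- (sigma + 1)) * b)%:E * I_const gamma sigma sigma
      = (b * eps `^ (- alpha) * (gamma `^ (- sigma) / Gamma sigma))%:E.
    by rewrite /I_const eqxx alE [(sigma + 1)%R]addrC -!EFinM; congr (_%:E); ring.
  by split; [exact: toE|exact: ltry].
- move=> /andP[al2 als] tl; have al0 : (0 < alpha)%R by lra.
  have [c0 Bc] := B_equiv _ _ al0 tl.
  have r1 : (1 < alpha - 1)%R by lra.
  have rs : (alpha - 1 < sigma)%R by lra.
  have [l lE hl] := weighted_average_lt gamma0 sigma_gt1 asym a_sub HE B01 Bc r1 rs.
  have -> : (eps `^ (- alpha) * b)%:E * I_const gamma (alpha - 1) sigma
      = (b * eps `^ (- alpha) * (l / Gamma (alpha - 1)))%:E.
    rewrite /I_const lt_eqF// lE -!EFinM; congr (_%:E); ring.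
  by split; [exact: toE|exact: ltry].
Unshelve. all: end_near. Qed.
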